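(* Let $L$ be a finite-dimensional restricted Lie algebra over a field $\mathbb{F}$ of prime characteristic. Then the following statements are equivalent: (i) $L$ is solvable. (ii) $H^1(L/\operatorname{Ann}_L(S),S)=0$ for every non-trivial irreducible restricted $L$-module $S$. (iii) $\dim_{\mathbb{F}} H^1(L,S)=\dim_{\mathbb{F}}\operatorname{End}_L(S)\cdot[L:S]_{\rm split}$ holds for every non-trivial irreducible restricted $L$-module $S$. (iv) $H_*^1(L/\operatorname{Ann}_L(S),S)=0$ for every non-trivial irreducible restricted $L$-module $S$. (v) $H_*^1(L/\operatorname{Ann}_L(S),S)=0$ for every non-trivial irreducible restricted $L$-module $S$ belonging to the principal block of $L$. (vi) $\dim_{\mathbb{F}} H_*^1(L,S)=\dim_{\mathbb{F}}\operatorname{End}_L(S)\cdot[L:S]_{\rm split}$ holds for every non-trivial irreducible restricted $L$-module $S$. (vii) $\dim_{\mathbb{F}} H_*^1(L,S)=\dim_{\mathbb{F}}\operatorname{End}_L(S)\cdot[L:S]_{\rm split}$ holds for every non-trivial irreducible restricted $L$-module $S$ belonging to the principal block of $L$. (viii) $[\operatorname{Jac}(u(L))P_L(\mathbb{F})/\operatorname{Jac}(u(L))^2P_L(\mathbb{F}):S]=[L:S]_{\rm split}$ holds for every non-trivial irreducible restricted $L$-module $S$. (ix) $[\operatorname{Jac}(u(L))P_L(\mathbb{F})/\operatorname{Jac}(u(L))^2P_L(\mathbb{F}):S]=[L:S]_{\rm split}$ holds for every non-trivial irreducible restricted $L$-module $S$ belonging to the principal block of $L$.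
   Context: $H^n(L,M)$ denotes the ordinary (Chevalley–Eilenberg) cohomology of a Lie algebra $L$ with coefficients in an $L$-module $M$. For a finite-dimensional restricted Lie algebra $L$ (with $p$-map $x\mapsto x^{[p]}$) over $\mathbb{F}$, $u(L)$ denotes its restricted universal enveloping algebra, a finite-dimensional unital associative algebra whose modules are exactly the restricted $L$-modules. The restricted cohomology of $L$ with coefficients in a restricted $L$-module $M$ is $H_*^n(L,M):=\operatorname{Ext}_{u(L)}^n(\mathbb{F},M)$, where $\mathbb{F}$ is the trivial irreducible $L$-module. ''Non-trivial'' means not isomorphic to $\mathbb{F}$. $\operatorname{Ann}_L(S):=\{x\in L\mid x\cdot s=0 \text{ for all } s\in S\}$; for a restricted module $S$ it is a $p$-ideal, so $L/\operatorname{Ann}_L(S)$ is a restricted Lie algebra and $S$ is a restricted module for it. $\operatorname{Jac}(A)$ denotes the Jacobson radical of a finite-dimensional associative algebra $A$. $P_L(\mathbb{F}):=P_{u(L)}(\mathbb{F})$ denotes the projective cover of the trivial irreducible $L$-module as a $u(L)$-module. $[M:S]$ denotes the multiplicity of $S$ as a composition factor of $M$. The principal block of $L$ is the block of $u(L)$ (i.e. of the decomposition of $u(L)$ into indecomposable two-sided ideals) to which the trivial irreducible module $\mathbb{F}$ belongs. A chief series of a finite-dimensional Lie algebra $L$ is an ascending chain $0=L_0\subset L_1\subset\cdots\subset L_n=L$ of (ordinary) ideals of $L$ such that $L_j/L_{j-1}$ is a minimal (non-zero) ideal of $L/L_{j-1}$ for every $1\le j\le n$; each $L_j/L_{j-1}$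 is called a chief factor, and it is an $L$-module via the adjoint action. It is called an abelian chief factor if it is an abelian Lie algebra. For a finite-dimensional irreducible $L$-module $S$ and a given chief series of $L$, $[L:S]_{\rm split}$ denotes the number of indices $j$ such that $L_j/L_{j-1}$ is an abelian chief factor isomorphic to $S$ as an $L$-module and the exact sequence $0\to L_j/L_{j-1}\to L/L_{j-1}\to L/L_j\to 0$ splits in the category of (ordinary) Lie algebras. This number does not depend on the choice of the chief series. *)

(* Defs.v *)
From HB Require Import structures.
From mathcomp Require Import all_boot all_order all_algebra falgebra.
From mathcomp Require Import boolp.

Set Implicit Arguments.
Unset Strict Implicit.
Unset Printing Implicit Defensive.

Import GRing.Theory.
Local Open Scope ring_scope.

Definition subspace_pred (F : fieldType) (V : vectType F) (Q : V -> Prop) :=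
  Q 0 /\ forall a u v, Q u -> Q v -> Q (a *: u + v).

Lemma lfunZE (F : fieldType) (U V : vectType F) (a : F) (f : 'Hom(U, V)) u :
  (a *: f) u = a *: f u.
Proof. exact: scale_lfunE. Qed.

Lemma lfunZDE (F : fieldType) (U V : vectType F) (a : F) (f g : 'Hom(U, V)) u :
  (a *: f + g) u = a *: f u + g u.
Proof. by rewrite add_lfunE scale_lfunE. Qed.

Lemma max_nat_ex (P : nat -> Prop) (b : nat) :
  (exists n, P n) -> (forall n, P n -> (n <= b)%N) ->
  exists2 n, P n & forall m, P m -> (m <= n)%N.
Proof.
move=> [n0 Pn0] Pb.
have ex : exists n, `[< P n >] by exists n0; apply/asboolP.
have ub n : `[< P n >] -> (n <= b)%N by move/asboolP; apply: Pb.
case: (ex_maxnP ex ub) => n /asboolP Pn nmax.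
by exists n => // m Pm; apply: nmax; apply/asboolP.
Qed.

Lemma min_nat_ex (P : nat -> Prop) :
  (exists n, P n) -> exists2 n, P n & forall m, P m -> (n <= m)%N.
Proof.
move=> [n0 Pn0]; have ex : exists n, `[< P n >] by exists n0; apply/asboolP.
case: (ex_minnP ex) => n /asboolP Pn nmin.
by exists n => // m Pm; apply: nmin; apply/asboolP.
Qed.

Lemma vspace_of_subproof (F : fieldType) (V : vectType F) (Q : V -> Prop) :
  subspace_pred Q -> exists W : {vspace V}, forall v, v \in W <-> Q v.
Proof.
case=> Q0 QL.
pose P n := exists2 W : {vspace V}, (forall v, v \in W -> Q v) & \dim W = n.
have [||n [W WQ dW] nmax] := @max_nat_ex P (\dim {:V}).
- by exists 0%N, 0%VS; [move=> v; rewrite memv0 => /eqP-> | rewrite dimv0].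
- by move=> n [W _ <-]; rewrite dimvS // subvf.
exists W => v; split=> [|Qv]; first exact: WQ.
have sub : (W <= W + <[v]>)%VS by rewrite addvSl.
have : (\dim (W + <[v]>) <= n)%N.
  apply: nmax; exists (W + <[v]>)%VS => // w /memv_addP[w1 w1W [w2 w2v ->]].
  by case/vlineP: w2v => a ->; rewrite addrC; apply: QL => //; apply: WQ.
rewrite -dW => le; have /eqP -> : W == (W + <[v]>)%VS by rewrite eqEdim sub le.
by rewrite (subvP (addvSr _ _)) // memv_line.
Qed.

Definition vspace_of (F : fieldType) (V : vectType F) (Q : V -> Prop)
  (h : subspace_pred Q) : {vspace V} := projT1 (cid (vspace_of_subproof h)).

Lemma mem_vspace_of (F : fieldType) (V : vectType F) (Q : V -> Prop)
  (h : subspace_pred Q) v : v \in vspace_of h <-> Q v.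
Proof. by rewrite /vspace_of; case: (cid _). Qed.

Section Quotient.
Variables (F : fieldType) (V : vectType F) (W : {vspace V}).

(* V / W is realised on the complement W^C, with qproj the projection along W
   and qrepr the choice of representatives. *)
Definition quotv : vectType F := subvs_of (W^C)%VS.
Definition qproj : 'Hom(V, quotv) :=
  (linfun (vsproj (W^C)%VS) \o (\1 - projv W))%VF.
Definition qrepr : 'Hom(quotv, V) := linfun vsval.

Lemma qrepr_proj v : qrepr (qproj v) = v - projv W v.
Proof.
rewrite /qrepr /qproj comp_lfunE add_lfunE opp_lfunE id_lfunE !lfunE /=.
by rewrite vsprojK // memv_projC.
Qed.

Lemma qrepr_projB v : qrepr (qproj v) - v \in W.
Proof. by rewrite qrepr_proj addrAC subrr sub0r memvN memv_proj. Qed.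

Lemma qproj_eq0 v : (qproj v == 0) = (v \in W).
Proof.
apply/eqP/idP => [v0|vW].
  by have := qrepr_projB v; rewrite v0 linear0 sub0r memvN.
by apply: val_inj; rewrite -[LHS](lfunE vsval) -/qrepr qrepr_proj projv_id ?subrr.
Qed.

Lemma qreprK : cancel qrepr qproj.
Proof.
move=> q; apply: val_inj; rewrite -[LHS](lfunE vsval) -/qrepr qrepr_proj.
have -> : projv W (qrepr q) = 0.
  apply/eqP; rewrite -memv_ker lker_proj /qrepr lfunE /=; exact: subvsP.
by rewrite subr0 /qrepr lfunE.
Qed.

Lemma qproj_eq u v : u - v \in W -> qproj u = qproj v.
Proof. by move=> uvW; apply/eqP; rewrite -subr_eq0 -linearB qproj_eq0. Qed.

Lemma lker_qproj : lker qproj = W.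
Proof. by apply/vspaceP => v; rewrite memv_ker qproj_eq0. Qed.

Lemma limg_qproj : limg qproj = fullv.
Proof.
apply/vspaceP => q; rewrite memvf; apply/memv_imgP.
by exists (qrepr q); rewrite ?memvf // qreprK.
Qed.

End Quotient.

(* An [opmod F X] is a finite-dimensional F-space with an endomorphism for each
   x : X; modules over Lie and associative algebras are special cases, and
   submodules, factor modules, homomorphisms and composition series only depend
   on the family of operators. *)

Record opmod (F : fieldType) (X : Type) := OpMod {
  om_sort :> vectType F;
  op : X -> 'End(om_sort)
}.
Arguments op {F X M} : rename.

Section OpMod.
Variables (F : fieldType) (X : Type).
Implicit Types M N : opmod F X.

Definition stable M (W : {vspace M}) :=
  forall x v, v \in W -> op x v \in W.

Definition irreducible M :=
  {:M}%VS != 0%VS /\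
  forall W : {vspace M}, stable W -> W = 0%VS \/ W = fullv.

Definition om_hom M N (f : 'Hom(M, N)) :=
  forall x v, f (op x v) = op x (f v).

Definition om_iso M N :=
  exists f : 'Hom(M, N), [/\ om_hom f, lker f = 0%VS & limg f = fullv].

Lemma Homs_subproof M N : subspace_pred (@om_hom M N).
Proof.
split=> [x v|a f g hf hg x v]; first by rewrite !lfunE /= linear0.
by rewrite !add_lfunE !scale_lfunE hf hg linearP.
Qed.

Definition Homs M N : {vspace 'Hom(M, N)} := vspace_of (Homs_subproof M N).

Definition om_quot M (W : {vspace M}) : opmod F X :=
  OpMod (fun x => qproj W \o op x \o qrepr W)%VF.

Definition om_sub M (U : {vspace M}) : opmod F X :=
  @OpMod F X (subvs_of U)
    (fun x => linfun (vsproj U) \o op x \o linfun vsval)%VF.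

(* the factor U / W for W <= U, as the image of U in M / W *)
Definition om_factor M (W U : {vspace M}) : opmod F X :=
  om_sub (M := om_quot W) (qproj W @: U)%VS.

Definition comp_series M (n : nat) (c : nat -> {vspace M}) :=
  [/\ c 0 = 0%VS, c n = fullv,
      forall j, (j <= n)%N -> stable (c j) &
      forall j, (j < n)%N ->
        (c j <= c j.+1)%VS /\ irreducible (om_factor (c j) (c j.+1))].

Lemma om_quotE M (W : {vspace M}) x v : stable W ->
  op (M := om_quot W) x (qproj W v) = qproj W (op x v).
Proof.
move=> sW; rewrite /= 2!comp_lfunE; apply: (@qproj_eq _ _ W).
rewrite -linearB /=; apply: sW; exact: qrepr_projB.
Qed.

Lemma om_subE M (U : {vspace M}) x (v : om_sub U) : stable U ->
  vsval (op (M := om_sub U) x v) = op x (vsval v).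
Proof.
by move=> sU; rewrite /= !comp_lfunE !lfunE /= vsprojK //; apply/sU/subvsP.
Qed.

Lemma stable0 M : stable (0%VS : {vspace M}).
Proof. by move=> x v; rewrite memv0 => /eqP ->; rewrite linear0 mem0v. Qed.

Lemma stablef M : stable ({:M}%VS).
Proof. by move=> x v _; exact: memvf. Qed.

Lemma stable_qimg M (W U : {vspace M}) :
  stable W -> stable U -> stable (M := om_quot W) (qproj W @: U)%VS.
Proof.
move=> sW sU x _ /memv_imgP[u uU ->].
by rewrite om_quotE //; apply/memv_img/sU.
Qed.

Definition covers M (W U : {vspace M}) :=
  [/\ (W <= U)%VS, W != U &
    forall U' : {vspace M}, stable U' -> (W <= U')%VS -> (U' <= U)%VS ->
      U' = W \/ U' = U].

Lemma covers_ex M (W : {vspace M}) : stable W -> W != fullv ->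
  exists2 U : {vspace M}, stable U & covers W U.
Proof.
move=> sW nW.
pose P n := exists U : {vspace M},
  [/\ stable U, (W <= U)%VS, W != U & \dim U = n].
have [|n [U [sU WU nU dU]] nmin] := @min_nat_ex P.
  by exists (\dim {:M}), fullv; split=> //; [exact: stablef | exact: subvf].
exists U => //; split=> // U' sU' WU' U'U.
case: (eqVneq W U') => [->|nU']; first by left.
right; apply/eqP; rewrite eqEdim U'U dU; apply: nmin.
by exists U'.
Qed.

Lemma covers_chain M : exists (n : nat) (c : nat -> {vspace M}),
  [/\ c 0 = 0%VS, c n = fullv, forall j, (j <= n)%N -> stable (c j) &
      forall j, (j < n)%N -> covers (c j) (c j.+1)].
Proof.
suff: forall k (W : {vspace M}), stable W -> (\dim {:M} - \dim W <= k)%N ->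
  exists (n : nat) (c : nat -> {vspace M}),
  [/\ c 0 = W, c n = fullv, forall j, (j <= n)%N -> stable (c j) &
      forall j, (j < n)%N -> covers (c j) (c j.+1)].
  by move=> /(_ (\dim {:M}) 0%VS); apply; [exact: stable0 | rewrite leq_subr].
elim=> [|k IH] W sW; case: (eqVneq W fullv) => [Wf _|nW].
- by exists 0%N, (fun=> W); split=> // j; rewrite leqn0 => /eqP ->.
- rewrite leqn0 subn_eq0 => le; case/eqP: nW; apply/eqP.
  by rewrite eqEdim subvf.
- by exists 0%N, (fun=> W); split=> // j; rewrite leqn0 => /eqP ->.
- have [U sU WU le] := covers_ex sW nW.
  have [||n [c [c0 cn sc cc]]] := IH U => //.
    case: WU => WU nU _; rewrite -ltnS; apply: leq_trans le.
    have lt : (\dim W < \dim U)%N.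
      rewrite ltn_neqAle dimvS // andbT; apply: contra nU => /eqP dWU.
      by rewrite eqEdim WU dWU leqnn.
    by apply: ltn_sub2l => //; apply: leq_trans lt _; rewrite dimvS ?subvf.
  exists n.+1, (fun j => if j is i.+1 then c i else W); split=> //.
    by case.
  by case=> [|j] /=; rewrite ?c0 //; exact: cc.
Qed.

Lemma covers_irr M (W U : {vspace M}) : stable W -> stable U ->
  covers W U -> irreducible (om_factor W U).
Proof.
move=> sW sU [WU nU hU]; have sq := stable_qimg sW sU.
split.
  apply: contraNneq nU => f0; apply/eqP/subv_anti; rewrite WU /=.
  apply/subvP => u uU; rewrite -qproj_eq0.
  have qu : qproj W u \in (qproj W @: U)%VS by rewrite memv_img.
  have : vsproj (qproj W @: U)%VS (qproj W u) \in {:om_factor W U}%VS.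
    exact: memvf.
  by rewrite f0 memv0 => /eqP/(congr1 vsval); rewrite vsprojK // => ->.
move=> V sV.
pose pr := (linfun (vsproj (qproj W @: U)%VS) \o qproj W)%VF.
have prE v : v \in U -> vsval (pr v) = qproj W v.
  by move=> vU; rewrite comp_lfunE lfunE /= vsprojK // memv_img.
have prop x v : v \in U -> pr (op x v) = op (M := om_factor W U) x (pr v).
  move=> vU; apply: val_inj; rewrite [RHS]om_subE // ![\val _]prE ?sU //.
  by rewrite om_quotE.
have prS (y : om_factor W U) : exists2 u, u \in U & y = pr u.
  have /memv_imgP[u uU yu] : vsval y \in (qproj W @: U)%VS by exact: subvsP.
  by exists u => //; apply: val_inj; rewrite [RHS]prE.
have [||| U'W | U'U] := hU (U :&: pr @^-1: V)%VS.
- move=> x v; rewrite !memv_cap -!memv_preim => /andP[vU vV].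
  by rewrite sU //= prop // sV.
- apply/subvP => w wW; rewrite memv_cap (subvP WU) //= -memv_preim.
  suff -> : pr w = 0 by exact: mem0v.
  apply: val_inj; rewrite [LHS]prE ?(subvP WU) //; apply/eqP.
  by rewrite qproj_eq0.
- exact: capvSl.
- left; apply/vspaceP => y; rewrite memv0.
  apply/idP/eqP => [yV|->]; last exact: mem0v.
  have [u uU yu] := prS y; apply: val_inj; rewrite yu [LHS]prE //.
  apply/eqP; rewrite qproj_eq0 -U'W memv_cap uU /= -memv_preim -yu //.
- right; apply/vspaceP => y; rewrite memvf.
  have [u uU ->] := prS y.
  have : u \in (U :&: pr @^-1: V)%VS by rewrite U'U.
  by rewrite memv_cap -memv_preim => /andP[].
Qed.

Lemma comp_series_ex M :
  exists nc : nat * (nat -> {vspace M}), comp_series nc.1 nc.2.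
Proof.
have [n [c [c0 cn sc cc]]] := covers_chain M.
exists (n, c); split=> // j jn; have cj := cc _ jn; split; first by case: cj.
by apply: covers_irr => //; apply: sc => //; apply: ltnW.
Qed.

(* [M : S], read off a chosen composition series of M *)
Definition comp_mult M S : nat :=
  let nc := projT1 (cid (comp_series_ex M)) in
  #|[set j : 'I_nc.1 |
      `[< om_iso (om_factor (nc.2 j) (nc.2 j.+1)) S >]]|.

End OpMod.

Record lieAlgebra (F : fieldType) := LieAlgebra {
  la_sort :> vectType F;
  lie_ad : 'Hom(la_sort, 'End(la_sort));
  lie_alt : forall x, lie_ad x x = 0;
  lie_jacobi : forall x y z,
    lie_ad x (lie_ad y z) + lie_ad y (lie_ad z x) + lie_ad z (lie_ad x y) = 0
}.

Definition lbr (F : fieldType) (L : lieAlgebra F) (x y : L) : L :=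
  lie_ad L x y.

(* jac_coef x y m k is the coefficient of t^k in (ad (t x + y))^m (x). *)
Fixpoint jac_coef (F : fieldType) (L : lieAlgebra F) (x y : L) (m k : nat)
  : L :=
  match m with
  | 0 => if k == 0 then x else 0
  | m'.+1 => lbr y (jac_coef x y m' k) +
             (if k is k'.+1 then lbr x (jac_coef x y m' k') else 0)
  end.

(* Jacobson's s_i: (ad (t x + y))^(p-1) (x) = \sum_(1 <= i < p) i s_i t^(i-1). *)
Definition jac_s (F : fieldType) (L : lieAlgebra F) (p i : nat) (x y : L) : L :=
  (i%:R : F)^-1 *: jac_coef x y p.-1 i.-1.

Record restrictedLie (F : fieldType) (p : nat) := RestrictedLie {
  rl_lie :> lieAlgebra F;
  rl_char : p \in [pchar F];
  pmap : rl_lie -> rl_lie;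
  pmap_ad : forall x y, lbr (pmap x) y = iter p (lbr x) y;
  pmapZ : forall (a : F) x, pmap (a *: x) = a ^+ p *: pmap x;
  pmapD : forall x y,
    pmap (x + y) = pmap x + pmap y + \sum_(1 <= i < p) jac_s p i x y
}.
Arguments pmap {F p L} : rename.

Section LieTheory.
Variables (F : fieldType) (L : lieAlgebra F).
Implicit Types x y z : L.

Lemma lbrxx x : lbr x x = 0. Proof. exact: lie_alt. Qed.

Lemma lbr0 x : lbr x 0 = 0. Proof. exact: linear0. Qed.
Lemma lbrDr x y z : lbr x (y + z) = lbr x y + lbr x z.
Proof. exact: linearD. Qed.
Lemma lbrDl x y z : lbr (x + y) z = lbr x z + lbr y z.
Proof. by rewrite /lbr linearD add_lfunE. Qed.
Lemma lbrBl x y z : lbr (x - y) z = lbr x z - lbr y z.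
Proof. by rewrite /lbr linearB add_lfunE opp_lfunE. Qed.
Lemma lbrZl a x z : lbr (a *: x) z = a *: lbr x z.
Proof. by rewrite /lbr linearZ lfunZE. Qed.
Lemma lbrNr x y : lbr x (- y) = - lbr x y.
Proof. exact: linearN. Qed.

Lemma lbrC x y : lbr x y = - lbr y x.
Proof.
apply/eqP; rewrite -addr_eq0; have := lbrxx (x + y).
by rewrite lbrDl !lbrDr !lbrxx addr0 add0r => ->.
Qed.

Lemma lbrJ x y z : lbr (lbr x y) z = lbr x (lbr y z) - lbr y (lbr x z).
Proof.
have := lie_jacobi x y z; rewrite -!/(lbr _ _) => /eqP.
rewrite [lbr z (lbr x y)]lbrC [lbr z x]lbrC lbrNr subr_eq0 => /eqP <-.
by [].
Qed.

Definition adj : opmod F L := OpMod (fun x => lie_ad L x).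

Record ideal := Ideal { idl :> {vspace L}; idlP : stable (M := adj) idl }.

Lemma idl_br (I : ideal) x y : y \in (I : {vspace L}) ->
  lbr x y \in (I : {vspace L}).
Proof. exact: idlP. Qed.

Lemma idl_brl (I : ideal) x y : x \in (I : {vspace L}) ->
  lbr x y \in (I : {vspace L}).
Proof. by move=> xI; rewrite lbrC memvN idl_br. Qed.

Definition derived_term (U : {vspace L}) : {vspace L} :=
  <<[seq lbr x y | x <- vbasis U, y <- vbasis U]>>%VS.

Lemma mem_derived_term (U : {vspace L}) x y :
  x \in U -> y \in U -> lbr x y \in derived_term U.
Proof.
move=> xU yU; rewrite /lbr (coord_vbasis xU) linear_sum sum_lfunE.
apply: memv_suml => i _; rewrite linearZ lfunZE; apply: memvZ.
rewrite (coord_vbasis yU) linear_sum; apply: memv_suml => j _.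
rewrite linearZ; apply/memvZ/memv_span/allpairsP.
by exists ((vbasis U)`_i, (vbasis U)`_j); split; rewrite //= mem_nth ?size_tuple.
Qed.

Definition lie_solvable := exists k, iter k derived_term fullv = 0%VS.

End LieTheory.
Arguments derived_term {F L}.

Section LieQuotient.
Variables (F : fieldType) (L : lieAlgebra F) (I : ideal L).
Implicit Types q r : quotv I.

Let qad q : 'End(quotv I) :=
  (qproj I \o lie_ad L (qrepr I q) \o qrepr I)%VF.

Fact qad_linear : linear qad.
Proof.
move=> a q r; apply/lfunP => s.
rewrite lfunZDE /qad 6!comp_lfunE linearP /= linearP /=.
by rewrite lfunZDE linearP.
Qed.

Let qadl : {linear quotv I -> 'End(quotv I)} :=
  HB.pack qad (GRing.isLinear.Build F _ _ _ qad qad_linear).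

Let qadE q r : linfun qadl q r = qproj I (lbr (qrepr I q) (qrepr I r)).
Proof. by rewrite lfunE /= 2!comp_lfunE. Qed.

Let qbr_proj x y :
  qproj I (lbr (qrepr I (qproj I x)) (qrepr I (qproj I y))) =
  qproj I (lbr x y).
Proof.
apply: qproj_eq.
set x' := qrepr I _; set y' := qrepr I _.
have -> : lbr x' y' - lbr x y = lbr (x' - x) y' + lbr x (y' - y).
  by rewrite lbrBl lbrDr lbrNr addrA subrK.
by apply: memvD; [apply: idl_brl | apply: idl_br]; exact: qrepr_projB.
Qed.

Let qbr_projr x y : qproj I (lbr x (qrepr I (qproj I y))) = qproj I (lbr x y).
Proof.
apply: qproj_eq; rewrite -lbrNr -lbrDr; apply: idl_br; exact: qrepr_projB.
Qed.

Fact quot_alt q : linfun qadl q q = 0.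
Proof. by rewrite qadE lbrxx linear0. Qed.

Fact quot_jacobi q r s : linfun qadl q (linfun qadl r s) +
  linfun qadl r (linfun qadl s q) + linfun qadl s (linfun qadl q r) = 0.
Proof.
rewrite !qadE !qbr_projr.
have := congr1 (qproj I) (lie_jacobi (qrepr I q) (qrepr I r) (qrepr I s)).
by rewrite linear0 2!linearD.
Qed.

Definition quot_lie : lieAlgebra F := LieAlgebra quot_alt quot_jacobi.

Lemma quot_lbr x y :
  lbr (L := quot_lie) (qproj I x) (qproj I y) = qproj I (lbr x y).
Proof. by rewrite /lbr /= qadE qbr_proj. Qed.

End LieQuotient.

Section RestrictedTheory.
Variables (F : fieldType) (p : nat) (L : restrictedLie F p).

Lemma rl_prime : prime p. Proof. by case/andP: (rl_char L). Qed.

Record pideal := PIdeal {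
  pidl :> ideal L;
  pidlP : forall x, x \in (pidl : {vspace L}) ->
    pmap x \in (pidl : {vspace L})
}.

Variable I : pideal.

Definition quot_pmap (q : quot_lie I) : quot_lie I :=
  qproj I (pmap (qrepr I q)).

Lemma quot_jac_s i x y :
  jac_s (L := quot_lie I) p i (qproj I x) (qproj I y) = qproj I (jac_s p i x y).
Proof.
rewrite /jac_s linearZ; congr (_ *: _); move: (p.-1) (i.-1) => m.
elim: m => [|m IH] k /=; first by case: ifP => // _; rewrite linear0.
rewrite IH quot_lbr linearD /=; congr (_ + _).
by case: k => [|k]; rewrite ?linear0 // IH quot_lbr.
Qed.

Fact quot_pmap_ad q r : lbr (quot_pmap q) r = iter p (lbr q) r.
Proof.
rewrite -{1}(qreprK r) quot_lbr pmap_ad.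
have it n : iter n (lbr (L := quot_lie I) q) r =
            qproj I (iter n (lbr (qrepr I q)) (qrepr I r)).
  elim: n => [|n IH] /=; first by rewrite qreprK.
  by rewrite IH -{1}(qreprK q) quot_lbr.
by rewrite it.
Qed.

Fact quot_pmapZ (a : F) q : quot_pmap (a *: q) = a ^+ p *: quot_pmap q.
Proof. by rewrite /quot_pmap linearZ pmapZ linearZ. Qed.

Fact quot_pmapD q r : quot_pmap (q + r) =
  quot_pmap q + quot_pmap r + \sum_(1 <= i < p) jac_s p i q r.
Proof.
rewrite /quot_pmap linearD pmapD !linearD linear_sum; congr (_ + _).
by apply: eq_bigr => i _; rewrite -{2}(qreprK q) -{2}(qreprK r) quot_jac_s.
Qed.

Definition quot_rlie : restrictedLie F p :=
  RestrictedLie (rl_char L) quot_pmap_ad quot_pmapZ quot_pmapD.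

Lemma quot_pmapE x : pmap (L := quot_rlie) (qproj I x) = qproj I (pmap x).
Proof.
change (qproj I (pmap (qrepr I (qproj I x))) = qproj I (pmap x)).
set x' := qrepr I _.
have dI : x - x' \in (I : {vspace L}).
  by rewrite -memvN opprB qrepr_projB.
have -> : pmap x = pmap (x' + (x - x')) by rewrite addrC subrK.
rewrite pmapD 2!linearD /=.
have /eqP -> : qproj I (pmap (x - x')) == 0 by rewrite qproj_eq0 pidlP.
rewrite addr0 [X in _ + X](_ : _ = 0) ?addr0 //.
apply/eqP; rewrite qproj_eq0; apply: memv_suml => i _; apply: memvZ.
have : (0 < p.-1)%N by rewrite -subn1 subn_gt0 prime_gt1 ?rl_prime.
move: (x - x') (i.-1) (p.-1) dI => d k m dI; case: m => // m _.
have jacS (y z : L) n h : jac_coef y z n.+1 h = lbr z (jac_coef y z n h) +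
    (if h is h'.+1 then lbr y (jac_coef y z n h') else 0) by [].
elim: m k => [|m IH] k; rewrite jacS.
  apply: memvD; first exact: idl_brl.
  by case: k => [|[|k]] //=; rewrite ?mem0v // ?lbrxx ?lbr0 mem0v.
apply: memvD; first by apply: idl_br; exact: IH.
by case: k => [|k]; rewrite ?mem0v //; apply: idl_br; exact: IH.
Qed.

End RestrictedTheory.

Record lieModule (F : fieldType) (L : lieAlgebra F) := LieModule {
  lm_om :> opmod F L;
  lm_linear : linear (@op F L lm_om);
  lm_lbr : forall (x y : L) (v : lm_om),
    op (lbr x y) v = op x (op y v) - op y (op x v)
}.

Record restModule (F : fieldType) (p : nat) (L : restrictedLie F p) :=
  RestModule {
  rm_lm :> lieModule L;
  rm_pmap : forall (x : L) (v : rm_lm), op (pmap x) v = iter p (op x) v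
}.

Section Modules.
Variables (F : fieldType) (p : nat) (L : restrictedLie F p).

Definition triv_om : opmod F L := @OpMod F L F^o (fun=> 0).

Fact triv_linear : linear (@op F L triv_om).
Proof. by move=> a x y; rewrite /= scaler0 addr0. Qed.

Fact triv_lbr (x y : L) (v : triv_om) :
  op (lbr x y) v = op x (op y v) - op y (op x v).
Proof. by rewrite /= !lfunE /= subrr. Qed.

Definition triv_lm : lieModule L := LieModule triv_linear triv_lbr.

Fact triv_pmap (x : L) (v : triv_lm) : op (pmap x) v = iter p (op x) v.
Proof.
by rewrite -[X in iter X](prednK (prime_gt0 (rl_prime L))) /= !lfunE.
Qed.

Definition triv_rm : restModule L := RestModule triv_pmap.

Variable S : restModule L.

Fact opD (x y : L) : op (M := S) (x + y) = op x + op y.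
Proof. by have := lm_linear S 1 x y; rewrite !scale1r. Qed.

Fact op0 : op (M := S) (0 : L) = 0.
Proof.
by have := lm_linear S (-1) 0 0; rewrite scaler0 addr0 scaleN1r addNr.
Qed.

Fact ann_subproof :
  subspace_pred (fun x : L => forall s : S, op x s = 0).
Proof.
split=> [s|a u v hu hv s]; first by rewrite op0 zero_lfunE.
by rewrite (lm_linear S) lfunZDE hu hv scaler0 addr0.
Qed.

Definition ann_vs : {vspace L} := vspace_of ann_subproof.

Lemma annP x : x \in ann_vs <-> forall s : S, op x s = 0.
Proof. exact: mem_vspace_of. Qed.

Fact ann_stable : stable (M := adj L) ann_vs.
Proof.
move=> x y /annP hy; apply/annP => s.
by rewrite -[op x y]/(lbr x y) lm_lbr !hy linear0 subrr.
Qed.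

Definition ann_ideal : ideal L := Ideal ann_stable.

Fact ann_pmap x : x \in (ann_ideal : {vspace L}) ->
  pmap x \in (ann_ideal : {vspace L}).
Proof.
move/annP => hx; apply/annP => s; rewrite rm_pmap.
by rewrite -[X in iter X](prednK (prime_gt0 (rl_prime L))) /= hx.
Qed.

Definition Ann : pideal L := PIdeal ann_pmap.

Definition LAnn : restrictedLie F p := quot_rlie Ann.

Definition ann_om : opmod F LAnn :=
  @OpMod F LAnn S (fun q => op (qrepr Ann q)).

Lemma ann_omE x (s : S) : op (M := ann_om) (qproj Ann x) s = op (M := S) x s.
Proof.
change (op (qrepr Ann (qproj Ann x)) s = op x s).
rewrite -{1}[qrepr Ann _](subrK x) opD add_lfunE.
by have /annP -> := qrepr_projB Ann x; rewrite add0r.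
Qed.

Fact ann_linear : linear (@op F LAnn ann_om).
Proof. by move=> a q r; rewrite /= linearP (lm_linear S). Qed.

Fact ann_lbr (q r : LAnn) (v : ann_om) :
  op (lbr q r) v = op q (op r v) - op r (op q v).
Proof.
by rewrite -{1}(qreprK q) -{1}(qreprK r) quot_lbr ann_omE lm_lbr.
Qed.

Definition ann_lm : lieModule LAnn := LieModule ann_linear ann_lbr.

Fact ann_om_pmap (q : LAnn) (v : ann_lm) : op (pmap q) v = iter p (op q) v.
Proof. by rewrite -{1}(qreprK q) quot_pmapE ann_omE rm_pmap. Qed.

Definition ann_rm : restModule LAnn := RestModule ann_om_pmap.

End Modules.

(* Irreducible restricted modules are cyclic over the finite-dimensional algebra
   u(L), so ranging over finite-dimensional modules loses none of them. *)
Definition nontriv_irr (F : fieldType) (p : nat) (L : restrictedLie F p)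
  (S : restModule L) := irreducible S /\ ~ om_iso S (triv_rm L).

Section LieCohomology.
Variables (F : fieldType) (L : lieAlgebra F) (M : lieModule L).

Definition lie_cocycle (f : 'Hom(L, M)) :=
  forall x y, f (lbr x y) = op x (f y) - op y (f x).

Definition lie_coboundary (f : 'Hom(L, M)) :=
  exists m : M, forall x, f x = op x m.

Fact lie_cocycle_subspace : subspace_pred lie_cocycle.
Proof.
split=> [x y|a f g hf hg x y]; first by rewrite !zero_lfunE !linear0 addr0.
rewrite !lfunZDE hf hg !linearP /=.
by rewrite scalerBr scalerN addrACA.
Qed.

Fact lie_coboundary_subspace : subspace_pred lie_coboundary.
Proof.
split=> [|a f g [m hm] [n hn]]; first by exists 0 => x; rewrite zero_lfunE linear0.
by exists (a *: m + n) => x; rewrite !lfunZDE hm hn linearP.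
Qed.

Lemma lie_coboundary_cocycle f : lie_coboundary f -> lie_cocycle f.
Proof. by move=> [m hm] x y; rewrite !hm lm_lbr. Qed.

(* degree one of the Chevalley-Eilenberg complex: dim Z^1 - dim B^1 *)
Definition dim_H1 : nat :=
  (\dim (vspace_of lie_cocycle_subspace) -
   \dim (vspace_of lie_coboundary_subspace))%N.

End LieCohomology.

Section ChiefSeries.
Variables (F : fieldType) (L : lieAlgebra F).

Definition minimal_ideal (K : {vspace L}) :=
  [/\ stable (M := adj L) K, K != 0%VS &
    forall J : {vspace L}, stable (M := adj L) J -> (J <= K)%VS ->
      J = 0%VS \/ J = K].

Definition lie_hom (L' : lieAlgebra F) (f : 'Hom(L, L')) :=
  forall x y, f (lbr x y) = lbr (f x) (f y).

End ChiefSeries.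

Section ChiefSeries2.
Variables (F : fieldType) (L : lieAlgebra F).
Implicit Types I J : ideal L.

(* the ideal J / I of L / I *)
Definition quot_img I J : {vspace quot_lie I} := (qproj I @: J)%VS.

Definition chief_series (n : nat) (c : nat -> ideal L) :=
  [/\ c 0 = 0%VS :> {vspace L}, c n = fullv :> {vspace L} &
      forall j, (j < n)%N ->
        (c j <= c j.+1)%VS /\ minimal_ideal (quot_img (c j) (c j.+1))].

Definition abelian_factor I J :=
  forall q r, q \in quot_img I J -> r \in quot_img I J ->
    lbr (L := quot_lie I) q r = 0.

(* L / I -> L / J for I <= J *)
Definition qmap I J : 'Hom(quot_lie I, quot_lie J) :=
  (qproj J \o qrepr I)%VF.

(* 0 -> J / I -> L / I -> L / J -> 0 splits in the category of Lie algebras *)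
Definition lie_split I J :=
  exists2 s : 'Hom(quot_lie J, quot_lie I), lie_hom s & cancel s (qmap I J).

Definition split_mult (n : nat) (c : nat -> ideal L) (S : lieModule L) : nat :=
  #|[set j : 'I_n | `[< [/\ abelian_factor (c j) (c j.+1),
      om_iso (om_factor (M := adj L) (c j) (c j.+1)) S &
      lie_split (c j) (c j.+1)] >]]|.

Lemma chief_series_ex :
  exists (n : nat) (c : nat -> ideal L), chief_series n c.
Proof.
have [n [c [c0 cn sc cc]]] := covers_chain (adj L).
pose c' j : ideal L := if pselect (stable (M := adj L) (c j)) is left s
  then Ideal s else Ideal (@stable0 F L (adj L)).
have c'E j : (j <= n)%N -> c' j = c j :> {vspace L}.
  by move=> jn; rewrite /c'; case: pselect => // -[]; exact: sc.
exists n, c'; split; [by rewrite c'E | by rewrite c'E | move=> j jn].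
have [cj cU hU] := cc _ jn; rewrite !c'E ?(ltnW jn) //; split=> //.
rewrite /quot_img; move: (c' j) (c'E j (ltnW jn)) => I EI.
rewrite (c'E j.+1) //; move: (sc _ jn) cj cU hU.
rewrite -EI; move: (c j.+1) => U sU IU nIU hU.
split.
- move=> q _ /memv_imgP[u uU ->].
  rewrite -(qreprK q) -[op _ _]/(lbr _ _) quot_lbr; apply: memv_img.
  exact: sU.
- apply: contraNneq nIU => U0; apply/eqP/subv_anti; rewrite IU /=.
  by apply/subvP => u uU; rewrite -qproj_eq0 -memv0 -U0 memv_img.
- move=> J sJ JU.
  have [||| E | E] := hU (U :&: qproj I @^-1: J)%VS.
  + move=> x v; rewrite !memv_cap -!memv_preim => /andP[vU vJ].
    rewrite (sU x v vU) /= -[op x v]/(lbr x v) -quot_lbr; exact: sJ.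
  + apply/subvP => w wI; rewrite memv_cap (subvP IU) //= -memv_preim.
    by have /eqP -> : qproj I w == 0; [rewrite qproj_eq0 | exact: mem0v].
  + exact: capvSl.
  + left; apply/vspaceP => y; rewrite memv0.
    apply/idP/eqP => [yJ|->]; last exact: mem0v.
    have /memv_imgP[u uU yu] := subvP JU _ yJ.
    rewrite yu; apply/eqP; rewrite qproj_eq0 -E memv_cap uU -memv_preim -yu.
    exact: yJ.
  + right; apply/subv_anti; rewrite JU /=; apply/subvP => _ /memv_imgP[u uU ->].
    by move: uU; rewrite -{1}E memv_cap -memv_preim => /andP[].
Qed.

End ChiefSeries2.

Definition restricted_map (F : fieldType) (p : nat) (L : restrictedLie F p)
  (B : algType F) (f : L -> B) :=
  (forall x y, f (lbr x y) = f x * f y - f y * f x) /\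
  (forall x, f (pmap x) = f x ^+ p).

Definition is_renv (F : fieldType) (p : nat) (L : restrictedLie F p)
  (U : algType F) (i : {linear L -> U}) :=
  restricted_map i /\
  forall (B : algType F) (f : {linear L -> B}), restricted_map f ->
    exists2 g : {lrmorphism U -> B}, (forall x, g (i x) = f x) &
      forall g' : {lrmorphism U -> B}, (forall x, g' (i x) = f x) -> g' =1 g.

(* Existence: words of length at most n (p - 1) in a basis of L, with
   n = dim L, span the values of every restricted map, uniformly in the map.
   u(L) is the space of formal combinations of such words modulo those that
   vanish under all restricted maps. *)
Module RenvExists.
Section RenvExists.
Variables (F : fieldType) (p : nat) (L : restrictedLie F p).

Let n : nat := \dim {:L}.
Let e (i : 'I_n) : L := (vbasis {:L})`_i.

Definition fam := forall (B : algType F) (f : {linear L -> B}),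
  restricted_map f -> B.

Definition word (s : seq 'I_n) : fam :=
  fun B f _ => \prod_(i <- s) f (e i).

Definition inU (k : nat) (E : fam) := exists l : seq (F * seq 'I_n),
  all (fun x => size x.2 <= k)%N l /\
  forall B f hf, E B f hf = \sum_(x <- l) x.1 *: word x.2 hf.

Lemma inU_ext k E E' : (forall B f hf, E B f hf = E' B f hf) ->
  inU k E -> inU k E'.
Proof. by move=> EE' [l [lk El]]; exists l; split=> // B f hf; rewrite -EE'. Qed.

Lemma inU_mono k m E : (k <= m)%N -> inU k E -> inU m E.
Proof.
move=> km [l [lk El]]; exists l; split=> //.
by apply: sub_all lk => x /leq_trans; apply.
Qed.

Lemma inU0 k : inU k (fun B f hf => 0).
Proof. by exists [::]; split=> // B f hf; rewrite big_nil. Qed.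

Lemma inUD k E E' : inU k E -> inU k E' ->
  inU k (fun B f hf => E B f hf + E' B f hf).
Proof.
move=> [l [lk El]] [l' [lk' El']]; exists (l ++ l').
by rewrite all_cat lk lk'; split=> // B f hf; rewrite big_cat /= El El'.
Qed.

Lemma inUZ k a E : inU k E -> inU k (fun B f hf => a *: E B f hf).
Proof.
move=> [l [lk El]]; exists [seq (a * x.1, x.2) | x <- l].
split; first by rewrite all_map.
move=> B f hf; rewrite big_map El scaler_sumr.
by apply: eq_bigr => x _; rewrite scalerA.
Qed.

Lemma inU_sum k (I : Type) (r : seq I) (E : I -> fam) :
  (forall i, inU k (E i)) -> inU k (fun B f hf => \sum_(i <- r) E i B f hf).
Proof.
move=> h; elim: r => [|i r IH].
  by apply: inU_ext (inU0 k) => B f hf; rewrite big_nil.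
by apply: inU_ext (inUD (h i) IH) => B f hf; rewrite big_cons.
Qed.

Lemma inU_word s : inU (size s) (word s).
Proof.
exists [:: (1, s)]; split; first by rewrite /= leqnn.
by move=> B f hf; rewrite big_seq1 scale1r.
Qed.

Lemma word_cat s t B f hf : @word (s ++ t) B f hf = word s hf * word t hf.
Proof. exact: big_cat. Qed.

Lemma inUM k m E E' : inU k E -> inU m E' ->
  inU (k + m) (fun B f hf => E B f hf * E' B f hf).
Proof.
move=> [l [/allP lk El]] [l' [/allP lk' El']].
exists [seq (x.1 * y.1, x.2 ++ y.2) | x <- l, y <- l']; split.
  apply/allP => _ /allpairsP[[x y] [/= xl yl ->]] /=.
  by rewrite size_cat leq_add ?lk ?lk'.
move=> B f hf; rewrite El El' big_allpairs_dep mulr_suml.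
apply: eq_bigr => x _; rewrite mulr_sumr; apply: eq_bigr => y _ /=.
by rewrite word_cat -scalerAl -scalerAr scalerA.
Qed.

Lemma inU_f x : inU 1 (fun B f _ => f x).
Proof.
have E : x = \sum_i coord (vbasis {:L}) i x *: e i.
  by rewrite -coord_vbasis ?memvf.
pose G (i : 'I_n) : fam := fun B f hf => coord (vbasis {:L}) i x *: f (e i).
apply: inU_ext (@inU_sum 1 _ (index_enum 'I_n) G _).
  move=> B f hf; rewrite [in RHS]E linear_sum; apply: eq_bigr => i _.
  by rewrite linearZ.
move=> i; apply: inUZ; apply: inU_ext (inU_word [:: i]) => B f hf.
by rewrite /word big_seq1.
Qed.

Lemma inU_trans k m E : inU k E ->
  (forall s, (size s <= k)%N -> inU m (word s)) -> inU m E.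
Proof.
move=> [l [lk El]] h.
suff : inU m (fun B f hf => \sum_(x <- l) x.1 *: word x.2 hf).
  by apply: inU_ext => B f hf; rewrite El.
elim: l lk {El} => [|x l IH] /=.
  by move=> _; apply: inU_ext (inU0 m) => B f hf; rewrite big_nil.
case/andP => xk lk; apply: inU_ext (inUD (inUZ x.1 (h _ xk)) (IH lk)).
by move=> B f hf; rewrite big_cons.
Qed.

Lemma inU_swap i j s : inU (size s).+1
  (fun B f hf => word [:: i, j & s] hf - word [:: j, i & s] hf).
Proof.
apply: inU_ext (inUM (inU_f (lbr (e i) (e j))) (inU_word s)) => B f hf.
by rewrite hf.1 /word !big_cons mulrBl !mulrA.
Qed.

Lemma inU_move i s t : inU (size s + size t)
  (fun B f hf => word (i :: s ++ t) hf - word (s ++ i :: t) hf).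
Proof.
elim: s => [|j s IH] /=.
  by apply: inU_ext (inU0 _) => B f hf; rewrite subrr.
have h1 := inU_swap i j (s ++ t); rewrite size_cat in h1.
have h2 : inU (size s + size t).+1 _ := inUM (inU_word [:: j]) IH.
apply: inU_ext (inUD h1 h2) => B f hf.
by rewrite /word !big_cons big_nil mulr1 mulrBr addrA subrK.
Qed.

Lemma inU_perm s t : perm_eq s t ->
  inU (size s).-1 (fun B f hf => word s hf - word t hf).
Proof.
elim: s t => [|i s IH] t st.
  have -> : t = [::] by apply: perm_nilP; rewrite perm_sym.
  by apply: inU_ext (inU0 _) => B f hf; rewrite subrr.
have it : i \in t by rewrite -(perm_mem st) mem_head.
case/splitPr: it st => t1 t2 st.
have st' : perm_eq s (t1 ++ t2).
  by rewrite -(perm_cons i) (perm_trans st) // perm_sym -cat1s perm_catCA.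
have h1 := inU_move i t1 t2.
have h2 : inU (size s) (fun B f hf => word (i :: s) hf - word (i :: t1 ++ t2) hf).
  case: s IH st {st' h1} (st' : perm_eq s (t1 ++ t2)) => [|j s] IH st st'.
    have -> : t1 ++ t2 = [::] by apply: perm_nilP; rewrite perm_sym.
    by apply: inU_ext (inU0 _) => B f hf; rewrite subrr.
  have := inUM (inU_word [:: i]) (IH _ st'); rewrite /= add1n.
  by apply: inU_ext => B f hf; rewrite /word !big_cons big_nil mulr1 mulrBr.
move: h1; rewrite -size_cat -(perm_size st') => h1 /=.
by apply: inU_ext (inUD h2 h1) => B f hf; rewrite addrA subrK.
Qed.

Lemma inU_pow i s : (p <= count_mem i s)%N -> inU (size s).-1 (word s).
Proof.
move=> ps.
pose t := nseq (count_mem i s - p) i ++ [seq j <- s | j != i].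
have st : perm_eq s (nseq p i ++ t).
  have E : [seq j <- s | j == i] = nseq (count_mem i s) i.
    by rewrite -size_filter; exact/all_pred1P/filter_all.
  rewrite catA -nseqD subnKC // -E perm_sym.
  exact: permEl (perm_filterC (pred1 i) s).
have ss : size s = (p + size t)%N by rewrite (perm_size st) size_cat size_nseq.
have h1 : inU (1 + size t) (word (nseq p i ++ t)).
  apply: inU_ext (inUM (inU_f (pmap (e i))) (inU_word t)) => B f hf.
  rewrite [RHS]word_cat hf.2 [word (nseq p i) hf]/word.
  by rewrite big_nseq iter_mulr_1.
have h2 : (1 + size t <= (size s).-1)%N.
  move: (prime_gt1 (rl_prime L)); rewrite ss; case: (p) => [|[|q]] // _.
  by rewrite add1n !addSn /= ltnS leq_addl.
apply: inU_ext (inUD (inU_perm st) (inU_mono h2 h1)) => B f hf.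
by rewrite subrK.
Qed.

Let N := (n * p.-1)%N.

Lemma inU_words s : inU N (word s).
Proof.
have [k] := ubnP (size s); elim: k s => // k IH s sk.
case: (leqP (size s) N) => [sN|Ns]; first exact: inU_mono sN (inU_word s).
have [i pi] : exists i : 'I_n, (p <= count_mem i s)%N.
  apply/existsP; apply: contraLR Ns; rewrite negb_exists -leqNgt => /forallP h.
  have -> : size s = \sum_(i < n) count_mem i s.
    rewrite -sum1_size (eq_bigr (fun j => \sum_(i < n) (j == i))%N); last first.
      move=> j _; rewrite (bigD1 j) //= eqxx big1 // => i.
      by rewrite eq_sym => /negPf ->.
    rewrite exchange_big; apply: eq_bigr => i _.
    by rewrite -sum1_count [RHS]big_mkcond.
  rewrite /N -[X in (X * _)%N]card_ord -sum_nat_const; apply: leq_sum => i _.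
  by rewrite -ltnS prednK ?prime_gt0 ?(rl_prime L) // ltnNge.
apply: (inU_trans (inU_pow pi)) => t ts; apply: IH.
apply: leq_ltn_trans ts _; rewrite -ltnS prednK //.
exact: leq_ltn_trans Ns.
Qed.

Lemma inU_all k E : inU k E -> inU N E.
Proof. by move=> /inU_trans; apply=> s _; exact: inU_words. Qed.

Let T := {k : 'I_N.+1 & k.-tuple 'I_n}.
Let V := {ffun T -> F^o}.

Definition ev (v : V) : fam :=
  fun B f hf => \sum_t v t *: word (tagged t) hf.

Lemma evP a u v B f hf : @ev (a *: u + v) B f hf = a *: ev u hf + ev v hf.
Proof.
rewrite /ev scaler_sumr -big_split; apply: eq_bigr => t _.
by rewrite !ffunE /= scalerDl scalerA.
Qed.

Lemma ev0 B f hf : @ev 0 B f hf = 0.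
Proof. by rewrite /ev big1 // => t _; rewrite ffunE scale0r. Qed.

Fact ker_subproof : subspace_pred (fun v : V => forall B f hf, @ev v B f hf = 0).
Proof.
split=> [B f hf|a u v hu hv B f hf]; first exact: ev0.
by rewrite evP hu hv scaler0 addr0.
Qed.

Definition K := vspace_of ker_subproof.

Lemma ev_word s : (size s <= N)%N ->
  exists v : V, forall B f hf, @ev v B f hf = word s hf.
Proof.
move=> sN; pose t0 : T := Tagged (fun k : 'I_N.+1 => k.-tuple 'I_n)
  (in_tuple s : (Ordinal (sN : (size s < N.+1)%N)).-tuple 'I_n).
exists [ffun t => (t == t0)%:R] => B f hf.
rewrite /ev (bigD1 t0) //= ffunE eqxx scale1r big1 ?addr0 // => t /negPf nt.
by rewrite ffunE nt scale0r.
Qed.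

Lemma ev_surj k E : inU k E ->
  exists v : V, forall B f hf, @ev v B f hf = E B f hf.
Proof.
move/inU_all => [l [lN El]].
suff [v hv] : exists v : V, forall B f hf,
    @ev v B f hf = \sum_(x <- l) x.1 *: word x.2 hf.
  by exists v => B f hf; rewrite El.
elim: l lN {El} => [|x l IH] /=.
  by move=> _; exists 0 => B f hf; rewrite big_nil ev0.
case/andP => /ev_word[u hu] /IH[v hv]; exists (x.1 *: u + v) => B f hf.
by rewrite evP big_cons hu hv.
Qed.

Definition U : Type := quotv K.
HB.instance Definition _ := Vector.on U.

Definition evq (q : U) : fam := ev (qrepr K q).

Lemma evqP a q r B f hf :
  @evq (a *: q + r) B f hf = a *: evq q hf + evq r hf.
Proof. by rewrite /evq linearP evP. Qed.
Lemma evqD q r B f hf : @evq (q + r) B f hf = evq q hf + evq r hf.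
Proof. by rewrite -[q]scale1r evqP !scale1r. Qed.
Lemma evq0 B f hf : @evq 0 B f hf = 0.
Proof. by rewrite /evq linear0 ev0. Qed.
Lemma evqZ a q B f hf : @evq (a *: q) B f hf = a *: evq q hf.
Proof. by rewrite -[_ *: q]addr0 evqP evq0 addr0. Qed.

Lemma evq_inj q r : (forall B f hf, @evq q B f hf = evq r hf) -> q = r.
Proof.
move=> h; apply/eqP; rewrite -subr_eq0 -(qreprK (q - r)) qproj_eq0.
apply/mem_vspace_of => B f hf.
by rewrite -/(evq (q - r) hf) addrC -scaleN1r evqP h scaleN1r addNr.
Qed.

Lemma evq_ex k E : inU k E ->
  exists q : U, forall B f hf, @evq q B f hf = E B f hf.
Proof.
move=> /ev_surj[v hv]; exists (qproj K v) => B f hf.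
rewrite -hv /evq -[qrepr K _](subrK v) -[_ - v]scale1r evP scale1r.
by have /mem_vspace_of -> := qrepr_projB K v; rewrite add0r.
Qed.

Lemma inU_ev v : inU N (ev v).
Proof.
apply: inU_sum => t; apply: inUZ; exact: inU_words.
Qed.

Lemma mul_ex q r : exists q' : U,
  forall B f hf, @evq q' B f hf = evq q hf * evq r hf.
Proof. exact: evq_ex (inUM (inU_ev _) (inU_ev _)). Qed.

Lemma one_ex : exists q : U, forall B f hf, @evq q B f hf = 1.
Proof.
by apply: evq_ex (inU_ext _ (inU_word [::])) => B f hf; rewrite /word big_nil.
Qed.

Lemma gen_ex x : exists q : U, forall B f hf, @evq q B f hf = f x.
Proof. exact: evq_ex (inU_f x). Qed.

Definition mul q r : U := projT1 (cid (mul_ex q r)).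
Definition one : U := projT1 (cid one_ex).
Definition gen x : U := projT1 (cid (gen_ex x)).

Lemma mulE q r B f hf : @evq (mul q r) B f hf = evq q hf * evq r hf.
Proof. by rewrite /mul; case: (cid _). Qed.
Lemma oneE B f hf : @evq one B f hf = 1.
Proof. by rewrite /one; case: (cid _). Qed.
Lemma genE x B f hf : @evq (gen x) B f hf = f x.
Proof. by rewrite /gen; case: (cid _). Qed.

Fact mulA : associative mul.
Proof. by move=> q r s; apply: evq_inj => B f hf; rewrite !mulE mulrA. Qed.
Fact mul1 : left_id one mul.
Proof. by move=> q; apply: evq_inj => B f hf; rewrite !mulE oneE mul1r. Qed.
Fact mul1' : right_id one mul.
Proof. by move=> q; apply: evq_inj => B f hf; rewrite !mulE oneE mulr1. Qed.
Fact mulDl : left_distributive mul +%R.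
Proof.
by move=> q r s; apply: evq_inj => B f hf; rewrite evqD !mulE evqD mulrDl.
Qed.
Fact mulDr : right_distributive mul +%R.
Proof.
by move=> q r s; apply: evq_inj => B f hf; rewrite evqD !mulE evqD mulrDr.
Qed.

Fact triv_restricted : restricted_map (\0 : {linear L -> F^o}).
Proof.
split=> [x y|x] /=; first by rewrite mulr0 subr0.
by rewrite expr0n gtn_eqF ?prime_gt0 ?(rl_prime L).
Qed.

Fact one_neq0 : one != 0.
Proof.
apply/eqP => h; have := oneE triv_restricted; rewrite h evq0 => /eqP.
by rewrite eq_sym oner_eq0.
Qed.

HB.instance Definition _ := GRing.Zmodule_isNzRing.Build U
  mulA mul1 mul1' mulDl mulDr one_neq0.

Fact mulZl a (q r : U) : a *: (q * r) = (a *: q) * r.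
Proof.
by apply: evq_inj => B f hf; rewrite evqZ !mulE evqZ scalerAl.
Qed.
HB.instance Definition _ := GRing.Lmodule_isLalgebra.Build F U mulZl.

Fact mulZr a (q r : U) : a *: (q * r) = q * (a *: r).
Proof.
by apply: evq_inj => B f hf; rewrite evqZ !mulE evqZ scalerAr.
Qed.
HB.instance Definition _ := GRing.Lalgebra_isAlgebra.Build F U mulZr.
HB.instance Definition _ := Algebra_isFalgebra.Build F U.

Fact gen_linear : linear gen.
Proof.
by move=> a x y; apply: evq_inj => B f hf; rewrite evqP !genE linearP.
Qed.
HB.instance Definition _ := GRing.isLinear.Build F L U _ gen gen_linear.

Lemma evqM q r B f hf : @evq (q * r) B f hf = evq q hf * evq r hf.
Proof. exact: mulE. Qed.
Lemma evq1 B f hf : @evq 1 B f hf = 1.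
Proof. exact: oneE. Qed.

Lemma evqX q k B f hf : @evq (q ^+ k) B f hf = evq q hf ^+ k.
Proof. by elim: k => [|k IH]; rewrite ?evq1 // !exprS evqM IH. Qed.

Lemma gen_restricted : restricted_map gen.
Proof.
split=> [x y|x]; apply: evq_inj => B f hf.
  by rewrite addrC -scaleN1r evqP !evqM !genE hf.1 scaleN1r addrC.
by rewrite genE hf.2 evqX genE.
Qed.

Lemma gen_universal (B : algType F) (f : {linear L -> B}) :
  restricted_map f ->
  exists2 g : {lrmorphism U -> B}, (forall x, g (gen x) = f x) &
    forall g' : {lrmorphism U -> B}, (forall x, g' (gen x) = f x) -> g' =1 g.
Proof.
move=> hf; pose g0 (q : U) := evq q hf.
have g0L : linear g0 by move=> a q r; rewrite /g0 evqP.
have g0M : monoid_morphism g0.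
  by split; [exact: evq1 | move=> q r; exact: evqM].
pose g : {lrmorphism U -> B} := HB.pack g0
  (GRing.isLinear.Build F U B _ g0 g0L) (GRing.isMonoidMorphism.Build U B g0 g0M).
exists g => [x|g' hg' q]; first exact: genE.
have -> : q = \sum_t qrepr K q t *: \prod_(i <- tagged t) gen (e i).
  apply: evq_inj => C h hh.
  rewrite (big_morph (fun r => evq r hh) (fun a b => evqD a b hh) (evq0 hh)).
  apply: eq_bigr => t _; rewrite evqZ; congr (_ *: _).
  rewrite (big_morph (fun r => evq r hh) (fun a b => evqM a b hh) (evq1 hh)).
  by apply: eq_bigr => i _; rewrite genE.
rewrite !linear_sum; apply: eq_bigr => t _; rewrite !linearZ; congr (_ *: _).
rewrite !rmorph_prod; apply: eq_bigr => i _ /=.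
by rewrite hg' /g0 genE.
Qed.

End RenvExists.

Theorem renv_ex (F : fieldType) (p : nat) (L : restrictedLie F p) :
  exists Ui : {U : falgType F & {linear L -> U}}, is_renv (projT2 Ui).
Proof.
exists (existT (fun U : falgType F => {linear L -> U})
  (U L : falgType F) (@gen F p L : {linear _ -> _})).
by split; [exact: gen_restricted | exact: gen_universal].
Qed.

End RenvExists.

Section Renv.
Variables (F : fieldType) (p : nat) (L : restrictedLie F p).

Definition renv : falgType F := projT1 (projT1 (cid (RenvExists.renv_ex L))).
Definition renv_in : {linear L -> renv} := projT2 (projT1 (cid (RenvExists.renv_ex L))).

Lemma renvP : is_renv renv_in.
Proof. by rewrite /renv_in /renv; case: (cid _). Qed.

End Renv.

Definition is_amodule (F : fieldType) (A : falgType F) (M : opmod F A) :=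
  [/\ linear (@op F A M), op (M := M) (1 : A) = \1%VF &
      forall a b : A, op (M := M) (a * b) = (op a \o op b)%VF].

Record amodule (F : fieldType) (A : falgType F) := AModule {
  am_om :> opmod F A;
  am_P : is_amodule am_om
}.

Section Amodules.
Variables (F : fieldType) (A : falgType F).

Lemma is_amodule_sub (M : opmod F A) (U : {vspace M}) :
  is_amodule M -> stable U -> is_amodule (om_sub U).
Proof.
move=> [hl h1 hM] sU; split.
- move=> a x y; apply/lfunP => v; apply: val_inj.
  by rewrite [LHS]om_subE // hl !lfunZDE linearP -!(om_subE _ _ sU).
- by apply/lfunP => v; apply: val_inj; rewrite [LHS]om_subE // h1 !id_lfunE.
- move=> a b; apply/lfunP => v; apply: val_inj.
  by rewrite [LHS]om_subE // hM 2!comp_lfunE -!(om_subE _ _ sU).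
Qed.

(* the free module A^n *)
Definition free_act n (a : A) (f : {ffun 'I_n -> A}) : {ffun 'I_n -> A} :=
  [ffun i => a * f i].

Fact free_act_linear n a : linear (@free_act n a).
Proof.
by move=> k f g; apply/ffunP => i; rewrite !ffunE mulrDr scalerAr.
Qed.
HB.instance Definition _ n a :=
  GRing.isLinear.Build F _ _ _ (@free_act n a) (free_act_linear a).

Definition free_om n : opmod F A :=
  @OpMod F A {ffun 'I_n -> A} (fun a => linfun (@free_act n a)).

Lemma free_omE n (a : A) (f : free_om n) i :
  (op a f : {ffun 'I_n -> A}) i = a * (f : {ffun 'I_n -> A}) i.
Proof. by rewrite /= lfunE ffunE. Qed.

Lemma free_amodule n : is_amodule (free_om n).
Proof.
split.
- move=> k a b; apply/lfunP => f; rewrite lfunZDE; apply/ffunP => i.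
  by rewrite free_omE !ffunE !lfunE !ffunE mulrDl scalerAl.
- by apply/lfunP => f; apply/ffunP => i; rewrite free_omE mul1r id_lfunE.
- move=> a b; apply/lfunP => f; apply/ffunP => i; rewrite comp_lfunE.
  by rewrite !free_omE mulrA.
Qed.

Definition free_am n : amodule A := AModule (free_amodule n).

Definition free_map n (N : amodule A) (e : 'I_n -> N) (f : free_om n) : N :=
  \sum_i op ((f : {ffun 'I_n -> A}) i) (e i).

Fact free_map_linear n (N : amodule A) (e : 'I_n -> N) : linear (free_map e).
Proof.
move=> k f g; rewrite /free_map scaler_sumr -big_split; apply: eq_bigr => i _.
by rewrite !ffunE; case: (am_P N) => -> _ _; rewrite lfunZDE.
Qed.
HB.instance Definition _ n (N : amodule A) e :=
  GRing.isLinear.Build F _ _ _ (@free_map n N e) (free_map_linear e).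

Lemma free_map_hom n (N : amodule A) (e : 'I_n -> N) :
  om_hom (linfun (free_map e)).
Proof.
move=> a f; rewrite lfunE [linfun _ f]lfunE /= /free_map linear_sum; apply: eq_bigr => i _.
by rewrite free_omE; case: (am_P N) => _ _ ->; rewrite comp_lfunE.
Qed.

Lemma free_map_delta n (N : amodule A) (e : 'I_n -> N) j :
  free_map e [ffun i => (i == j)%:R] = e j.
Proof.
rewrite /free_map (bigD1 j) //= big1 ?addr0 => [|i /negPf nij].
  by rewrite ffunE eqxx; case: (am_P N) => _ -> _; rewrite id_lfunE.
rewrite ffunE nij; case: (am_P N) => hl _ _.
by have := hl (-1) 0 0; rewrite scaler0 addr0 scaleN1r addNr => ->; rewrite zero_lfunE.
Qed.

(* the free module on the standard basis of N, and its canonical map onto N *)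
Definition fcover_src (N : amodule A) : amodule A := free_am (\dim {:N}).
Definition fcover (N : amodule A) : 'Hom(fcover_src N, N) :=
  linfun (free_map (fun i : 'I_(\dim {:N}) => (vbasis {:N})`_i)).

Lemma fcover_hom N : om_hom (fcover N).
Proof. exact: free_map_hom. Qed.

Lemma fcover_surj N : limg (fcover N) = fullv.
Proof.
apply/vspaceP => v; rewrite memvf (coord_vbasis (memvf v)).
apply: memv_suml => i _; apply: memvZ; apply/memv_imgP.
exists [ffun j => (j == i)%:R]; first exact: memvf.
by rewrite lfunE /= free_map_delta.
Qed.

Lemma stable_lker (M N : opmod F A) (f : 'Hom(M, N)) :
  om_hom f -> stable (lker f).
Proof.
by move=> hf x v; rewrite !memv_ker => /eqP fv; rewrite hf fv linear0.
Qed.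

(* Ext^n_A(N, M) is the n-th cohomology of Hom_A(res N, M), where res N is the
   free resolution of N obtained by iterating [fcover]. *)

Definition fsyz (N : amodule A) : amodule A :=
  AModule (is_amodule_sub (am_P (fcover_src N)) (stable_lker (fcover_hom (N := N)))).

Definition fsyz_in (N : amodule A) : 'Hom(fsyz N, fcover_src N) :=
  linfun vsval.

Definition syz (N : amodule A) (n : nat) : amodule A := iter n fsyz N.
Definition res (N : amodule A) (n : nat) : amodule A := fcover_src (syz N n).
Definition res_d (N : amodule A) (n : nat) : 'Hom(res N n.+1, res N n) :=
  (fsyz_in (syz N n) \o fcover (syz N n.+1))%VF.

Lemma fsyz_in_hom N : om_hom (fsyz_in N).
Proof.
move=> x v; rewrite lfunE [X in _ = op x X]lfunE.
apply: om_subE; exact/stable_lker/fcover_hom.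
Qed.

Lemma res_d_hom N n : om_hom (res_d N n).
Proof.
by move=> x v; rewrite /res_d !comp_lfunE fcover_hom fsyz_in_hom.
Qed.

Lemma limg_res_d N n : limg (res_d N n) = lker (fcover (syz N n)).
Proof.
rewrite /res_d limg_comp fcover_surj; apply/vspaceP => v.
apply/memv_imgP/idP => [[u _ ->]|vK]; first by rewrite lfunE; exact: subvsP.
by exists (vsproj _ v); rewrite ?memvf // lfunE /= vsprojK.
Qed.

Lemma res_exact N n : limg (res_d N n.+1) = lker (res_d N n).
Proof.
rewrite limg_res_d; apply/vspaceP => v; rewrite !memv_ker /res_d comp_lfunE.
rewrite [fsyz_in _ _]lfunE; apply/eqP/eqP => [->|h]; first by rewrite linear0.
by apply: val_inj; rewrite [LHS]h linear0.
Qed.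

Section Ext.
Variables (N M : amodule A).

Definition ext_cocycle n (f : 'Hom(res N n, M)) :=
  om_hom f /\ (f \o res_d N n)%VF = 0.

Definition ext_coboundary n : 'Hom(res N n, M) -> Prop :=
  match n with
  | 0 => fun f => f = 0
  | m.+1 => fun f => exists2 g : 'Hom(res N m, M),
      om_hom g & f = (g \o res_d N m)%VF
  end.

Fact ext_cocycle_subspace n : subspace_pred (@ext_cocycle n).
Proof.
split=> [|a f g [hf df] [hg dg]].
  by split; [case: (Homs_subproof (res N n) M) | rewrite comp_lfun0l].
split; first by case: (Homs_subproof (res N n) M) => _; apply.
by rewrite comp_lfunDl -comp_lfunZl df dg scaler0 addr0.
Qed.

Fact ext_coboundary_subspace n : subspace_pred (@ext_coboundary n).
Proof.
case: n => [|n]; split=> //.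
- by move=> a f g -> ->; rewrite scaler0 addr0.
- by exists 0; [case: (Homs_subproof (res N n) M) | rewrite comp_lfun0l].
- move=> a _ _ [f hf ->] [g hg ->]; exists (a *: f + g).
    by case: (Homs_subproof (res N n) M) => _; apply.
  by rewrite comp_lfunDl -comp_lfunZl.
Qed.

Lemma ext_coboundary_cocycle n f : @ext_coboundary n f -> ext_cocycle f.
Proof.
case: n f => [_ ->|n _ [g hg ->]]; first by case: (ext_cocycle_subspace 0).
split=> [x v|].
  by rewrite [LHS]comp_lfunE [X in _ = op x X]comp_lfunE res_d_hom hg.
apply/lfunP => v; rewrite -comp_lfunA 2!comp_lfunE zero_lfunE.
have : res_d N n.+1 v \in lker (res_d N n) by rewrite -res_exact memv_img ?memvf.
by rewrite memv_ker => /eqP ->; rewrite linear0.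
Qed.

Definition dim_Ext (n : nat) : nat :=
  (\dim (vspace_of (ext_cocycle_subspace n)) -
   \dim (vspace_of (ext_coboundary_subspace n)))%N.

End Ext.

Definition projective (P : amodule A) :=
  forall (M N : amodule A) (g : 'Hom(M, N)) (f : 'Hom(P, N)),
    om_hom g -> limg g = fullv -> om_hom f ->
    exists2 h : 'Hom(P, M), om_hom h & (g \o h)%VF = f.

Definition is_proj_cover (P N : amodule A) (g : 'Hom(P, N)) :=
  [/\ projective P, om_hom g, limg g = fullv &
    forall W : {vspace P}, stable W -> (W + lker g)%VS = fullv -> W = fullv].

Lemma free_proj n : projective (free_am n).
Proof.
move=> M N g f hg sg hf.
have pre (y : N) : exists x, g x = y.
  have : y \in limg g by rewrite sg memvf.
  by case/memv_imgP => x _ ->; exists x.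
pose d j : free_am n := [ffun i => (i == j)%:R].
pose m j : M := projT1 (cid (pre (f (d j)))).
have mE j : g (m j) = f (d j) by rewrite /m; case: (cid _).
exists (linfun (free_map m)); first exact: free_map_hom.
apply/lfunP => u; rewrite comp_lfunE lfunE /= /free_map linear_sum.
have uE : u = \sum_j op ((u : {ffun 'I_n -> A}) j) (d j).
  apply/ffunP => i; rewrite sum_ffunE (bigD1 i) //= free_omE ffunE eqxx mulr1.
  rewrite big1 ?addr0 // => j /negPf nij.
  by rewrite free_omE ffunE eq_sym nij mulr0.
rewrite [in RHS]uE linear_sum; apply: eq_bigr => j _; rewrite [LHS]hg mE.
exact/esym/hf.
Qed.

Lemma proj_cover_ex (N : amodule A) :
  exists Pg : {P : amodule A & 'Hom(P, N)}, is_proj_cover (projT2 Pg).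
Proof.
pose P0 := fcover_src N; pose pi := fcover N.
pose D k := exists W : {vspace P0},
  [/\ stable W, (pi @: W)%VS = fullv & \dim W = k].
have [|k [W [sW pW dW]] kmin] := @min_nat_ex D.
  exists (\dim {:P0}), fullv.
  by split; [exact: stablef | exact: fcover_surj | ].
pose Q : amodule A := AModule (is_amodule_sub (am_P P0) sW).
pose j : 'Hom(Q, P0) := linfun vsval.
have jE x : j x = vsval x by rewrite lfunE.
have hj : om_hom j by move=> a v; rewrite !jE om_subE.
have hpi : om_hom pi := fcover_hom (N := N).
pose q : 'Hom(Q, N) := (pi \o j)%VF.
have hq : om_hom q.
  move=> a v; rewrite [LHS]comp_lfunE [X in _ = op a X]comp_lfunE.
  by rewrite hj hpi.
have limg_j : limg j = W.
  apply/vspaceP => v; apply/memv_imgP/idP => [[x _ ->]|vW].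
    rewrite jE; exact: subvsP.
  by exists (vsproj W v : Q); rewrite ?memvf // jE vsprojK.
have q_surj : limg q = fullv by rewrite /q limg_comp limg_j pW.
have ess (V : {vspace Q}) : stable V -> (q @: V)%VS = fullv -> V = fullv.
  move=> sV qV.
  have sV' : stable (j @: V)%VS.
    by move=> a _ /memv_imgP[v vV ->]; rewrite -hj memv_img // sV.
  have jk : lker j = 0%VS.
    apply/eqP; rewrite -subv0; apply/subvP => v; rewrite memv_ker memv0 jE.
    by move=> /eqP v0; apply/eqP/val_inj.
  have dV : \dim (j @: V) = \dim V by apply: limg_dim_eq; rewrite jk capv0.
  have dQ : \dim {:Q} = k by rewrite -dW -limg_j limg_dim_eq // jk capv0.
  apply/eqP; rewrite eqEdim subvf dQ -dV; apply: kmin.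
  by exists (j @: V)%VS; split=> //; rewrite -limg_comp.
have [h hh qh] := free_proj (M := Q) hq q_surj hpi.
pose t : 'End(Q) := (h \o j)%VF.
have ht : om_hom t.
  move=> a v; rewrite [LHS]comp_lfunE [X in _ = op a X]comp_lfunE.
  by rewrite hj hh.
have qt : (q \o t)%VF = q by rewrite /t comp_lfunA qh.
have t_surj : limg t = fullv.
  apply: ess; last by rewrite -limg_comp qt.
  by move=> a _ /memv_imgP[v _ ->]; rewrite -ht memv_img // memvf.
have t_inj : lker t == 0%VS.
  have := limg_ker_dim t fullv; rewrite t_surj capfv => /eqP.
  by rewrite -[X in _ == X]add0n eqn_add2r dimv_eq0.
pose r : 'Hom(P0, Q) := (t^-1 \o h)%VF.
have hr : om_hom r.
  move=> a v; apply: (lker0P t_inj); rewrite [r (op a v)]comp_lfunE.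
  by rewrite lker0_lfunVK // ht [r v]comp_lfunE lker0_lfunVK // hh.
have rj : (r \o j)%VF = \1%VF by rewrite /r -comp_lfunA lker0_compVf.
exists (existT (fun P : amodule A => 'Hom(P, N)) Q q); split=> //=.
  move=> M N' g f hg sg hf.
  have [|H hH gH] := @free_proj _ M N' g (f \o r)%VF hg sg.
    move=> a v; rewrite [LHS]comp_lfunE [X in _ = op a X]comp_lfunE.
    by rewrite hr hf.
  exists (H \o j)%VF.
    move=> a v; rewrite [LHS]comp_lfunE [X in _ = op a X]comp_lfunE.
    by rewrite hj hH.
  by rewrite comp_lfunA gH -comp_lfunA rj comp_lfun1r.
move=> V sV Vk; apply: ess => //; rewrite -q_surj -Vk limgD.
by rewrite [X in (_ + X)%VS](_ : _ = 0%VS) ?addv0 //; apply/eqP; rewrite -lkerE.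
Qed.

Definition proj_cover (N : amodule A) : amodule A :=
  projT1 (projT1 (cid (proj_cover_ex N))).

Definition left_ideal (I : {vspace A}) :=
  forall a x : A, x \in I -> a * x \in I.

Definition max_left_ideal (I : {vspace A}) :=
  [/\ left_ideal I, I <> fullv &
    forall J : {vspace A}, left_ideal J -> (I <= J)%VS ->
      J = I \/ J = fullv].

Fact Jac_subproof : subspace_pred (fun a : A =>
  forall I : {vspace A}, max_left_ideal I -> a \in I).
Proof.
split=> [I _|c a b ha hb I mI]; first exact: mem0v.
by apply: memvD; [apply: memvZ; exact: ha | exact: hb].
Qed.

Definition Jac : {vspace A} := vspace_of Jac_subproof.

(* the span I W of the products a w with a in I and w in W *)
Definition act_span (M : opmod F A) (I : {vspace A}) (W : {vspace M})
  : {vspace M} :=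
  <<[seq op a w | a <- vbasis I, w <- vbasis W]>>%VS.

Lemma mem_act_span (M : opmod F A) (I : {vspace A}) (W : {vspace M}) a w :
  is_amodule M -> a \in I -> w \in W -> op a w \in act_span I W.
Proof.
case=> hl _ _ aI wW; pose f : A -> 'End(M) := @op F A M.
pose f' : {linear A -> 'End(M)} := HB.pack f (GRing.isLinear.Build F A _ _ f hl).
rewrite -[op a w]/(f' a w) (coord_vbasis aI) linear_sum sum_lfunE.
apply: memv_suml => i _; rewrite linearZ lfunZE; apply: memvZ.
rewrite (coord_vbasis wW) linear_sum; apply: memv_suml => j _.
rewrite linearZ; apply/memvZ/memv_span/allpairsP.
by exists ((vbasis I)`_i, (vbasis W)`_j); split; rewrite //= mem_nth ?size_tuple.
Qed.

Definition rad_layer (P : opmod F A) : opmod F A :=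
  om_factor (@act_span P (Jac ^+ 2)%VS fullv) (@act_span P Jac fullv).

Definition two_sided (I : {vspace A}) :=
  forall a x : A, x \in I -> a * x \in I /\ x * a \in I.

Definition indecomposable_ideal (B : {vspace A}) :=
  [/\ two_sided B, B <> 0%VS &
    forall I J : {vspace A}, two_sided I -> two_sided J ->
      (I + J)%VS = B -> (I :&: J)%VS = 0%VS -> I = 0%VS \/ J = 0%VS].

Definition block_decomposition (n : nat) (B : 'I_n -> {vspace A}) :=
  [/\ forall i, indecomposable_ideal (B i),
      directv (\sum_(i < n) B i)%VS & (\sum_(i < n) B i)%VS = fullv].

Definition is_block (B : {vspace A}) :=
  exists (n : nat) (B_ : 'I_n -> {vspace A}) (i : 'I_n),
    block_decomposition B_ /\ B = B_ i.

Definition in_block (B : {vspace A}) (M : opmod F A) :=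
  @act_span M B fullv = fullv.

End Amodules.

Section EndAlgebra.
Variables (F : fieldType) (V : vectType F) (V0 : (0 < dim V)%N).

(* 'End(V) with product the composition f \o g (the library's algebra
   structure on 'End(V) uses the opposite product) *)
Definition End_alg : algType F :=
  let R := lfun_comp_nzRingType V0 in
  let mL := GRing.Lmodule_isLalgebra.Build F R
    (fun k (f g : 'End(V)) => comp_lfunZl k f g) in
  let LA : lalgType F := HB.pack 'End(V) R mL in
  let mA := GRing.Lalgebra_isAlgebra.Build F LA
    (fun k (f g : 'End(V)) => comp_lfunZr k f g) in
  HB.pack 'End(V) LA mA.

End EndAlgebra.

Section RestrictedModules.
Variables (F : fieldType) (p : nat) (L : restrictedLie F p).

Lemma umod_ex (S : restModule L) : exists act : renv L -> 'End(S),
  is_amodule (OpMod act) /\ forall x : L, act (renv_in L x) = op x.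
Proof.
have [S0|S_gt0] := posnP (dim S).
  have E (f g : 'End(S)) : f = g.
    apply/lfunP => v; have z (w : S) : w = 0.
      apply/eqP; rewrite -memv0; suff <- : {:S}%VS = 0%VS by exact: memvf.
      by apply/eqP; rewrite -dimv_eq0 dimvf S0.
    by rewrite (z (f v)) (z (g v)).
  by exists (fun=> 0); split=> [|x]; [split=> [a u v||a b]|]; apply: (E _ _).
pose B := End_alg S_gt0.
pose f : L -> B := fun x => op (M := S) x.
have fL : linear f := lm_linear S.
pose f' : {linear L -> B} := HB.pack f (GRing.isLinear.Build F L B _ f fL).
have hf : restricted_map f'.
  split=> [x y|x]; apply/lfunP => v.
    rewrite [LHS](@lm_lbr _ _ S).
    rewrite [RHS](@add_lfunE _ S S) opp_lfunE.
    by congr (_ - _); rewrite [RHS](@comp_lfunE _ S S S).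
  rewrite [LHS](@rm_pmap _ _ _ S).
  suff it k : (f x ^+ k : 'End(S)) v = iter k (op x) v by rewrite -it.
  elim: k => [|k IH]; first by rewrite expr0 /= id_lfunE.
  by rewrite exprS [LHS](@comp_lfunE _ S S S) IH.
have [_ univ] := renvP L; have [g gf _] := univ B f' hf.
exists (fun a => g a : 'End(S)); split; last by move=> x; exact: gf.
split.
- by move=> a x y; exact: (linearP g a x y).
- exact: (rmorph1 g).
- exact: (rmorphM g).
Qed.

Definition umod_act (S : restModule L) : renv L -> 'End(S) :=
  projT1 (cid (umod_ex S)).

Fact umod_actP (S : restModule L) : is_amodule (OpMod (umod_act S)).
Proof. by rewrite /umod_act; case: (cid _) => ? []. Qed.

Lemma umod_act_in (S : restModule L) (x : L) :
  umod_act S (renv_in L x) = op x.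
Proof. by rewrite /umod_act; case: (cid _) => ? []. Qed.

Definition umod (S : restModule L) : amodule (renv L) :=
  AModule (umod_actP S).

(* dim H_*^n(L, M), with H_*^n(L, M) = Ext^n_u(L)(F, M) *)
Definition dim_Hres (n : nat) (M : restModule L) : nat :=
  dim_Ext (umod (triv_rm L)) (umod M) n.

(* P_L(F) *)
Definition proj_cover_triv : amodule (renv L) := proj_cover (umod (triv_rm L)).

Definition in_principal_block (S : restModule L) :=
  exists B : {vspace renv L},
    [/\ is_block B, in_block B (umod (triv_rm L)) & in_block B (umod S)].

End RestrictedModules.

(* Main.v *)
From HB Require Import structures.
Require Import Defs.
From mathcomp Require Import all_boot ssrAC all_order all_algebra falgebra fieldext.
From mathcomp Require Import boolp.

Set Implicit Arguments.
Unset Strict Implicit.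
Unset Printing Implicit Defensive.

Import GRing.Theory.
Local Open Scope ring_scope.

(** Let A = Ann S for a nontrivial irreducible restricted module S of L. All the
    conditions but solvability are, module by module, forms of the vanishing of
    H^1(L / A, S).

    - Every ordinary cocycle L -> S is restricted, because S has no invariants
      ([cocycle_pmap]). If P is a projective u(L)-module mapping onto F with
      kernel X, the maps X -> S modulo those extending to P are therefore
      H^1(L, S) ([presentation_H1]). With P free this says that H_*^1 = H^1; with
      P = P_L(F), where X = Jac P and no nonzero map X -> S extends, it computes
      the multiplicity of S in the second Loewy layer ([rad_layer_mult]).
    - dim H^1(L, S) = dim End(S) [L : S]_split + dim H^1(L / A, S), by filtering
      the cocycles by their vanishing on the terms of a chief series
      ([dim_H1_formula]); a cocycle that is nonzero on an abelian chief factor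
      splits it by its kernel.

    If L is solvable, some x in L is invertible on S and satisfies
    [x, [x, L]] <= A, which forces H^1(L / A, S) = 0 ([solvable_H1_ann]).

    Conversely, suppose L is not solvable, and let N / J be a nonabelian chief
    factor; it is perfect. We look for S killed by J but not by N and a cocycle
    of S vanishing on J that is not a coboundary. Such a cocycle vanishes on A,
    since A :&: N = J, and S is in the principal block because the cocycle
    defines a nonsplit extension of F by S ([principal_block_of_cocycle]). If
    there is none, then among the modules killed by J the extensions of those
    killed by N by those without trivial N-subquotient split, and a vector on
    which an L-invariant linear map takes a given value can be replaced by an
    N-invariant one ([invariant_lift]). Apply this to the symmetric
    p-linear forms l on N / J and to the functional l |-> l(y, .., y), which is
    L-invariant because p = 0: some N-invariant form does not vanish at
    (y, .., y). But over an extension field one finds z in N and u in N / J with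
    z u = y <> 0 and z y = 0, and then N-invariance gives
    l(y, .., y) = l(z u, y, .., y) = 0 ([no_sandwich], [factor_abelian]). *)

(** * Restricted modules *)

Section LinearMap.
Variables (F : fieldType) (U V : vectType F) (f : U -> V) (fL : linear f).

Definition lin_of : 'Hom(U, V) :=
  linfun (HB.pack f (GRing.isLinear.Build F U V _ f fL) : {linear U -> V}).

Lemma lin_ofE u : lin_of u = f u. Proof. exact: lfunE. Qed.

End LinearMap.

Section Frobenius.
Variables (F : fieldType) (p : nat) (V : vectType F).
Hypothesis pF : p \in [pchar F].

(** This is additivity of the Frobenius map on commuting elements of the algebra
    of endomorphisms, which has characteristic p. *)
Lemma iter_lfunB (a b : 'End(V)) v :
  (forall w, a (b w) = b (a w)) ->
  iter p (fun w => a w - b w) v = iter p a v - iter p b v.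
Proof.
move=> ab.
have [V0|V_gt0] := posnP (dim V).
  have z (w : V) : w = 0.
    apply/eqP; rewrite -memv0; suff <- : {:V}%VS = 0%VS by exact: memvf.
    by apply/eqP; rewrite -dimv_eq0 dimvf V0.
  by rewrite (z (iter _ _ _)) [RHS]z.
pose B := End_alg V_gt0.
have itE (f : B) k w : (f ^+ k : 'End(V)) w = iter k (f : 'End(V)) w.
  elim: k => [|k IH]; first by rewrite expr0 /= id_lfunE.
  by rewrite exprS [LHS](@comp_lfunE _ V V V) IH.
have pB : p \in [pchar B] by rewrite GRing.pchar_lalg.
have cab : GRing.comm (a : B) (b : B).
  apply/lfunP => w; rewrite [LHS](@comp_lfunE _ V V V).
  by rewrite [RHS](@comp_lfunE _ V V V) ab.
have := pFrobenius_autB_comm pB cab; rewrite !pFrobenius_autE => E.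
have := congr1 (fun f : 'End(V) => f v) E.
rewrite [X in _ = X](@add_lfunE _ V V) opp_lfunE !itE => <-.
by apply: eq_iter => w; rewrite [RHS](@add_lfunE _ V V) opp_lfunE.
Qed.

End Frobenius.

Section ModuleOps.
Variables (F : fieldType) (L : lieAlgebra F) (M : lieModule L).
Implicit Types (x y : L) (v : M).

Lemma lm_opZD a x y v : op (a *: x + y) v = a *: op x v + op y v.
Proof. by rewrite (lm_linear M) lfunZDE. Qed.

Lemma lm_opD x y v : op (x + y) v = op x v + op y v.
Proof. by have := lm_opZD 1 x y v; rewrite !scale1r. Qed.

Lemma lm_op0 v : op (0 : L) v = 0.
Proof. by have := lm_opZD (-1) 0 0 v; rewrite scaler0 addr0 scaleN1r addNr. Qed.

Lemma lm_opZ a x v : op (a *: x) v = a *: op x v.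
Proof. by have := lm_opZD a x 0 v; rewrite !addr0 lm_op0 addr0. Qed.

Lemma lm_opN x v : op (- x) v = - op x v.
Proof. by rewrite -scaleN1r lm_opZ scaleN1r. Qed.

Lemma lm_op_sum (I : Type) (r : seq I) (P : pred I) (f : I -> L) v :
  op (\sum_(i <- r | P i) f i) v = \sum_(i <- r | P i) op (f i) v.
Proof.
by apply: (big_morph (fun x => op x v)) => [x y|]; rewrite ?lm_opD ?lm_op0.
Qed.

End ModuleOps.

Section SubQuotientModules.
Variables (F : fieldType) (p : nat) (L : restrictedLie F p).
Variables (M : restModule L) (W : {vspace M}).
Hypothesis sW : stable W.

Fact rm_sub_linear : linear (@op F L (om_sub W)).
Proof.
move=> a x y; apply/lfunP => v; apply: val_inj.
by rewrite [LHS]om_subE // lm_opZD lfunZDE linearP -!(om_subE _ _ sW).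
Qed.

Fact rm_sub_lbr (x y : L) (v : om_sub W) :
  op (lbr x y) v = op x (op y v) - op y (op x v).
Proof.
apply: val_inj; rewrite [LHS]om_subE // lm_lbr linearB.
by rewrite -!(om_subE _ _ sW).
Qed.

Definition lm_sub : lieModule L := LieModule rm_sub_linear rm_sub_lbr.

Fact rm_sub_pmap (x : L) (v : lm_sub) : op (Defs.pmap x) v = iter p (op x) v.
Proof.
have it k : val (iter k (op x) v) = iter k (op (M := M) x) (val v).
  by elim: k => [|k IH] //; rewrite !iterS -IH; exact: om_subE.
by apply: val_inj; rewrite it [LHS]om_subE // rm_pmap.
Qed.

Definition rm_sub : restModule L := RestModule rm_sub_pmap.

Fact rm_quot_linear : linear (@op F L (om_quot W)).
Proof.
move=> a x y; apply/lfunP => v; rewrite -(qreprK v) om_quotE //.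
by rewrite lm_opZD lfunZDE linearP !(om_quotE _ _ sW).
Qed.

Fact rm_quot_lbr (x y : L) (v : om_quot W) :
  op (lbr x y) v = op x (op y v) - op y (op x v).
Proof.
by rewrite -(qreprK v) !(om_quotE _ _ sW) lm_lbr linearB.
Qed.

Definition lm_quot : lieModule L := LieModule rm_quot_linear rm_quot_lbr.

Fact rm_quot_pmap (x : L) (v : lm_quot) : op (Defs.pmap x) v = iter p (op x) v.
Proof.
have it k w : iter k (op (M := lm_quot) x) (qproj W w) =
      qproj W (iter k (op (M := M) x) w).
  by elim: k => [|k IH] //; rewrite !iterS IH (om_quotE _ _ sW).
by rewrite -(qreprK v) it (om_quotE _ _ sW) rm_pmap.
Qed.

Definition rm_quot : restModule L := RestModule rm_quot_pmap.

End SubQuotientModules.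

Section FactorModules.
Variables (F : fieldType) (p : nat) (L : restrictedLie F p).
Variables (M : restModule L) (W U : {vspace M}).
Hypotheses (sW : stable W) (sU : stable U).

Definition rm_factor : restModule L :=
  @rm_sub F p L (rm_quot sW) (qproj W @: U)%VS (stable_qimg sW sU).

End FactorModules.

Section FactorMap.
Variables (F : fieldType) (X : Type) (M : opmod F X) (W U : {vspace M}).

(** The projection of U onto U / W; its values off U are junk. *)
Definition toq : 'Hom(M, om_factor W U) :=
  (linfun (vsproj (qproj W @: U)%VS) \o qproj W)%VF.

Lemma val_toq v : v \in U -> vsval (toq v) = qproj W v.
Proof. by move=> vU; rewrite comp_lfunE lfunE /= vsprojK // memv_img. Qed.

Lemma toq_op x v : stable W -> stable U -> v \in U ->
  toq (op x v) = op x (toq v).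
Proof.
move=> sW sU vU; apply: val_inj.
rewrite [RHS](om_subE (M := om_quot W)); last exact: stable_qimg.
by rewrite ![\val _]val_toq ?sU // om_quotE.
Qed.

Lemma toq_surj (y : om_factor W U) : exists2 u, u \in U & toq u = y.
Proof.
have /memv_imgP[u uU yu] : vsval y \in (qproj W @: U)%VS by exact: subvsP.
by exists u => //; apply: val_inj; rewrite [LHS]val_toq.
Qed.

Lemma toq_eq0 v : v \in U -> (toq v == 0) = (v \in W).
Proof. by move=> vU; rewrite -val_eqE [\val _]val_toq // qproj_eq0. Qed.

End FactorMap.

Section CommutatorPower.
Variables (F : fieldType) (p : nat) (V W : vectType F).
Hypothesis pF : p \in [pchar F].
Variables (a : 'End(W)) (b : 'End(V)).

Fact lcomp_linear : linear (fun h : 'Hom(V, W) => (a \o h)%VF).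
Proof. by move=> c g h; rewrite comp_lfunDr comp_lfunZr. Qed.
Fact rcomp_linear : linear (fun h : 'Hom(V, W) => (h \o b)%VF).
Proof. by move=> c g h; rewrite comp_lfunDl comp_lfunZl. Qed.

(** Left and right multiplication commute, so Frobenius applies to their
    difference. *)
Lemma iter_commutator (h : 'Hom(V, W)) v :
  (iter p (fun g => (a \o g)%VF - (g \o b)%VF) h) v =
  iter p a (h v) - h (iter p b v).
Proof.
pose lc := lin_of lcomp_linear; pose rc := lin_of rcomp_linear.
have itl k g w : (iter k lc g) w = iter k a (g w).
  by elim: k => [|k IH] //; rewrite iterS lin_ofE comp_lfunE IH.
have itr k g w : (iter k rc g) w = g (iter k b w).
  elim: k w => [|k IH] w //; rewrite iterS lin_ofE comp_lfunE IH.
  by rewrite -iterSr.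
have -> : iter p (fun g => (a \o g)%VF - (g \o b)%VF) h =
    iter p (fun g => lc g - rc g) h.
  by apply: eq_iter => g; rewrite !lin_ofE.
rewrite (iter_lfunB pF) => [|g]; last by rewrite !lin_ofE comp_lfunA.
by rewrite add_lfunE opp_lfunE itl itr.
Qed.

End CommutatorPower.

Section HomModule.
Variables (F : fieldType) (p : nat) (L : restrictedLie F p).
Variables (M N : restModule L).

Definition hom_om : opmod F L :=
  @OpMod F L 'Hom(M, N) (fun x =>
    lin_of (lcomp_linear (V := M) (op x)) - lin_of (rcomp_linear (W := N) (op x))).

Lemma hom_omE x (h : hom_om) m :
  (op x h : 'Hom(M, N)) m = op x ((h : 'Hom(M, N)) m) - (h : 'Hom(M, N)) (op x m).
Proof.
have -> : op x h = (op x \o h)%VF - (h \o op x)%VF.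
  by rewrite [LHS]add_lfunE [X in _ + X]opp_lfunE 2!lin_ofE.
by rewrite add_lfunE opp_lfunE !comp_lfunE.
Qed.

Fact hom_linear : linear (@op F L hom_om).
Proof.
move=> a x y; apply/lfunP => h; apply/lfunP => m; rewrite lfunZDE.
rewrite [LHS]hom_omE !lm_opZD.
rewrite [RHS](@lfunZDE _ M N) !hom_omE linearP scalerBr.
by rewrite opprD addrACA.
Qed.

Fact hom_lbr (x y : L) (h : hom_om) :
  op (lbr x y) h = op x (op y h) - op y (op x h).
Proof.
apply/lfunP => m; rewrite [RHS](@add_lfunE _ M N) opp_lfunE.
rewrite !hom_omE !lm_lbr !linearB /= !opprK.
rewrite [RHS](AC ((2*2)*(2*2)) ((1*5)*(8*4)*((2*7)*(3*6)))) /=.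
by rewrite !addNr !addr0.
Qed.

Definition hom_lm : lieModule L := LieModule hom_linear hom_lbr.

Fact hom_pmap (x : L) (h : hom_lm) : op (Defs.pmap x) h = iter p (op x) h.
Proof.
apply/lfunP => m; rewrite hom_omE !rm_pmap -(iter_commutator (rl_char L)).
congr (fun_of_lfun _ m); apply: eq_iter => g; apply/lfunP => w.
by rewrite hom_omE add_lfunE opp_lfunE !comp_lfunE.
Qed.

Definition rm_hom : restModule L := RestModule hom_pmap.

End HomModule.

Section AdjointModule.
Variables (F : fieldType) (p : nat) (L : restrictedLie F p).

Fact adj_linear : linear (@op F L (adj L)).
Proof. by move=> a x y; exact: linearP. Qed.

Fact adj_lbr (x y : L) (v : adj L) :
  op (lbr x y) v = op x (op y v) - op y (op x v).
Proof. exact: lbrJ. Qed.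

Definition adj_lm : lieModule L := LieModule adj_linear adj_lbr.

Fact adj_pmap (x : L) (v : adj_lm) : op (Defs.pmap x) v = iter p (op x) v.
Proof. exact: pmap_ad. Qed.

Definition adj_rm : restModule L := RestModule adj_pmap.

End AdjointModule.

Section Coboundaries.
Variables (F : fieldType) (L : lieAlgebra F) (M : lieModule L).

Fact cobd_linear (m : M) : linear (fun x : L => op x m).
Proof. by move=> a x y; exact: lm_opZD. Qed.

Definition cobd (m : M) : 'Hom(L, M) := lin_of (cobd_linear m).

Lemma cobdE m x : cobd m x = op x m. Proof. exact: lin_ofE. Qed.

Lemma cobd_coboundary m : lie_coboundary (cobd m).
Proof. by exists m => x; rewrite cobdE. Qed.

Lemma cocycleB (f g : 'Hom(L, M)) :
  lie_cocycle f -> lie_cocycle g -> lie_cocycle (f - g).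
Proof.
move=> hf hg; have [_ h] := lie_cocycle_subspace M.
by have := h (-1) g f hg hf; rewrite scaleN1r addrC.
Qed.

Lemma cocycle_cobd m : lie_cocycle (cobd m).
Proof. exact/lie_coboundary_cocycle/cobd_coboundary. Qed.

Lemma coboundaryBl (f : 'Hom(L, M)) m :
  lie_coboundary (f - cobd m) -> lie_coboundary f.
Proof.
case=> m' hm; exists (m' + m) => x; rewrite linearD /= -hm add_lfunE opp_lfunE.
by rewrite cobdE subrK.
Qed.

End Coboundaries.

(** * Modules without trivial subquotients over an ideal *)

Section Full.
Variables (F : fieldType) (L : lieAlgebra F) (N : {vspace L}).
Hypothesis sN : stable (M := adj L) N.

Section FullSubspaces.
Variable M : opmod F L.

Definition sub_stable (W : {vspace M}) :=
  forall n v, n \in N -> v \in W -> op n v \in W.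

(** Equivalently U = NU for every N-stable U in D, that is, no subquotient of
    the N-module D is trivial. In this form, extensions and quotients of full
    modules are full for formal reasons. *)
Definition full_on (D : {vspace M}) :=
  forall U W : {vspace M}, (U <= D)%VS -> sub_stable U ->
    (forall n u, n \in N -> u \in U -> op n u \in W) -> (U <= W)%VS.

End FullSubspaces.

Lemma lm_swap (M : lieModule L) x n (v : M) :
  op n (op x v) = op x (op n v) + op (lbr n x) v.
Proof. by rewrite lm_lbr addrC subrK. Qed.

(** If D is full then so is D + xD: modulo D the second summand is a quotient
    of D, because x commutes with N up to elements of N. *)
Lemma full_on_translate (M : lieModule L) (D : {vspace M}) x :
  sub_stable D -> full_on D ->
  sub_stable (D + op x @: D)%VS /\ full_on (D + op x @: D)%VS.
Proof.
move=> sD fD; have nx n : n \in N -> lbr n x \in N.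
  by move=> nN; rewrite lbrC memvN; exact: sN.
have D1 (v : M) : v \in D -> v \in (D + op x @: D)%VS by apply/subvP/addvSl.
have D2 (v : M) : v \in D -> op x v \in (D + op x @: D)%VS.
  by move=> vD; apply: (subvP (addvSr _ _)); rewrite memv_img.
split=> [n _ nN /memv_addP[d dD [_ /memv_imgP[e eD ->] ->]]|U W UD sU NUW].
  rewrite linearD /= lm_swap; apply: memvD; first by rewrite D1 ?sD.
  by apply: memvD; [rewrite D2 ?sD | rewrite D1 ?sD ?nx].
pose W' := (W :&: U)%VS.
have NUW' n u : n \in N -> u \in U -> op n u \in W'.
  by move=> nN uU; rewrite memv_cap NUW ?sU.
suff /subv_trans : (U <= W')%VS by apply; exact: capvSl.
have key (V V' : {vspace M}) t :
    (forall n u, n \in N -> u \in V -> op n u \in V') ->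
    t \in D -> op x t \in (V + D)%VS ->
    forall n, n \in N -> op x (op n t) \in (V' + D)%VS.
  move=> NV tD xt n nN.
  have /eqP := lm_swap x n t; rewrite -subr_eq => /eqP <-.
  have /memv_addP[v vV [d dD ->]] := xt.
  rewrite linearD /= -addrA memv_add ?NV //.
  by rewrite rpredB ?sD ?nx.
have : (D :&: op x @^-1: (U + D) <= D :&: op x @^-1: (W' + D))%VS.
  apply: fD; first exact: capvSl.
  - move=> n t nN; rewrite !memv_cap -!memv_preim => /andP[tD xt].
    by rewrite sD //=; apply: key xt n nN.
  - move=> n t nN; rewrite !memv_cap -!memv_preim => /andP[tD xt].
    by rewrite sD //=; apply: key xt n nN.
move=> /subvP sub; apply/subvP => u uU.
have : u \in (W' + D)%VS.
  have /memv_addP[t tD [_ /memv_imgP[t' t'D ->] ut]] := subvP UD _ uU.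
  have : t' \in (D :&: op x @^-1: (U + D))%VS.
    rewrite memv_cap t'D -memv_preim /=.
    have -> : op x t' = u - t by rewrite ut addrC addKr.
    by rewrite memv_add // memvN.
  move/sub; rewrite memv_cap -memv_preim => /andP[_ xt'].
  rewrite ut memvD //; by apply: (subvP (addvSr _ _)).
case/memv_addP => w wW [d dD ud].
have dU : d \in U.
  have -> : d = u - w by rewrite ud addrC addKr.
  by rewrite memvB //; move: wW; rewrite memv_cap => /andP[].
have : (U :&: D <= W' :&: D)%VS.
  apply: fD; first exact: capvSr.
    by move=> n v nN; rewrite !memv_cap => /andP[vU vD]; rewrite sU ?sD.
  move=> n v nN; rewrite memv_cap => /andP[vU vD].
  by rewrite memv_cap NUW' ?sD.
move/subvP/(_ d); rewrite memv_cap dU dD => /(_ isT).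
by rewrite memv_cap => /andP[dW _]; rewrite ud; apply: memvD.
Qed.

(** In an irreducible module on which N acts nontrivially, a largest full
    subspace is a submodule by the previous lemma, and it contains every minimal
    N-stable subspace. *)
Lemma irr_full (T : lieModule L) (n0 : L) (t0 : T) :
  irreducible T -> n0 \in N -> op n0 t0 != 0 -> @full_on T fullv.
Proof.
move=> [T0 irT] n0N nt0.
pose P k := exists D : {vspace T}, [/\ sub_stable D, full_on D & \dim D = k].
have [||k [D [sD fD dD]] kmax] := @max_nat_ex P (\dim {:T}).
- exists 0%N, 0%VS; split; last exact: dimv0.
    by move=> n v _; rewrite memv0 => /eqP ->; rewrite linear0 mem0v.
  by move=> U W; rewrite subv0 => /eqP -> _ _; exact: sub0v.
- by move=> k [D [_ _ <-]]; rewrite dimvS // subvf.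
suff -> : fullv = D by [].
have stD : stable D.
  move=> x v vD; have [sD' fD'] := full_on_translate x sD fD.
  have /eqP -> : D == (D + op x @: D)%VS.
    by rewrite eqEdim addvSl dD; apply: kmax; exists (D + op x @: D)%VS.
  by apply: (subvP (addvSr _ _)); rewrite memv_img.
case: (irT _ stD) => [D0|->] //.
have [|m [E [sE E0 dE]] mmin] := @min_nat_ex (fun m => exists E : {vspace T},
    [/\ sub_stable E, E != 0%VS & \dim E = m]).
  by exists (\dim {:T}), fullv; split=> // n v _ _; exact: memvf.
have minE (U : {vspace T}) : (U <= E)%VS -> sub_stable U -> U != 0%VS -> U = E.
  by move=> UE sU U0; apply/eqP; rewrite eqEdim UE dE mmin //; exists U.
have [NE0|/existsNP[n1 /existsNP[e1 /not_implyP[n1N /not_implyP[e1E /eqP ne1]]]]] :=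
  pselect (forall n e, n \in N -> e \in E -> op n e = 0).
- (* then N kills a nonzero submodule, hence everything *)
  pose Q (v : T) := forall n, n \in N -> op n v = 0.
  have Qs : subspace_pred Q.
    split=> [n _|a u v hu hv n nN]; first exact: linear0.
    by rewrite linearP /= hu ?hv // scaler0 addr0.
  have sQ : stable (vspace_of Qs).
    move=> x v /mem_vspace_of hv; apply/mem_vspace_of => n nN.
    by rewrite lm_swap hv // linear0 add0r hv // lbrC memvN sN.
  case: (irT _ sQ) => Q0; last first.
    have /mem_vspace_of/(_ _ n0N) nt : t0 \in vspace_of Qs by rewrite Q0 memvf.
    by rewrite nt eqxx in nt0.
  case/negP: E0; rewrite -subv0 -Q0; apply/subvP => e eE.
  by apply/mem_vspace_of => n nN; exact: NE0.
- have fE : full_on E.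
    move=> U W UE sU NUW.
    have [-> | U0] := eqVneq U 0%VS; first exact: sub0v.
    have defU := minE U UE sU U0; subst U.
    have sWE : sub_stable (W :&: E)%VS.
      move=> n v nN; rewrite !memv_cap => /andP[_ vE]; rewrite NUW ?sE //.
    rewrite -(minE (W :&: E)%VS) ?capvSl ?capvSr //.
    apply: contraNneq ne1 => WE0; rewrite -memv0 -WE0 memv_cap NUW ?sE //.
  have : (\dim E <= \dim D)%N by rewrite dD; apply: kmax; exists E.
  by rewrite D0 dimv0 leqn0 dimv_eq0 (negPf E0).
Qed.

End Full.

(** * Splitting off full quotients *)

Section Splitting.
Variables (F : fieldType) (p : nat) (L : restrictedLie F p).
Variables (N J : {vspace L}).
Hypothesis sN : stable (M := adj L) N.

Definition acts_zero (I : {vspace L}) (M : opmod F L) :=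
  forall x (m : M), x \in I -> op x m = 0.

Definition vanishing_on (I : {vspace L}) (M : opmod F L) (f : 'Hom(L, M)) :=
  forall x, x \in I -> f x = 0.

Definition relH1_zero (S : lieModule L) :=
  forall f : 'Hom(L, S), lie_cocycle f -> vanishing_on J f -> lie_coboundary f.

(** Hom(Q, T) is filtered by evaluation at the vectors of a basis of Q, and each
    layer embeds N-equivariantly into T when N acts trivially on Q. *)
Lemma full_hom (Q T : restModule L) :
  acts_zero N Q -> full_on N (fullv : {vspace T}) ->
  full_on N (fullv : {vspace rm_hom Q T}).
Proof.
move=> NQ fT U W _ sU NUW.
have nE n (h : rm_hom Q T) q : n \in N ->
    (op n h : 'Hom(Q, T)) q = op n ((h : 'Hom(Q, T)) q).
  by move=> nN; rewrite hom_omE NQ // linear0 subr0.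
pose b i : Q := (vbasis {:Q})`_i.
pose ev (h : rm_hom Q T) i : T := (h : 'Hom(Q, T)) (b i).
have evL a g h i : ev (a *: g + h) i = a *: ev g i + ev h i.
  exact: (@lfunZDE _ Q T).
have evB g h i : ev (g - h) i = ev g i - ev h i.
  by rewrite [LHS](@add_lfunE _ Q T) opp_lfunE.
have evD g h i : ev (g + h) i = ev g i + ev h i by exact: (@add_lfunE _ Q T).
suff key k h : h \in U -> exists2 w, w \in (W :&: U)%VS &
    forall i, (i < k)%N -> ev h i = ev w i.
  apply/subvP => h /(key (\dim {:Q}))[w wW hw].
  suff -> : h = w by move: wW; rewrite memv_cap => /andP[].
  apply/lfunP => q; rewrite (coord_vbasis (memvf q)) !linear_sum.
  by apply: eq_bigr => i _; rewrite !linearZ /=; congr (_ *: _); exact: hw.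
elim: k h => [|k IH] h hU; first by exists 0 => //; exact: mem0v.
pose P (V : {vspace rm_hom Q T}) (t : T) :=
  exists2 g, g \in V & (forall i, (i < k)%N -> ev g i = 0) /\ ev g k = t.
have Ps V : subspace_pred (P V).
  split=> [|a _ _ [g gV [g0 <-]] [g' g'V [g0' <-]]].
    by exists 0; rewrite ?mem0v //; split=> [i _|]; exact: (@zero_lfunE _ Q T).
  exists (a *: g + g'); first by rewrite memvD ?memvZ.
  by split=> [i ik|]; rewrite evL // g0 ?g0' // scaler0 addr0.
have NP (V V' : {vspace rm_hom Q T}) :
    (forall n u, n \in N -> u \in V -> op n u \in V') ->
    forall n t, n \in N -> t \in vspace_of (Ps V) -> op n t \in vspace_of (Ps V').
  move=> NV n t nN /mem_vspace_of[g gV [g0 <-]]; apply/mem_vspace_of.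
  exists (op n g); first exact: NV.
  by split=> [i ik|]; rewrite /ev nE // -/(ev g i) g0 // linear0.
have NUW' n u : n \in N -> u \in U -> op n u \in (W :&: U)%VS.
  by move=> nN uU; rewrite memv_cap NUW ?sU.
have /subvP sub : (vspace_of (Ps U) <= vspace_of (Ps (W :&: U)%VS))%VS.
  by apply: fT; [exact: subvf | exact: NP | exact: NP].
have [w wWU hw] := IH h hU.
have wU : w \in U by move: wWU; rewrite memv_cap => /andP[].
have : ev (h - w) k \in vspace_of (Ps U).
  apply/mem_vspace_of; exists (h - w); first by rewrite memvB.
  split=> // i ik; by rewrite evB hw // subrr.
move/sub/mem_vspace_of => [g gWU [g0 gk]].
exists (w + g); first by rewrite memvD.
move=> i; rewrite ltnS leq_eqVlt evD.
case/orP => [/eqP ->|ik]; last by rewrite g0 // addr0 hw.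
by rewrite gk evB addrC subrK.
Qed.

Hypothesis H : forall S : restModule L, irreducible S -> acts_zero J S ->
  ~ acts_zero N S -> relH1_zero S.

(** Each factor of a composition series is irreducible and not killed by N, so
    subtracting a coboundary moves the values of a cocycle one step down. *)
Lemma full_relH1_zero (M : restModule L) :
  acts_zero J M -> full_on N (fullv : {vspace M}) -> relH1_zero M.
Proof.
move=> JM fM; have [[n c] /= [c0 cn sc cc]] := comp_series_ex M.
suff key j f : (j <= n)%N -> lie_cocycle f -> vanishing_on J f ->
    (forall x, f x \in c j) -> lie_coboundary f.
  by move=> f Zf Jf; apply: (key n) => // x; rewrite cn memvf.
elim: j f => [|j IH] f jn Zf Jf fc.
  exists 0 => x; rewrite linear0; apply/eqP.
  by rewrite -memv0 -c0.
have [cj irT] := cc _ jn; have sW := sc _ (ltnW jn); have sU := sc _ jn.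
pose T := rm_factor sW sU; pose t : 'Hom(M, T) := toq (c j) (c j.+1).
have tE x v : v \in c j.+1 -> t (op x v) = op x (t v) by exact: toq_op.
have tfE y : (t \o f)%VF y = t (f y) by exact: comp_lfunE.
have [||||g Bg] := @H T irT _ _ (t \o f)%VF.
- by move=> x s xJ; have [u uU <-] := toq_surj s; rewrite -tE // JM // linear0.
- move=> NT; case: irT => /negP[]; rewrite -subv0; apply/subvP => s _.
  have [u uU <-] := toq_surj s; rewrite memv0 toq_eq0 //.
  have /subvP -> // : (c j.+1 <= c j)%VS.
  apply: fM; [exact: subvf | by move=> m v _ vU; exact/(sU m v) | ].
  move=> m v mN vU; rewrite -(toq_eq0 _ (sU m v vU)) -/t.
  by rewrite [t _]tE // NT.
- by move=> x y; rewrite !tfE Zf linearB -!tE.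
- by move=> x xJ; rewrite tfE Jf // linear0.
have [u uU ug] := toq_surj g.
apply: (coboundaryBl (m := u)); apply: IH; first exact: ltnW.
- by apply: cocycleB => //; exact: cocycle_cobd.
- by move=> x xJ; rewrite add_lfunE opp_lfunE cobdE Jf // JM // subr0.
- move=> x; rewrite -(toq_eq0 _ (U := c j.+1)) add_lfunE opp_lfunE cobdE.
    by rewrite linearB /= -/t tE // ug -Bg tfE subrr.
  by rewrite memvB ?sU.
Qed.

(** If NM <= X and X / Y is irreducible and not killed by N, a linear retraction
    r0 of M onto X / Y is corrected to a module map: its defect x |-> [x, r0]
    vanishes on X, so it is a cocycle with values in the full module
    Hom(M / X, X / Y). *)
Lemma retraction_ex (M : restModule L) (X Y : {vspace M}) :
  acts_zero J M -> stable X -> stable Y -> covers Y X ->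
  (forall n m, n \in N -> op n m \in X) ->
  ~ (forall n m, n \in N -> m \in X -> op n m \in Y) ->
  exists2 r : 'Hom(M, om_factor Y X), om_hom r &
    forall v, v \in X -> r v = toq Y X v.
Proof.
move=> JM sX sY YX NMX nNXY.
pose T := rm_factor sY sX; pose Q := rm_quot sX.
have tE x v : v \in X -> toq Y X (op x v) = op (M := T) x (toq Y X v).
  exact: toq_op.
have irT : irreducible T by exact: covers_irr.
have nNT : ~ acts_zero N T.
  move=> NT; apply: nNXY => n m nN mX; rewrite -(toq_eq0 _ (sX n m mX)).
  by rewrite [toq _ _ _]tE // NT.
move/existsNP: nNT => [n0 /existsNP[t0 /not_implyP[n0N /eqP nt0]]].
have fT := irr_full sN irT n0N nt0.
have NQ : acts_zero N Q.
  move=> n q nN; rewrite -(qreprK q) om_quotE //; apply/eqP.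
  by rewrite qproj_eq0 NMX.
pose r0 : 'Hom(M, T) := (toq Y X \o projv X)%VF.
have r0X v : v \in X -> r0 v = toq Y X v.
  by move=> vX; rewrite comp_lfunE projv_id.
pose d x : 'Hom(M, T) := op (M := rm_hom M T) x r0.
have dX x v : v \in X -> d x v = 0.
  by move=> vX; rewrite /d hom_omE !r0X ?sX // tE // subrr.
have dq x m : d x (qrepr X (qproj X m)) = d x m.
  by have /eqP := dX x _ (qrepr_projB X m); rewrite linearB subr_eq0 => /eqP.
pose f0 x : rm_hom Q T := (d x \o qrepr X)%VF.
have fL : linear f0.
  move=> a x y; rewrite /f0 /d (lm_opZD (M := rm_hom M T)).
  by rewrite [LHS]comp_lfunDl comp_lfunZl.
pose f := lin_of fL.
have fE x m : (f x : 'Hom(Q, T)) (qproj X m) = d x m.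
  by rewrite lin_ofE comp_lfunE dq.
have opq x (h : rm_hom Q T) (h' : rm_hom M T) :
    (forall m, (h : 'Hom(Q, T)) (qproj X m) = (h' : 'Hom(M, T)) m) ->
    forall m, (op x h : 'Hom(Q, T)) (qproj X m) = (op x h' : 'Hom(M, T)) m.
  by move=> hh m; rewrite !hom_omE (om_quotE _ _ sX) !hh.
have JT : acts_zero J T.
  by move=> x t xJ; have [u uX <-] := toq_surj t; rewrite -tE // JM // linear0.
have [||||h hE] := @full_relH1_zero (rm_hom Q T) _ _ f.
- move=> x h xJ; apply/lfunP => q; rewrite hom_omE -(qreprK q) JT //.
  rewrite (om_quotE _ _ sX) JM // linear0.
  by rewrite [(h : 'Hom(Q, T)) 0]linear0 subr0 zero_lfunE.
- exact: full_hom.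
- move=> x y; apply/lfunP => q; rewrite -(qreprK q).
  rewrite [RHS](@add_lfunE _ Q T) opp_lfunE fE /d (lm_lbr (l := rm_hom M T)).
  rewrite [LHS](@add_lfunE _ M T) opp_lfunE.
  by congr (_ - _); symmetry; apply: opq => m; exact: fE.
- move=> x xJ; apply/lfunP => q; rewrite -(qreprK q) fE zero_lfunE.
  by rewrite /d hom_omE JT // JM // linear0 subr0.
pose r : rm_hom M T := r0 - ((h : 'Hom(Q, T)) \o qproj X)%VF.
have rE : forall m, (r : 'Hom(M, T)) m = r0 m - (h : 'Hom(Q, T)) (qproj X m).
  by move=> m; rewrite [LHS](@add_lfunE _ M T) opp_lfunE comp_lfunE.
exists (r : 'Hom(M, T)).
  move=> x m; suff : (op x r : 'Hom(M, T)) m = 0.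
    by rewrite hom_omE => /eqP; rewrite subr_eq0 => /eqP <-.
  rewrite /r linearB [LHS](@add_lfunE _ M T) opp_lfunE.
  rewrite -[X in X - _]/(d x m) -fE hE; apply/eqP; rewrite subr_eq0; apply/eqP.
  by apply: opq => k; rewrite comp_lfunE.
move=> v vX; rewrite rE; have /eqP -> : qproj X v == 0 by rewrite qproj_eq0.
by rewrite [(h : 'Hom(Q, T)) 0]linear0 subr0 r0X.
Qed.

Lemma covers_below (M : opmod F L) (U : {vspace M}) : stable U -> U != 0%VS ->
  exists2 W : {vspace M}, stable W & covers W U.
Proof.
move=> sU U0; pose P k := exists W : {vspace M},
  [/\ stable W, (W <= U)%VS, W != U & \dim W = k].
have [||k [W [sW WU nW dW]] kmax] := @max_nat_ex P (\dim U).
- by exists 0%N, 0%VS; rewrite sub0v eq_sym dimv0; split=> //; exact: stable0.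
- by move=> k [W [_ WU _ <-]]; exact: dimvS.
exists W => //; split=> // V sV WV VU.
have [-> | nV] := eqVneq V U; [by right | left].
by apply/esym/eqP; rewrite eqEdim WV dW kmax //; exists V.
Qed.

(** As long as NM is nonzero, the kernel C of a retraction onto a simple quotient
    of NM is a proper submodule with M = NM + C. Since g vanishes on NM, the
    vector m can be moved into C without changing g m. *)
Lemma invariant_lift (Z : vectType F) (M : restModule L)
    (g : 'Hom(M, Z)) (m : M) :
  (N <= derived_term N + J)%VS -> acts_zero J M ->
  (forall x v, g (op x v) = 0) ->
  exists2 m', forall n, n \in N -> op n m' = 0 & g m' = g m.
Proof.
move=> perf; have [k] := ubnP (\dim {:M}); elim: k => // k IH in M g m *.
rewrite ltnS => dM JM gM.
have [NM|nNM] := pselect (acts_zero N M).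
  by exists m => // n nN; exact: NM.
pose P (v : M) := forall V : {vspace M},
  (forall n w, n \in N -> op n w \in V) -> v \in V.
have Ps : subspace_pred P.
  split=> [V _|a u v hu hv V hV]; first exact: mem0v.
  by rewrite memvD ?memvZ ?hu ?hv.
pose X := vspace_of Ps.
have NX n v : n \in N -> op n v \in X.
  by move=> nN; apply/mem_vspace_of => V; apply.
have minX (V : {vspace M}) :
    (forall n w, n \in N -> op n w \in V) -> (X <= V)%VS.
  by move=> hV; apply/subvP => v /mem_vspace_of; apply.
have sX : stable X.
  move=> x v vX; suff /subvP/(_ v vX) : (X <= op x @^-1: X)%VS.
    by rewrite -memv_preim.
  apply: minX => n w nN; rewrite -memv_preim.
  have := lm_swap x n w => /eqP; rewrite -subr_eq => /eqP <-.
  by rewrite memvB ?NX // lbrC memvN; exact: sN.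
have X0 : X != 0%VS.
  apply: contra_notN nNM => /eqP X0 x v xN; apply/eqP.
  by rewrite -memv0 -X0 NX.
have [Y sY YX] := covers_below sX X0; have [subYX nYX _] := YX.
have nNXY : ~ (forall n v, n \in N -> v \in X -> op n v \in Y).
  move=> NXY; case/negP: nYX; rewrite eqEsubv subYX; apply: minX => n w nN.
  pose Q (x : L) := forall v : M, op x v \in Y.
  have Qs : subspace_pred Q.
    split=> [v|a x y hx hy v]; first by rewrite lm_op0 mem0v.
    by rewrite lm_opZD memvD ?memvZ ?hx ?hy.
  suff /subvP/(_ n nN)/mem_vspace_of : (N <= vspace_of Qs)%VS by apply.
  apply: subv_trans perf _; rewrite subv_add; apply/andP; split.
    apply/span_subvP => _ /allpairsP[[x y] [/= /vbasis_mem xN /vbasis_mem yN ->]].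
    apply/mem_vspace_of => v.
    by rewrite lm_lbr memvB // NXY // NX.
  apply/subvP => x xJ; apply/mem_vspace_of => v.
  by rewrite JM // mem0v.
have [r hr rX] := retraction_ex JM sX sY YX NX nNXY.
have sC : stable (lker r).
  by move=> x v; rewrite !memv_ker hr => /eqP ->; rewrite linear0.
have [t tX rt] : exists2 t, t \in X & r t = r m.
  by have [t tX tm] := toq_surj (r m); exists t; rewrite // rX.
have gX v : v \in X -> g v = 0.
  have /subvP sub : (X <= lker g)%VS.
    by apply: minX => n w _; rewrite memv_ker gM.
  by move/sub; rewrite memv_ker => /eqP.
have cC : m - t \in lker r by rewrite memv_ker linearB /= rt subrr.
pose C := rm_sub sC.
pose i : 'Hom(C, M) := linfun vsval.
have iE v : i v = vsval v by rewrite lfunE.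
have [|||m' Nm' gm'] := IH C (g \o i)%VF (vsproj (lker r) (m - t)).
- apply: leq_trans dM; rewrite dimvf.
  change (\dim (lker r) < \dim {:M})%N.
  rewrite ltn_neqAle dimvS ?subvf // andbT.
  apply: contra nYX => /eqP dC.
  have lf : lker r = fullv by apply/eqP; rewrite eqEdim subvf dC leqnn.
  rewrite eqEsubv subYX; apply/subvP => v vX.
  by rewrite -(toq_eq0 _ vX) -rX // -memv_ker lf memvf.
- by move=> x v xJ; apply: val_inj; rewrite [LHS]om_subE // JM // linear0.
- by move=> x v; rewrite comp_lfunE iE om_subE // gM.
exists (val m') => [n nN|].
  by rewrite -(om_subE _ _ sC) Nm' // linear0.
have : g (i m') = g (i (vsproj (lker r) (m - t))) by rewrite -!comp_lfunE gm'.
by rewrite !iE vsprojK // linearB /= (gX t) // subr0.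
Qed.

End Splitting.

(** * Eigenvectors over a finite extension *)

Section Eigenvectors.
Variable F : fieldType.

Lemma irreducible_factor_ex (q : {poly F}) : (1 < size q)%N ->
  exists2 r : {poly F}, irreducible_poly r & r %| q.
Proof.
move=> q1; have [|k [r [r1 rq <-]] kmin] := @min_nat_ex
    (fun k => exists r : {poly F}, [/\ (1 < size r)%N, r %| q & size r = k]).
  by exists (size q), q; split.
exists r => //; split=> // s s1 sr.
have r0 : r != 0 by rewrite -size_poly_gt0 ltnW.
have s0 : s != 0 by apply: contraTneq sr => ->; rewrite dvd0p.
rewrite -(dvdp_size_eqp sr) eqn_leq dvdp_leq //= kmin //.
exists s; split=> //; last exact: dvdp_trans sr rq.
by case: (size s) s1 (size_poly_gt0 s) => [|[|]] //; rewrite s0.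
Qed.

(** Write the characteristic polynomial as X^k q with q(0) <> 0. If q is constant
    then B^k = 0 by Cayley-Hamilton; otherwise q has a root in some extension. *)
Lemma nilpotent_or_eigenvector n (B : 'M[F]_n) :
  (exists k, forall v : 'rV[F]_n, iter k (mulmxr B) v = 0) \/
  exists (K : fieldExtType F) (a : K) (y : 'rV[K]_n),
    [/\ a != 0, y != 0 & y *m map_mx (in_alg K) B = a *: y].
Proof.
case: n B => [|n] B; first by left; exists 0%N => v; apply/rowP => -[].
have [k [q qn0 qE]] := multiplicity_XsubC (char_poly B) 0.
have q0 : ~~ root q 0 by move: qn0; rewrite monic_neq0 ?char_poly_monic.
rewrite subr0 in qE.
have [q1|q1] := leqP (size q) 1.
  left; exists k => v.
  have [c qc] : exists c, q = c%:P by exists q`_0; exact: size1_polyC.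
  have c0 : c != 0 by apply: contraNneq q0 => c0; rewrite qc c0 rootC.
  have := Cayley_Hamilton B; rewrite qE qc rmorphM /= horner_mx_C rmorphXn /=.
  rewrite horner_mx_X => /eqP; rewrite -mulmxE mul_scalar_mx scaler_eq0 (negPf c0) /=.
  move=> /eqP Bk; have itE : iter k (mulmxr B) v = v *m B ^+ k.
    elim: k {Bk qE} => [|k IH]; first by rewrite expr0 mulmx1.
    by rewrite iterS IH exprSr /= mulmxA.
  by rewrite itE Bk mulmx0.
right; have [r irr rq] := irreducible_factor_ex q1.
have [K _ [a ra _]] := irredp_FAdjoin irr.
have qa : root (map_poly (in_alg K) q) a.
  by rewrite -(divpK rq) rmorphM /= rootM ra orbT.
have /eigenvalueP[y yE y0] : eigenvalue (map_mx (in_alg K) B) a.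
  by rewrite eigenvalue_root_char -map_char_poly qE rmorphM /= rootM qa.
exists K, a, y; split=> //; apply: contraNneq q0 => a0.
by rewrite a0 -(rmorph0 (in_alg K)) fmorph_root in qa.
Qed.

End Eigenvectors.

(** * Multilinear forms *)

Section Forms.
Variables (F : fieldType) (p : nat) (L : restrictedLie F p) (V : restModule L).
Variable K : fieldExtType F.

(** The k-linear forms on V; as iterated Hom modules they inherit their restricted
    structure from [rm_hom]. *)
Fixpoint forms k : restModule L :=
  if k is k'.+1 then rm_hom V (forms k') else triv_rm L.

Local Notation m := (\dim {:V}).
Let e (i : 'I_m) : V := (vbasis {:V})`_i.

Definition coord_row (v : V) : 'rV[F]_m := \row_j coord (vbasis {:V}) j v.
Definition opmx (x : L) : 'M[F]_m := \matrix_i coord_row (op x (e i)).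

Lemma coord_row_sum v : v = \sum_j coord_row v 0 j *: e j.
Proof.
rewrite {1}(coord_vbasis (memvf v)); apply: eq_bigr => j _.
by rewrite mxE.
Qed.

Fact coord_row_linear : linear coord_row.
Proof. by move=> a u v; apply/rowP => j; rewrite !mxE linearP. Qed.
HB.instance Definition _ :=
  GRing.isLinear.Build F V 'rV[F]_m _ coord_row coord_row_linear.

Lemma coord_row_inj : injective coord_row.
Proof. by move=> u v uv; rewrite (coord_row_sum u) uv -coord_row_sum. Qed.

Lemma coord_row_op x v : coord_row (op x v) = coord_row v *m opmx x.
Proof.
rewrite {1}(coord_row_sum v) !linear_sum; apply/rowP => j.
rewrite !mxE summxE; apply: eq_bigr => i _.
by rewrite !linearZ /= !mxE.
Qed.

Local Notation opK x := (map_mx (in_alg K) (opmx x)).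
Local Notation vecK v := (map_mx (in_alg K) (coord_row v)).

(** The value at K-vectors of the K-multilinear extension of a form. *)
Fixpoint eval k : forms k -> seq 'rV[K]_m -> K :=
  match k with
  | 0 => fun l _ => in_alg K (l : F)
  | k'.+1 => fun l ws => \sum_j (head 0 ws) 0 j *
                          eval ((l : 'Hom(V, forms k')) (e j)) (behead ws)
  end.

Lemma eval_linear k ws : linear (fun l : forms k => eval l ws).
Proof.
elim: k ws => [|k IH] ws a l l' /=.
  by rewrite scalerDl -scalerA.
rewrite scaler_sumr -big_split; apply: eq_bigr => j _ /=.
by rewrite (@lfunZDE _ V (forms k)) IH mulrDr scalerAr.
Qed.

Definition evalL k ws : 'Hom(forms k, K) := lin_of (eval_linear (k := k) ws).

Lemma evalLE k ws l : @evalL k ws l = eval l ws.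
Proof. exact: lin_ofE. Qed.

Lemma eval_op k x (l : forms k) ws : size ws = k ->
  eval (op x l) ws =
  - \sum_(i < k) eval l (set_nth 0 ws i (nth 0 ws i *m opK x)).
Proof.
elim: k l ws => [|k IH] l ws.
  by move=> /size0nil ->; rewrite big_ord0 oppr0 /= lfunE /= scale0r.
case: ws => // w ws [sws]; rewrite big_ord_recl.
have -> : eval (op x l) (w :: ws) =
    (\sum_j w 0 j * eval (op x ((l : 'Hom(V, forms k)) (e j))) ws) -
    eval l ((w *m opK x) :: ws).
  rewrite /= -sumrB; under eq_bigr => j _.
    rewrite hom_omE -evalLE linearB /= evalLE evalLE mulrBr; over.
  rewrite !sumrB; congr (_ - _).
  under eq_bigr => j _.
    rewrite (coord_row_sum (op x (e j))) linear_sum -evalLE linear_sum mulr_sumr.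
    over.
  rewrite exchange_big; apply: eq_bigr => i _ /=.
  rewrite mxE mulr_suml; apply: eq_bigr => j _.
  rewrite !linearZ /= evalLE !mxE -mulr_algl mulrA; congr (_ * _ * _).
rewrite opprD addrC; congr (_ + _).
rewrite -sumrN; under eq_bigr => j _ do rewrite IH // mulrN mulr_sumr.
rewrite sumrN exchange_big sumrN; congr (- _); exact: eq_bigr.
Qed.

Fact coord_scale_linear (W : vectType F) i0 (l : W) :
  linear (fun v => coord (vbasis {:V}) i0 v *: l).
Proof. by move=> a u v; rewrite linearP /= scalerDl scalerA. Qed.

Definition symmetric_form k (l : forms k) :=
  forall ws ws', size ws = k -> perm_eq ws ws' -> eval l ws = eval l ws'.

Lemma eval_op_sym k x (l : forms k) ws : size ws = k -> symmetric_form l ->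
  eval (op x l) ws = - \sum_(w <- ws) eval l ((w *m opK x) :: rem w ws).
Proof.
move=> sws sl; rewrite eval_op //; congr (- _).
rewrite (big_nth 0) big_mkord sws; apply: eq_bigr => i _.
have iw : (i < size ws)%N by rewrite sws.
apply: sl; first by rewrite size_set_nth sws; exact/maxn_idPr.
rewrite set_nthE iw.
set a := nth 0 ws i; set t := take i ws; set d := drop _ ws.
have wsE : perm_eq ws (a :: t ++ d).
  by rewrite -{1}(cat_take_drop i ws) (drop_nth 0 iw) -cat1s perm_catCA.
apply: (@perm_trans _ (a *m opK x :: t ++ d)).
  by rewrite -cat1s perm_catCA.
rewrite perm_cons -(perm_cons a) -(permPl wsE); apply: perm_to_rem.
exact: mem_nth.
Qed.

Fact symmetric_subspace k : subspace_pred (@symmetric_form k).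
Proof.
split=> [ws ws' _ _|a l l' hl hl' ws ws' sws pws].
  by rewrite -!evalLE !linear0.
by rewrite !eval_linear (hl ws ws') ?(hl' ws ws').
Qed.

Lemma symmetric_op k x (l : forms k) : symmetric_form l ->
  symmetric_form (op x l).
Proof.
move=> sl ws ws' sws pws; have sws' : size ws' = k by rewrite -(perm_size pws).
rewrite !eval_op_sym // (perm_big _ pws) /=; congr (- _).
apply: eq_big_seq => w ww'.
have ww : w \in ws by rewrite (perm_mem pws).
apply: sl; first by rewrite /= size_rem // prednK //; case: (ws) ww.
rewrite perm_cons -(perm_cons w) -(permPl (perm_to_rem ww)).
by rewrite -(permPr (perm_to_rem ww')).
Qed.

(** The symmetric form ell^k, for a coordinate function ell. *)
Fixpoint coord_power (i0 : 'I_m) k : forms k :=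
  if k is k'.+1 return forms k
  then lin_of (coord_scale_linear i0 (coord_power i0 k')) else (1 : F^o).

Lemma eval_coord_power i0 k ws : size ws = k ->
  eval (coord_power i0 k) ws = \prod_(w <- ws) w 0 i0.
Proof.
elim: k ws => [|k IH] [|w ws] // sws; first by rewrite big_nil /= scale1r.
rewrite big_cons -IH; last by case: sws.
rewrite /= (bigD1 i0) //= lin_ofE coord_free ?(basis_free (vbasisP _)) //.
rewrite eqxx scale1r big1 ?addr0 // => j /negPf ji.
rewrite lin_ofE coord_free ?(basis_free (vbasisP _)) //.
rewrite [_ == _](ji : (j == i0 :> nat) = false) scale0r.
by rewrite -evalLE linear0 mulr0.
Qed.

Lemma coord_power_sym i0 k : symmetric_form (coord_power i0 k).
Proof.
move=> ws ws' sws pws; rewrite !eval_coord_power // -?(perm_size pws) //.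
exact: perm_big.
Qed.

Lemma eval_head k (l : forms k.+1) (I : Type) (r : seq I) (c : I -> K)
    (w : I -> 'rV[K]_m) ws :
  eval l ((\sum_(i <- r) c i *: w i) :: ws) =
  \sum_(i <- r) c i * eval l (w i :: ws).
Proof.
under [RHS]eq_bigr => i _ do rewrite /= mulr_sumr.
rewrite exchange_big; apply: eq_bigr => j _ /=.
rewrite summxE mulr_suml; apply: eq_bigr => i _.
by rewrite mxE mulrA.
Qed.

Lemma forms_acts_zero (J : {vspace L}) k :
  acts_zero J V -> acts_zero J (forms k).
Proof.
move=> JV; elim: k => [|k IH] x l xJ; first by rewrite /= lfunE.
by apply/lfunP => v; rewrite hom_omE IH // JV // linear0 subr0 zero_lfunE.
Qed.

End Forms.


(** * Cohomology of a nonabelian chief factor *)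

Section NonabelianFactor.
Variables (F : fieldType) (p : nat) (L : restrictedLie F p).
Variables (N J : {vspace L}).
Hypothesis sN : stable (M := adj L) N.
Hypothesis perfN : (N <= derived_term N + J)%VS.
Hypothesis H : forall S : restModule L, irreducible S -> acts_zero J S ->
  ~ acts_zero N S -> relH1_zero J S.

(** Invariance under z at the arguments (u, y, .., y): all terms but the first
    contain z y = 0. *)
Lemma eval_sandwich (V : restModule L) (K : fieldExtType F)
    (y u : 'rV[K]_(\dim {:V})) (z : seq (K * L)) k (l : forms V k.+1) :
  symmetric_form K l -> (forall c, c \in z -> op c.2 l = 0) ->
  \sum_(c <- z) c.1 *: (u *m map_mx (in_alg K) (opmx V c.2)) = y ->
  \sum_(c <- z) c.1 *: (y *m map_mx (in_alg K) (opmx V c.2)) = 0 ->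
  eval l (nseq k.+1 y) = 0.
Proof.
move=> sl zl zu zy; pose R := rem y (u :: nseq k y).
have main c : c \in z ->
    eval l (u *m map_mx (in_alg K) (opmx V c.2) :: nseq k y) =
    - (eval l (y *m map_mx (in_alg K) (opmx V c.2) :: R) *+ k).
  move=> cz; have := eval_op_sym c.2 (ws := u :: nseq k y) _ sl.
  rewrite zl // -evalLE linear0 /= size_nseq => /(_ erefl)/esym/eqP.
  rewrite oppr_eq0 big_cons eqxx addr_eq0 => /eqP ->; congr (- _).
  rewrite (eq_big_seq (fun=> eval l
      (y *m map_mx (in_alg K) (opmx V c.2) :: R))); last first.
    by move=> w; rewrite mem_nseq => /andP[_ /eqP ->].
  by rewrite big_const_seq count_predT size_nseq iter_addr_0.
rewrite -[nseq k.+1 y]/(y :: nseq k y) -{1}zu eval_head.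
rewrite (eq_big_seq (fun c => - (c.1 * eval l
    (y *m map_mx (in_alg K) (opmx V c.2) :: R) *+ k))); last first.
  by move=> c cz; rewrite main // mulrN mulrnAr.
rewrite sumrN sumrMnl -eval_head zy.
rewrite (_ : eval l (0 :: R) = 0) ?mul0rn ?oppr0 //.
by rewrite /= big1 // => j _; rewrite mxE mul0r.
Qed.

(** On symmetric p-linear forms the map l |-> l(y, .., y) is L-invariant, since
    p = 0; so an N-invariant symmetric form l with l(y, .., y) <> 0 exists. But
    if z u = y and z y = 0 for some z in K (x) N, then
    0 = (z l)(u, y, .., y) = - l(y, .., y). *)
Lemma no_sandwich (V : restModule L) (K : fieldExtType F)
    (y u : 'rV[K]_(\dim {:V})) (z : seq (K * L)) :
  acts_zero J V -> all (fun c => c.2 \in N) z ->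
  \sum_(c <- z) c.1 *: (u *m map_mx (in_alg K) (opmx V c.2)) = y ->
  \sum_(c <- z) c.1 *: (y *m map_mx (in_alg K) (opmx V c.2)) = 0 ->
  y = 0.
Proof.
move=> JV zN zu zy; apply/eqP/contraT => y0.
have [i0 yi0] : exists i, y 0 i != 0.
  apply/existsP; apply: contraNT y0; rewrite negb_exists => /forallP h.
  by apply/eqP/rowP => i; rewrite mxE; apply/eqP; have := h i; rewrite negbK.
have p_gt0 : (0 < p)%N := prime_gt0 (rl_prime L).
have remE k : rem y (nseq k y) = nseq k.-1 y by case: k => //= k; rewrite eqxx.
pose W := vspace_of (@symmetric_subspace F p L V K p).
have sW : stable W.
  move=> x l /mem_vspace_of hl; apply/mem_vspace_of; exact: symmetric_op.
pose P := rm_sub sW; pose i : 'Hom(P, forms V p) := linfun vsval.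
have iE l : i l = vsval l by rewrite lfunE.
have iS l : symmetric_form K (i l).
  by rewrite iE; have /mem_vspace_of := subvsP (l : subvs_of W).
have iop x l : i (op x l) = op x (i l) by rewrite !iE om_subE.
pose g : 'Hom(P, K) := (evalL _ (nseq p y) \o i)%VF.
have gE l : g l = eval (i l) (nseq p y) by rewrite comp_lfunE evalLE.
pose l0 : P := vsproj W (coord_power i0 p).
have [||l Nl gl] := invariant_lift sN H (g := g) l0 perfN.
- move=> x l xJ; apply: val_inj; rewrite [LHS]om_subE // linear0.
  by have -> := @forms_acts_zero _ _ _ V J p JV x (vsval l) xJ.
- move=> x l; rewrite gE iop eval_op_sym ?size_nseq //.
  rewrite (eq_big_seq (fun=> eval (i l)
    (y *m map_mx (in_alg K) (opmx V x) :: nseq p.-1 y))); last first.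
    move=> w; rewrite mem_nseq => /andP[_ /eqP ->].
    by rewrite remE.
  rewrite big_const_seq count_predT size_nseq iter_addr_0 -mulr_natl.
  have pK : p \in [pchar K] by rewrite GRing.pchar_lalg (rl_char L).
  by rewrite (pcharf0 pK) mul0r oppr0.
have l0E : i l0 = coord_power i0 p.
  rewrite iE vsprojK //; apply/mem_vspace_of; exact: coord_power_sym.
have : eval (i l) (nseq p y) != 0.
  rewrite -gE gl gE l0E eval_coord_power ?size_nseq //.
  rewrite prodf_seq_neq0; apply/allP => w.
  by rewrite mem_nseq => /andP[_ /eqP ->].
case/negP; apply/eqP.
have Nil c : c \in z -> op c.2 (i l) = 0.
  by move=> cz; rewrite -iop Nl ?linear0 //; exact: (allP zN).
suff key k (f : forms V k) : (0 < k)%N -> symmetric_form K f ->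
    (forall c, c \in z -> op c.2 f = 0) -> eval f (nseq k y) = 0.
  exact: key p_gt0 (iS l) Nil.
by case: k f => // k f _ sf zf; exact: eval_sandwich sf zf zu zy.
Qed.

Lemma alternating_sum (I : Type) (U : zmodType) (r : seq I) (c : I -> I -> U) :
  (forall i, c i i = 0) -> (forall i j, c i j = - c j i) ->
  \sum_(i <- r) \sum_(j <- r) c i j = 0.
Proof.
move=> c0 cN; elim: r => [|a r IH]; first by rewrite big_nil.
rewrite big_cons; under [X in _ + X]eq_bigr => i _ do rewrite big_cons cN.
by rewrite big_split /= IH addr0 sumrN big_cons c0 add0r subrr.
Qed.

(** Suppose that x in N acts nontrivially on V = N / J. If x is nilpotent on V,
    it serves as the operator z of the previous lemma. Otherwise take for y an
    eigenvector of x over an extension field, with eigenvalue a <> 0, for z a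
    lift of y to N, and for u the class of - x / a: then [z, u] = [x, y] / a = y
    and [z, y] = 0. *)
Lemma factor_abelian : stable (M := adj L) J ->
  forall x y, x \in N -> y \in N -> lbr x y \in J.
Proof.
move=> sJ x y xN yN.
have brN a b : b \in N -> lbr a b \in N by exact: sN.
pose V := rm_factor (M := adj_rm L) sJ sN.
pose t : 'Hom(L, V) := toq (M := adj L) J N.
have tE z v : v \in N -> op z (t v) = t (lbr z v).
  by move=> vN; rewrite [RHS](toq_op (M := adj L)).
have JV : acts_zero J V.
  move=> z v zJ; have [w wN <-] := toq_surj (M := adj L) v.
  rewrite [LHS]tE //; apply/eqP; rewrite [_ == _](toq_eq0 (M := adj L)).
    by rewrite lbrC memvN; exact/(sJ w z).
  exact: brN.
suff xV v : op (M := V) x v = 0.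
  by have := xV (t y); rewrite tE // => /eqP; rewrite (toq_eq0 (M := adj L)) // brN.
apply/eqP/contraT => xv.
pose m := \dim {:V}; pose e (i : 'I_m) : V := (vbasis {:V})`_i.
have [[k xk]|[K [a [w [a0 w0 xw]]]]] := nilpotent_or_eigenvector (opmx V x).
  have xkE j u : iter j (mulmxr (opmx V x)) (coord_row u) = coord_row (iter j (op x) u).
    by elim: j => [|j IH] //; rewrite !iterS IH coord_row_op.
  have [|j xj jmin] := @min_nat_ex (fun j => iter j (op x) v = 0).
    by exists k; apply: coord_row_inj; rewrite -xkE xk linear0.
  case: j xj jmin => [|[|j]] xj jmin.
  - by rewrite [v](xj : v = 0) linear0 eqxx in xv.
  - by rewrite [op x v](xj : op x v = 0) eqxx in xv.
  pose u := iter j (op x) v.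
  have xu : op x u != 0 by apply/eqP => h; have := jmin j.+1 h; rewrite ltnn.
  have := @no_sandwich V F^o (map_mx (in_alg F^o) (coord_row (op x u)))
    (map_mx (in_alg F^o) (coord_row u)) [:: (1, x)] JV.
  have cE v' : map_mx (in_alg F^o) (coord_row v') *m map_mx (in_alg F^o) (opmx V x) =
      map_mx (in_alg F^o) (coord_row (op x v')) by rewrite coord_row_op map_mxM.
  rewrite !big_seq1 /= xN !scale1r !cE => /(_ isT erefl).
  rewrite [op x (op x u)](xj : op x (op x u) = 0) linear0 map_mx0 => /(_ erefl).
  move/eqP; rewrite map_mx_eq0 => /eqP h; case/eqP: xu; apply: coord_row_inj.
  by rewrite h linear0.
have nb (i : 'I_m) : exists n, n \in N /\ t n = e i.
  by have [n nN nE] := toq_surj (M := adj L) (e i); exists n.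
pose n i := projT1 (cid (nb i)).
have nN i : n i \in N by rewrite /n; case: cid => ? [].
have nE i : t (n i) = e i by rewrite /n; case: cid => ? [].
pose vecK (v : V) := map_mx (in_alg K) (coord_row v).
have vecK_op z v' : vecK v' *m map_mx (in_alg K) (opmx V z) = vecK (op z v').
  by rewrite /vecK coord_row_op map_mxM.
have wE : w = \sum_i w 0 i *: vecK (e i).
  apply/rowP => i; rewrite summxE (bigD1 i) //= big1 ?addr0 => [|j /negPf ji].
    rewrite !mxE coord_free ?(basis_free (vbasisP _)) //.
    by rewrite eqxx rmorph1 mulr1.
  rewrite !mxE coord_free ?(basis_free (vbasisP _)) //.
  by rewrite [_ == _](ji : (j == i :> nat) = false) rmorph0 mulr0.
case/eqP: w0; apply: (@no_sandwich V K w (- a^-1 *: vecK (t x))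
  [seq (w 0 i, n i) | i <- enum 'I_m] JV).
- by apply/allP => _ /mapP[i _ ->] /=.
- rewrite big_map big_enum /=.
  transitivity (a^-1 *: (w *m map_mx (in_alg K) (opmx V x))); last first.
    by rewrite xw scalerA mulVf // scale1r.
  rewrite {2}wE mulmx_suml scaler_sumr; apply: eq_bigr => i _.
  rewrite -!scalemxAl !vecK_op tE // lbrC linearN /= -tE // nE.
  by rewrite /vecK linearN map_mxN scalerN scaleNr opprK !scalerA mulrC.
- rewrite big_map big_enum /=.
  under eq_bigr => i _.
    rewrite {2}wE mulmx_suml scaler_sumr.
    under eq_bigr => j _ do rewrite -scalemxAl vecK_op -nE tE // scalerA.
    over.
  apply: alternating_sum => [i|i j].
    by rewrite lbrxx linear0 /vecK linear0 map_mx0 scaler0.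
  by rewrite lbrC linearN /vecK linearN map_mxN scalerN mulrC.
Qed.

End NonabelianFactor.

(** * Counting factors by restriction of maps *)

Section Schur.
Variables (F : fieldType) (X : Type) (M S : opmod F X).

Lemma om_hom_lker (g : 'Hom(M, S)) : om_hom g -> stable (lker g).
Proof.
by move=> hg x v; rewrite !memv_ker hg => /eqP ->; rewrite linear0.
Qed.

Lemma om_hom_limg (g : 'Hom(M, S)) : om_hom g -> stable (limg g).
Proof.
by move=> hg x _ /memv_imgP[v _ ->]; rewrite -hg memv_img ?memvf.
Qed.

Lemma Schur_lker (g : 'Hom(M, S)) (v : M) :
  irreducible M -> om_hom g -> g v != 0 -> lker g = 0%VS.
Proof.
move=> [_ irM] hg gv; case: (irM _ (om_hom_lker hg)) => // kf.
by have := memvf v; rewrite -kf memv_ker (negPf gv).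
Qed.

Lemma Schur_limg (g : 'Hom(M, S)) (v : M) :
  irreducible S -> om_hom g -> g v != 0 -> limg g = fullv.
Proof.
move=> [_ irS] hg gv; case: (irS _ (om_hom_limg hg)) => // k0.
by have := memv_img g (memvf v); rewrite k0 memv0 (negPf gv).
Qed.

End Schur.

Lemma mem_Homs (F : fieldType) (X : Type) (M N : opmod F X) (f : 'Hom(M, N)) :
  f \in Homs M N <-> om_hom f.
Proof. exact: mem_vspace_of. Qed.

Section Restriction.
Variables (F : fieldType) (X : Type) (M S : opmod F X) (W U : {vspace M}).
Hypotheses (sW : stable W) (sU : stable U).
Hypotheses (irT : irreducible (om_factor W U)) (irS : irreducible S).
Variables (Z Z' : {vspace 'Hom(M, S)}).
Hypothesis Zop : forall f x u, f \in Z -> u \in U -> f (op x u) = op x (f u).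
Hypothesis ZW : forall f w, f \in Z -> w \in W -> f w = 0.
Hypothesis Zcomp : forall phi f, om_hom phi -> f \in Z -> (phi \o f)%VF \in Z.
Hypothesis Z'E : forall f, f \in Z' <-> f \in Z /\ forall u, u \in U -> f u = 0.

Let lift : 'Hom(om_factor W U, M) :=
  (qrepr W \o linfun (vsval : subvs_of (qproj W @: U)%VS -> _))%VF.

Let liftB u : u \in U -> lift (toq W U u) - u \in W.
Proof.
move=> uU; have -> : lift (toq W U u) = qrepr W (qproj W u).
  by rewrite comp_lfunE; congr (qrepr W _); rewrite lfunE; exact: val_toq.
exact: qrepr_projB.
Qed.

Let liftE f u : f \in Z -> u \in U -> f (lift (toq W U u)) = f u.
Proof.
move=> fZ uU; apply/eqP; rewrite -subr_eq0 -linearB; apply/eqP.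
exact: ZW (liftB uU).
Qed.

(** By Schur's lemma any two maps of Z that are nonzero on U differ there by an
    endomorphism of S. *)
Lemma restriction_dim f0 u0 : f0 \in Z -> u0 \in U -> f0 u0 != 0 ->
  om_iso (om_factor W U) S /\ \dim Z = (\dim Z' + \dim (Homs S S))%N.
Proof.
move=> f0Z u0U fu0; pose g := (f0 \o lift)%VF.
have gdef t : g t = f0 (lift t) by exact: comp_lfunE.
have gE u : u \in U -> g (toq W U u) = f0 u.
  by move=> uU; rewrite gdef liftE.
have liftop f x t : f \in Z -> f (lift (op x t)) = op x (f (lift t)).
  move=> fZ; have [u uU <-] := toq_surj t.
  by rewrite -toq_op // !liftE ?sU // Zop.
have hg : om_hom g by move=> x t; rewrite !gdef liftop.
have gu0 : g (toq W U u0) != 0 by rewrite gE.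
have kg := Schur_lker irT hg gu0; have ig := Schur_limg irS hg gu0.
split; first by exists g.
have gK : cancel g (g^-1)%VF by apply/lker0_lfunK/eqP.
have surj s : exists2 u, u \in U & f0 u = s.
  have : s \in limg g by rewrite ig memvf.
  case/memv_imgP => t _ ->; have [u uU <-] := toq_surj t.
  by exists u; rewrite ?gE.
have PhiL : linear (fun phi : 'End(S) => (phi \o f0)%VF).
  by move=> a phi psi; rewrite comp_lfunDl comp_lfunZl.
pose Phi := lin_of PhiL.
have PhiE phi v : Phi phi v = phi (f0 v) by rewrite lin_ofE comp_lfunE.
have Phi_inj phi : (forall u, u \in U -> Phi phi u = 0) -> phi = 0.
  move=> h; apply/lfunP => s; rewrite zero_lfunE; have [u uU <-] := surj s.
  by rewrite -PhiE h.
have dPhi : \dim (Phi @: Homs S S) = \dim (Homs S S).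
  apply: limg_dim_eq; apply/eqP; rewrite -subv0; apply/subvP => phi.
  rewrite memv_cap memv_ker => /andP[_ /eqP h]; rewrite memv0.
  by apply/eqP/Phi_inj => u _; rewrite h zero_lfunE.
rewrite -dPhi -dimv_disjoint_sum; last first.
  apply/eqP; rewrite -subv0; apply/subvP => f; rewrite memv_cap memv0.
  case/andP => /Z'E[_ fU] /memv_imgP[phi _ fphi].
  by rewrite fphi (Phi_inj phi) ?linear0 // => u uU; rewrite -fphi fU.
congr (\dim _); apply/eqP; rewrite eqEsubv subv_add; apply/and3P; split.
- apply/subvP => f fZ; pose phi := (f \o lift \o g^-1)%VF.
  have phiE u : u \in U -> phi (f0 u) = f u.
    have phidef s : phi s = f (lift ((g^-1)%VF s)) by rewrite /phi !comp_lfunE.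
    by move=> uU; rewrite phidef -(gE u uU) gK liftE.
  have hphi : om_hom phi.
    move=> x s; have [u uU <-] := surj s.
    by rewrite -Zop // !phiE ?sU // Zop.
  rewrite -[f](subrK (Phi phi)); apply: memv_add.
    apply/Z'E; split=> [|u uU].
      by rewrite memvB // lin_ofE Zcomp.
    by rewrite add_lfunE opp_lfunE PhiE phiE // subrr.
  by apply: memv_img; apply/mem_Homs.
- by apply/subvP => f /Z'E[].
- by apply/subvP => _ /memv_imgP[phi /mem_Homs hphi ->]; rewrite lin_ofE Zcomp.
Qed.

Lemma restriction_dim0 :
  (forall f u, f \in Z -> u \in U -> f u = 0) -> Z = Z'.
Proof.
move=> h; apply/vspaceP => f; apply/idP/idP => [fZ|/Z'E[] //].
by apply/Z'E; split=> // u; exact: h.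
Qed.

End Restriction.

(** * Split chief factors and cocycles *)

Section Nontrivial.
Variables (F : fieldType) (p : nat) (L : restrictedLie F p) (S : restModule L).
Hypothesis hS : nontriv_irr S.

Lemma nontriv_acts : exists (x : L) (s : S), op x s != 0.
Proof.
case: hS => -[S0 irS] nt; apply: contra_notP nt => h.
have z x (s : S) : op x s = 0.
  by apply/eqP/contraT => xs; case: h; exists x, s.
pose v := vpick {:S}; have v0 : v != 0 by rewrite vpick0.
have [|vf|vf] := irS <[v]>%VS.
- by move=> x s _; rewrite z mem0v.
- by have := memv_line v; rewrite vf memv0 (negPf v0).
have hL : linear (fun a : F^o => a *: v).
  by move=> a b c; rewrite scalerDl scalerA.
pose h' := lin_of hL.
have hK : cancel h' (h'^-1)%VF.
  apply/lker0_lfunK; rewrite -subv0; apply/subvP => a.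
  by rewrite memv_ker memv0 lin_ofE scaler_eq0 (negPf v0) orbF.
have hs s : exists a, s = h' a.
  have : s \in <[v]>%VS by rewrite vf memvf.
  by case/vlineP => a ->; exists a; rewrite lin_ofE.
exists (h'^-1)%VF; split.
- by move=> x s; rewrite z linear0 [RHS]lfunE.
- apply/eqP; rewrite -subv0; apply/subvP => s; have [a ->] := hs s.
  by rewrite memv_ker memv0 hK => /eqP ->; rewrite linear0.
- apply/vspaceP => a; rewrite memvf -(hK a); exact/memv_img/memvf.
Qed.

Lemma ann_proper : ann_vs S != fullv.
Proof.
have [x [s xs]] := nontriv_acts; apply: contraNneq xs => af.
have /annP : x \in ann_vs S by rewrite af memvf.
by move->.
Qed.

Lemma invariants_ideal0 (I : {vspace L}) (s : S) : stable (M := adj L) I ->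
  ~~ (I <= ann_vs S)%VS -> (forall x, x \in I -> op x s = 0) -> s = 0.
Proof.
move=> sI nI hs; case: hS => -[_ irS] _.
pose Q (s : S) := forall x, x \in I -> op x s = 0.
have Qs : subspace_pred Q.
  split=> [x _|a u v hu hv x xI]; first exact: linear0.
  by rewrite linearP /= hu ?hv // scaler0 addr0.
have sQ : stable (vspace_of Qs).
  move=> x v /mem_vspace_of hv; apply/mem_vspace_of => y yI.
  rewrite lm_swap hv // linear0 add0r hv //.
  by rewrite lbrC memvN; exact: sI.
case: (irS _ sQ) => Q0.
  by apply/eqP; rewrite -memv0 -Q0; apply/mem_vspace_of.
case/negP: nI; apply/subvP => x xI; apply/annP => v.
have /mem_vspace_of hv : v \in vspace_of Qs by rewrite Q0 memvf.
exact: hv.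
Qed.

Lemma invariants0 (s : S) : (forall x : L, op x s = 0) -> s = 0.
Proof.
move=> hs; apply: (@invariants_ideal0 fullv) => //; first exact: stablef.
apply: contra ann_proper => h; by apply/eqP/subv_anti; rewrite subvf.
Qed.

End Nontrivial.

Section ChiefFactor.
Variables (F : fieldType) (p : nat) (L : restrictedLie F p) (S : restModule L).
Variables I U : ideal L.
Hypothesis IU : (I <= U)%VS.
Hypothesis minU : minimal_ideal (quot_img I U).
Hypothesis hS : nontriv_irr S.

Let sI : stable (M := adj L) I := @idlP _ _ I.
Let sU : stable (M := adj L) U := @idlP _ _ U.

Lemma chief_covers : covers (M := adj L) I U.
Proof.
case: minU => sq q0 qmin; split=> //.
  apply: contraNneq q0 => eIU; rewrite /quot_img -eIU -subv0.
  apply/subvP => _ /memv_imgP[v vI ->].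
  by rewrite memv0 qproj_eq0.
move=> V sV IV VU.
have inV v : qproj I v \in (qproj I @: V)%VS -> v \in V.
  case/memv_imgP => w wV /eqP; rewrite -subr_eq0 -linearB qproj_eq0 => h.
  by rewrite -(subrK w v) memvD // (subvP IV).
have [||V0|VU'] := qmin (qproj I @: V)%VS.
- move=> q _ /memv_imgP[v vV ->]; rewrite -(qreprK q).
  by rewrite -[op _ _]/(lbr _ _) quot_lbr memv_img //; exact: sV.
- exact: limgS.
- left; apply/eqP; rewrite eqEsubv IV andbT; apply/subvP => v vV.
  by rewrite -qproj_eq0 -memv0 -V0 memv_img.
- right; apply/eqP; rewrite eqEsubv VU; apply/subvP => v vU.
  by apply: inV; rewrite VU' memv_img.
Qed.

Let irT : irreducible (om_factor (M := adj L) I U).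
Proof. exact: covers_irr chief_covers. Qed.

Definition cocycles_on (V : {vspace L}) (f : 'Hom(L, S)) :=
  lie_cocycle f /\ vanishing_on V f.

Fact cocycles_on_subspace (V : {vspace L}) : subspace_pred (cocycles_on V).
Proof.
have [h0 h] := lie_cocycle_subspace S; split.
  by split=> // x _; rewrite zero_lfunE.
move=> a f g [hf f0] [hg g0]; split; first exact: h.
by move=> x xV; rewrite lfunZDE f0 // g0 // scaler0 addr0.
Qed.

Definition Zon (V : {vspace L}) : {vspace 'Hom(L, S)} :=
  vspace_of (cocycles_on_subspace V).

Definition split_factor := [/\ abelian_factor I U,
  om_iso (om_factor (M := adj L) I U) S & lie_split I U].

Lemma cocycle_annr (f : 'Hom(L, S)) x u : lie_cocycle f -> u \in ann_vs S ->
  f (lbr x u) = op x (f u).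
Proof. by move=> Zf /annP ua; rewrite Zf ua subr0. Qed.

Section FromCocycle.
Variable f : 'Hom(L, S).
Hypotheses (Zf : lie_cocycle f) (fI : vanishing_on I f).
Hypothesis Ua : (U <= ann_vs S)%VS.
Variable u0 : L.
Hypotheses (u0U : u0 \in (U : {vspace L})) (fu0 : f u0 != 0).

Let kerU v : v \in (U : {vspace L}) -> f v = 0 -> v \in (I : {vspace L}).
Proof.
move=> vU fv; have [_ _ hU] := chief_covers.
have [||| <- | kU] := hU (U :&: lker f)%VS.
- move=> x w; rewrite !memv_cap !memv_ker => /andP[wU /eqP fw].
  rewrite sU //= -[op x w]/(lbr x w) cocycle_annr // ?fw ?linear0 //.
  exact: (subvP Ua).
- by rewrite subv_cap IU; apply/subvP => w wI; rewrite memv_ker fI.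
- exact: capvSl.
- by rewrite memv_cap vU memv_ker fv eqxx.
- by move: u0U; rewrite -kU memv_cap memv_ker (negPf fu0) andbF.
Qed.

(** The kernel of a cocycle that is nonzero on U / I is a subalgebra, which
    meets U in I and maps onto L / U: it splits the extension. *)
Lemma split_of_cocycle : abelian_factor I U /\ lie_split I U.
Proof.
split=> [_ _ /memv_imgP[u uU ->] /memv_imgP[v vU ->]|].
  rewrite quot_lbr; apply/eqP; rewrite qproj_eq0 kerU ?idl_br //.
  rewrite Zf; have /annP -> := subvP Ua _ uU; have /annP -> := subvP Ua _ vU.
  exact: subrr.
pose fU : 'Hom(L, S) := (f \o projv U)%VF.
have fUE v : fU v = f (projv U v) by exact: comp_lfunE.
have im : limg fU = fullv.
  case: hS => -[_ irS] _; case: (irS (limg fU)) => // [x s|k0].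
    case/memv_imgP => v _ ->; rewrite fUE.
    rewrite -cocycle_annr //; last by rewrite (subvP Ua) ?memv_proj.
    have : lbr x (projv U v) \in (U : {vspace L}) by rewrite idl_br ?memv_proj.
    by move/projv_id <-; rewrite -fUE memv_img ?memvf.
  have := memv_img fU (memvf u0); rewrite k0 memv0 fUE projv_id //.
  by rewrite (negPf fu0).
pose r : 'End(L) := (projv U \o fU^-1 \o f)%VF.
have rE x : r x = projv U ((fU^-1)%VF (f x)) by rewrite /r !comp_lfunE.
have rU x : r x \in (U : {vspace L}) by rewrite rE memv_proj.
have fr x : f (r x) = f x by rewrite rE -fUE limg_lfunVK // im memvf.
have fa x : f (x - r x) = 0 by rewrite linearB /= fr subrr.
have fb x y : f (lbr (x - r x) (y - r y)) = 0.
  by rewrite Zf !fa; apply/eqP; rewrite subr_eq0 !linear0.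
pose s : 'Hom(quot_lie U, quot_lie I) := (qproj I \o (\1 - r) \o qrepr U)%VF.
have sE q : s q = qproj I (qrepr U q - r (qrepr U q)).
  by rewrite /s 2!comp_lfunE add_lfunE opp_lfunE id_lfunE.
exists s => [q1 q2|q].
  rewrite !sE quot_lbr; apply: qproj_eq; apply: kerU; last first.
    by apply/eqP; rewrite linearB subr_eq0 [X in X == _]fa eq_sym [X in X == _]fb.
  set x := qrepr U q1; set y := qrepr U q2.
  set z := fun_of_lfun (qrepr U) (lbr q1 q2).
  have zE : z - lbr x y \in (U : {vspace L}).
    rewrite /z -{1}(qreprK q1) -{1}(qreprK q2) quot_lbr; exact: qrepr_projB.
  have -> : lbr (x - r x) (y - r y) =
      lbr x y - lbr (r x) y - lbr (x - r x) (r y).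
    by rewrite lbrDr lbrNr lbrBl.
  rewrite !opprD !opprK (AC (2*3) ((1*3)*(2*(4*5)))) /=.
  rewrite memvD // memvD ?memvN //.
  by apply: memvD; [exact: idl_brl | exact: idl_br].
rewrite sE comp_lfunE -[RHS]qreprK; apply: qproj_eq; set x := qrepr U q.
set a := x - r x; have -> : qrepr I (qproj I a) - x = qrepr I (qproj I a) - a - r x.
  by rewrite /a opprB -!addrA; congr (_ + _); rewrite addrCA subrr addr0.
rewrite memvB //; apply: (subvP IU); exact: qrepr_projB.
Qed.

End FromCocycle.

Lemma split_factor_ann : split_factor -> (U <= ann_vs S)%VS.
Proof.
case=> ab [phi [hphi _ phiS]] _; apply/subvP => u uU; apply/annP => s.
have : s \in limg phi by rewrite phiS memvf.
case/memv_imgP => t _ ->; have [v vU <-] := toq_surj t.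
rewrite -hphi -(toq_op (M := adj L)) //.
suff /eqP -> : toq (M := adj L) I U (op u v) == 0 by rewrite linear0.
rewrite (toq_eq0 (M := adj L)); last exact/(sU u vU).
rewrite -qproj_eq0 -[op u v]/(lbr u v) -quot_lbr; apply/eqP/ab; exact: memv_img.
Qed.

(** The projection of L / I onto U / I along the image of the section is a
    derivation because U / I is abelian. *)
Lemma cocycle_of_split : split_factor -> exists f u,
  [/\ lie_cocycle f, vanishing_on I f, u \in (U : {vspace L}) & f u != 0 :> S].
Proof.
case=> ab [phi [hphi kphi _]] [s hs sK].
pose t : 'Hom(L, quot_lie I) := (qproj I - (s \o qproj U))%VF.
have tE x : t x = qproj I x - s (qproj U x).
  by rewrite add_lfunE opp_lfunE comp_lfunE.
have qmapE v : qmap I U (qproj I v) = qproj U v.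
  rewrite comp_lfunE; apply: qproj_eq.
  by apply: (subvP IU); exact: qrepr_projB.
have tq x : t x \in quot_img I U.
  rewrite -(qreprK (t x)) memv_img // -qproj_eq0.
  by rewrite -qmapE qreprK tE linearB /= sK qmapE subrr.
have tbr x y : t (lbr x y) =
    lbr (L := quot_lie I) (qproj I x) (t y) - lbr (L := quot_lie I) (qproj I y) (t x).
  rewrite tE -!quot_lbr hs.
  have qE z : qproj I z = t z + s (qproj U z) by rewrite tE subrK.
  rewrite !qE !lbrDl !lbrDr (ab _ _ (tq x) (tq y)) (ab _ _ (tq y) (tq x)).
  rewrite add0r !add0r [lbr (s (qproj U y)) (t x)]lbrC opprK.
  by rewrite addrA addrK addrC.
pose T := om_factor (M := adj L) I U.
pose w : 'Hom(quot_lie I, T) := linfun (vsproj (quot_img I U)).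
have wE v : w (qproj I v) = toq (M := adj L) I U v.
  by rewrite [RHS]comp_lfunE.
have wop x q : q \in quot_img I U ->
    w (lbr (L := quot_lie I) (qproj I x) q) = op (M := T) x (w q).
  case/memv_imgP => u uU ->; rewrite quot_lbr !wE.
  by rewrite -(toq_op (M := adj L)).
pose f : 'Hom(L, S) := (phi \o w \o t)%VF.
have fE x : f x = phi (w (t x)) by rewrite /f !comp_lfunE.
have [_ nIU _] := chief_covers.
have [u uU uI] : exists2 u, u \in (U : {vspace L}) & u \notin (I : {vspace L}).
  apply: contraNP nIU => h; rewrite eqEsubv IU; apply/subvP => u uU.
  by apply/contraT => uI; case: h; exists u.
have tU v : v \in (U : {vspace L}) -> t v = qproj I v.
  move=> vU; rewrite tE; have /eqP -> : qproj U v == 0 by rewrite qproj_eq0.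
  by rewrite linear0 subr0.
exists f, u; split=> //.
- by move=> x y; rewrite !fE tbr linearB /= !wop // linearB /= !hphi.
- move=> x xI; rewrite fE tU ?(subvP IU) //.
  by have /eqP -> : qproj I x == 0; rewrite ?qproj_eq0 // !linear0.
- rewrite fE tU // wE; apply/eqP => h.
  have : toq (M := adj L) I U u \in lker phi by rewrite memv_ker h.
  by rewrite kphi memv0 (toq_eq0 (M := adj L)) // (negPf uI).
Qed.

(** As U kills S, restriction to U embeds Zon I / Zon U into Hom_L(U / I, S). Its
    image is nonzero exactly when U / I is a split factor isomorphic to S. *)
Lemma Zon_step : (U <= ann_vs S)%VS ->
  \dim (Zon I) = (\dim (Zon U) + `[< split_factor >] * \dim (Homs S S))%N.
Proof.
move=> Ua.
have Zop f x u : f \in Zon I -> u \in (U : {vspace L}) ->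
    f (op (M := adj L) x u) = op x (f u).
  by move=> /mem_vspace_of[Zf _] uU; apply: cocycle_annr => //; exact: (subvP Ua).
have ZW f w : f \in Zon I -> w \in (I : {vspace L}) -> f w = 0.
  by move=> /mem_vspace_of[_ f0]; exact: f0.
have Zcomp phi f : om_hom phi -> f \in Zon I -> (phi \o f)%VF \in Zon I.
  move=> hphi /mem_vspace_of[Zf f0]; apply/mem_vspace_of; split=> [x y|x xI].
    by rewrite !comp_lfunE Zf linearB /= !hphi.
  by rewrite comp_lfunE f0 ?linear0.
have Z'E f : f \in Zon U <-> f \in Zon I /\ forall u, u \in (U : {vspace L}) -> f u = 0.
  split=> [/mem_vspace_of[Zf fU]|[/mem_vspace_of[Zf _] fU]].
    split=> //; apply/mem_vspace_of; split=> // x xI.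
    by apply: fU; exact: (subvP IU).
  by apply/mem_vspace_of; split.
have irS : irreducible S by case: hS.
have [[f [u [fZ uU fu]]]|no] := pselect (exists f u,
    [/\ f \in Zon I, u \in (U : {vspace L}) & f u != 0]).
  have [iso ->] := @restriction_dim F L (adj L) S _ _ sI sU irT irS _ _
    Zop ZW Zcomp Z'E f u fZ uU fu.
  have /mem_vspace_of[Zf f0] := fZ.
  have [ab sp] := split_of_cocycle Zf f0 Ua uU fu.
  by rewrite (_ : `[< split_factor >]) ?mul1n //; apply/asboolP; split.
rewrite (_ : `[< split_factor >] = false).
  rewrite addn0; congr (\dim _); apply: (restriction_dim0 (M := adj L) Z'E).
  move=> f u fZ uU; apply/eqP/contraT => fu; case: no.
  by exists f, u.
apply/asboolP => /cocycle_of_split[f [u [Zf f0 uU fu]]]; case: no.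
by exists f, u; split=> //; apply/mem_vspace_of.
Qed.

(** If U acts nontrivially but I does not, a cocycle vanishing on I vanishes on
    the whole annihilator A, since [U, A] <= U :&: A = I. *)
Lemma Zon_ann : (I <= ann_vs S)%VS -> ~~ (U <= ann_vs S)%VS ->
  Zon I = Zon (ann_vs S).
Proof.
move=> Ia nUa; apply/vspaceP => f; apply/idP/idP; last first.
  move=> /mem_vspace_of[Zf f0]; apply/mem_vspace_of; split=> // x xI.
  by apply: f0; exact: (subvP Ia).
move=> /mem_vspace_of[Zf f0]; apply/mem_vspace_of; split=> // a aA.
apply: (invariants_ideal0 hS sU nUa) => u uU.
rewrite -cocycle_annr //; apply: f0.
have [_ _ hU] := chief_covers.
have [||| <- | UA] := hU (U :&: ann_vs S)%VS.
- move=> x v; rewrite !memv_cap => /andP[vU vA]; rewrite sU //.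
  exact: (@ann_stable _ _ _ S).
- by rewrite subv_cap IU.
- exact: capvSl.
- rewrite memv_cap idl_brl //; exact: (@ann_stable _ _ _ S).
- by case/negP: nUa; rewrite -UA capvSr.
Qed.

End ChiefFactor.

Section CohomologyFormula.
Variables (F : fieldType) (p : nat) (L : restrictedLie F p) (S : restModule L).

Definition coboundaries : {vspace 'Hom(L, S)} :=
  vspace_of (lie_coboundary_subspace S).

Lemma coboundaries_on_ann : (coboundaries <= Zon S (ann_vs S))%VS.
Proof.
apply/subvP => f /mem_vspace_of[m fm]; apply/mem_vspace_of; split.
  by apply: lie_coboundary_cocycle; exists m.
by move=> x /annP xm; rewrite fm xm.
Qed.

(** Inflation identifies the cocycles of L / Ann S with the cocycles of L that
    vanish on Ann S. *)
Lemma dim_H1_ann :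
  dim_H1 (ann_rm S) = (\dim (Zon S (ann_vs S)) - \dim coboundaries)%N.
Proof.
pose infl (f : 'Hom(LAnn S, ann_rm S)) : 'Hom(L, S) := (f \o qproj (Ann S))%VF.
have inflL : linear infl by move=> a f g; rewrite /infl comp_lfunDl comp_lfunZl.
have inflE f x : lin_of inflL f x = f (qproj (Ann S) x).
  by rewrite lin_ofE; exact: comp_lfunE.
have inj V : \dim (lin_of inflL @: V) = \dim V.
  apply: limg_dim_eq; apply/eqP; rewrite -subv0; apply/subvP => f.
  rewrite memv_cap memv_ker memv0 => /andP[_ /eqP f0]; apply/eqP/lfunP => q.
  by rewrite -(qreprK q) -inflE f0 !zero_lfunE.
have deflL (f : 'Hom(L, S)) : vanishing_on (ann_vs S) f ->
    lin_of inflL (f \o qrepr (Ann S))%VF = f.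
  move=> f0; apply/lfunP => x; rewrite inflE; rewrite comp_lfunE.
  apply/eqP; rewrite -subr_eq0 -linearB; apply/eqP/f0.
  exact: (qrepr_projB (Ann S)).
rewrite /dim_H1; congr subn; rewrite -inj; congr (\dim _); apply/vspaceP => f.
  apply/idP/idP => [/memv_imgP[g /mem_vspace_of Zg ->]|/mem_vspace_of[Zf f0]].
    apply/mem_vspace_of; split=> [x y|x xA].
      by rewrite !inflE -quot_lbr Zg !ann_omE.
    by rewrite inflE; have /eqP -> : qproj (Ann S) x == 0;
      rewrite ?qproj_eq0 // linear0.
  rewrite -(deflL f f0) memv_img //; apply/mem_vspace_of => q r.
  have fE t : f t = (f \o qrepr (Ann S))%VF (qproj (Ann S) t).
    by rewrite -inflE deflL.
  rewrite -{1}(qreprK q) -{1}(qreprK r) quot_lbr -fE Zf !fE !qreprK.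
  by rewrite -{1}(qreprK q) -{2}(qreprK r) !ann_omE.
apply/idP/idP => [/memv_imgP[g /mem_vspace_of[m gm] ->]|/mem_vspace_of[m fm]].
  apply/mem_vspace_of; exists m => x.
  by rewrite inflE gm ann_omE.
rewrite -(deflL f) => [|x /annP xm]; last by rewrite fm xm.
rewrite memv_img //; apply/mem_vspace_of; exists m => q.
by rewrite comp_lfunE fm -{2}(qreprK q) ann_omE.
Qed.

(** Along the chief series the space of cocycles loses one copy of End_L(S) for
    each split factor isomorphic to S, until the series leaves Ann S; from there
    on only the cocycles of L / Ann S are left. *)
Lemma dim_H1_formula (n : nat) (c : nat -> ideal L) :
  chief_series n c -> nontriv_irr S ->
  dim_H1 S = (\dim (Homs S S) * split_mult n c S + dim_H1 (ann_rm S))%N.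
Proof.
move=> [c0 cn hc] hS; have cS j : (j < n)%N -> (c j <= c j.+1)%VS.
  by move=> jn; case: (hc _ jn).
have cM i j : (i <= j)%N -> (j <= n)%N -> (c i <= c j)%VS.
  elim: j => [|j IH]; first by rewrite leqn0 => /eqP ->.
  rewrite leq_eqVlt => /orP[/eqP -> //|ij] jn.
  exact: subv_trans (IH ij (ltnW jn)) (cS _ jn).
pose cnt j : nat := `[< split_factor S (c j) (c j.+1) >].
have -> : split_mult n c S = (\sum_(0 <= j < n) cnt j)%N.
  by rewrite /split_mult cardsE -sum1_card big_mkord big_mkcond; apply: eq_bigr.
have [|k nk kmin] := @min_nat_ex (fun k => (k <= n)%N /\ ~~ (c k <= ann_vs S)%VS).
  exists n; split=> //; rewrite cn; apply: contra (ann_proper hS) => h.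
  by apply/eqP/subv_anti; rewrite subvf.
case: k nk kmin => [|k] [kn nk] kmin; first by rewrite c0 sub0v in nk.
have ca j : (j <= k)%N -> (c j <= ann_vs S)%VS.
  move=> jk; apply/contraT => nj; have := kmin j.
  rewrite (leq_trans jk (ltnW kn)) nj => /(_ (conj isT isT)).
  by rewrite leqNgt ltnS jk.
have filt j : (j <= k)%N -> \dim (Zon S (c 0)) =
    (\dim (Zon S (c j)) + \dim (Homs S S) * \sum_(0 <= i < j) cnt i)%N.
  elim: j => [|j IH] jk; first by rewrite big_nil muln0 addn0.
  have jn : (j < n)%N by apply: leq_trans jk (ltnW kn).
  have [cj mj] := hc _ jn; rewrite (IH (ltnW jk)) big_nat_recr //=.
  rewrite (Zon_step cj mj hS) ?ca // mulnDr -/(cnt j) [(cnt j * _)%N]mulnC.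
  by rewrite -!addnA; congr addn; rewrite addnC.
have tail : (\sum_(0 <= j < n) cnt j = \sum_(0 <= j < k) cnt j)%N.
  rewrite (big_cat_nat (n := k)) //=; last exact: ltnW.
  rewrite [X in (_ + X)%N]big1_seq ?addn0 // => j /andP[_].
  rewrite mem_index_iota => /andP[kj jn]; rewrite /cnt.
  case: asboolP => // /split_factor_ann sa; case/negP: nk.
  exact: subv_trans (cM k.+1 j.+1 kj jn) sa.
have [ck mk] := hc _ kn.
have ZA : Zon S (c k) = Zon S (ann_vs S) by apply: (Zon_ann ck mk hS) nk; exact: ca.
have Z0 : vspace_of (lie_cocycle_subspace S) = Zon S (c 0).
  apply/vspaceP => f; apply/idP/idP => [/mem_vspace_of Zf|/mem_vspace_of[Zf _]].
    apply/mem_vspace_of; split=> // x; rewrite c0 memv0 => /eqP ->.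
    exact: linear0.
  exact/mem_vspace_of.
rewrite dim_H1_ann /dim_H1 -/coboundaries Z0 (filt k) // ZA tail addnC.
by rewrite addnBA // dimvS // coboundaries_on_ann.
Qed.

End CohomologyFormula.

(** * Solvable Lie algebras *)

Section Solvable.
Variables (F : fieldType) (p : nat) (L : restrictedLie F p) (S : restModule L).
Hypothesis hS : nontriv_irr S.

Lemma derived_stable (U : {vspace L}) :
  stable (M := adj L) U -> stable (M := adj L) (derived_term U).
Proof.
move=> sU z v vD.
suff /subvP/(_ v vD) : (derived_term U <= lie_ad L z @^-1: derived_term U)%VS.
  by rewrite -memv_preim.
apply/span_subvP => _ /allpairsP[[x y] [/= /vbasis_mem xU /vbasis_mem yU ->]].
rewrite -memv_preim -[lie_ad L z _]/(lbr z (lbr x y)).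
have := lbrJ z x y => /eqP; rewrite eq_sym subr_eq => /eqP ->.
by apply: memvD; apply: mem_derived_term => //; exact: sU.
Qed.

Section AbelianModAnn.
Variable K : {vspace L}.
Hypotheses (sK : stable (M := adj L) K) (nK : ~~ (K <= ann_vs S)%VS).
Hypothesis abK : forall x y, x \in K -> y \in K -> lbr x y \in ann_vs S.

(** The commutator of x^[p] with y is (ad x)^p y, and already [x, [x, y]] kills
    S. *)
Lemma pmap_op_comm x : x \in K ->
  om_hom (op (M := S) (Defs.pmap x) : 'Hom(S, S)).
Proof.
move=> xK y v; apply/eqP; rewrite -subr_eq0 -lm_lbr pmap_ad.
suff /annP -> : iter p (lbr x) y \in ann_vs S by [].
have := prime_gt1 (rl_prime L); move: {1 4}p => [|[|k]] // _.
rewrite !iterSr; elim: k => [|k IH] /=; last exact: (ann_stable (S := S)).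
by apply: abK => //; rewrite lbrC memvN; exact: sK.
Qed.

(** For x in K the operator x^p commutes with L, so it is zero or invertible;
    but commuting nilpotent operators would have a common kernel. *)
Lemma invertible_ex : exists2 x, x \in K & lker (op (M := S) x) = 0%VS.
Proof.
apply: contrapT => none.
have nil x : x \in K -> forall v : S, iter p (op x) v = 0.
  move=> xK v; apply/eqP/contraT; rewrite -rm_pmap => xv; case: none.
  have irS : irreducible S by case: hS.
  have k0 := Schur_lker irS (pmap_op_comm xK) xv.
  exists x => //; apply/eqP; rewrite -subv0 -k0; apply/subvP => w.
  rewrite !memv_ker rm_pmap => /eqP xw.
  have it k : iter k.+1 (op x) w = 0 by elim: k => //= k ->; rewrite linear0.
  by have := it p.-1; rewrite prednK ?prime_gt0 ?(rl_prime L) // => ->.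
suff [s s0 hs] : exists2 s : S, s != 0 & forall x, x \in vbasis K -> op x s = 0.
  case/eqP: s0; apply: (invariants_ideal0 hS sK nK) => x xK.
  rewrite (coord_vbasis xK) lm_op_sum big1 // => i _.
  by rewrite lm_opZ hs ?scaler0 // mem_nth ?size_tuple.
suff gen (xs : seq L) : {subset xs <= K} ->
    exists2 s : S, s != 0 & forall x, x \in xs -> op x s = 0.
  by apply: gen => x; exact: vbasis_mem.
elim: xs => [_|x xs IH xK].
  have [x [s xs]] := nontriv_acts hS; exists s => //.
  by apply: contraNneq xs => ->; rewrite linear0.
have [|s s0 hs] := IH; first by move=> y yxs; apply: xK; rewrite inE yxs orbT.
have xxK : x \in K by apply: xK; rewrite mem_head.
have [|j xj jmin] := @min_nat_ex (fun j => iter j (op x) s = 0).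
  by exists p; exact: nil.
case: j xj jmin => [|j] xj jmin; first by rewrite [s]xj eqxx in s0.
exists (iter j (op x) s); first by apply/eqP => h; have := jmin j h; rewrite ltnn.
move=> y; rewrite inE => /orP[/eqP -> //|yxs].
have yK : y \in K by apply: xK; rewrite inE yxs orbT.
elim: j {xj jmin} => [|j IHj] /=; first exact: hs.
rewrite lm_swap IHj linear0 add0r.
by have /annP -> := abK yK xxK.
Qed.

End AbelianModAnn.

(** If [x, [x, y]] kills S for all y and x is invertible on S, a cocycle f
    normalised by f(x) = 0 satisfies x^2 f(y) = f([x, [x, y]]) = 0. *)
Lemma solvable_H1_ann : lie_solvable L -> dim_H1 (ann_rm S) = 0%N.
Proof.
case=> k0 Lk0.
have [|k kann kmin] := @min_nat_ex
    (fun k => iter k derived_term fullv <= ann_vs S)%VS.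
  by exists k0; rewrite Lk0 sub0v.
case: k kann kmin => [|k] kann kmin.
  by case/negP: (ann_proper hS); apply/eqP/subv_anti; rewrite subvf.
pose K := iter k (@derived_term F L) fullv.
have sK : stable (M := adj L) K.
  by rewrite /K; elim: (k) => [|j IH]; [exact: stablef | exact: derived_stable].
have nK : ~~ (K <= ann_vs S)%VS.
  by apply/negP => /kmin; rewrite ltnn.
have abK x y : x \in K -> y \in K -> lbr x y \in ann_vs S.
  by move=> xK yK; apply: (subvP kann); exact: mem_derived_term.
have [x xK kx] := invertible_ex sK nK abK.
have inj v : op (M := S) x v = 0 -> v = 0.
  by move=> xv; apply/eqP; rewrite -memv0 -kx memv_ker xv.
rewrite dim_H1_ann; apply/eqP; rewrite subn_eq0 dimvS //.
apply/subvP => f /mem_vspace_of[Zf f0]; apply/mem_vspace_of.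
have [m xm] : exists m : S, op x m = f x.
  exists (((op (M := S) x)^-1)%VF (f x)); apply: limg_lfunVK.
  rewrite (_ : limg _ = fullv) ?memvf //; apply/eqP.
  by rewrite eqEdim subvf limg_dim_eq ?kx ?capv0 /=.
apply: (coboundaryBl (m := m)); exists 0 => y; rewrite linear0.
set g := f - cobd m; have Zg : lie_cocycle g.
  by apply: cocycleB => //; exact: cocycle_cobd.
have gx : g x = 0 by rewrite add_lfunE opp_lfunE cobdE xm subrr.
have g0 a : a \in ann_vs S -> g a = 0.
  move=> aA; rewrite add_lfunE opp_lfunE cobdE f0 //.
  by move/annP: aA => ->; rewrite subrr.
have gbr z : g (lbr x z) = op x (g z) by rewrite Zg gx linear0 subr0.
apply/inj/inj; rewrite -!gbr; apply/g0/abK => //.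
by rewrite lbrC memvN; exact: sK.
Qed.

End Solvable.

Lemma solvable_of_abelian_factors (F : fieldType) (L : lieAlgebra F) n
    (c : nat -> ideal L) : chief_series n c ->
  (forall j, (j < n)%N -> forall x y, x \in (c j.+1 : {vspace L}) ->
     y \in (c j.+1 : {vspace L}) -> lbr x y \in (c j : {vspace L})) ->
  lie_solvable L.
Proof.
move=> [c0 cn hc] ab; exists n; apply/eqP; rewrite -subv0.
suff key k : (k <= n)%N -> (iter k derived_term fullv <= c (n - k)%N)%VS.
  by have := key n (leqnn n); rewrite subnn c0.
elim: k => [|k IH] kn; first by rewrite subn0 cn subvf.
rewrite iterS; apply/span_subvP.
move=> _ /allpairsP[[x y] [/= /vbasis_mem xU /vbasis_mem yU ->]].
have kE : (n - k = (n - k.+1).+1)%N by rewrite subnSK.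
have /subvP sub := IH (ltnW kn).
apply: ab; first by rewrite -kE leq_subr.
  by rewrite -kE sub.
by rewrite -kE sub.
Qed.

(** * The restricted universal enveloping algebra *)

Section Generation.
Variables (F : fieldType) (p : nat) (L : restrictedLie F p).
Local Notation R := (renv L).
Local Notation i := (renv_in L).

(** The subalgebra generated by L receives a map from u(L) by universality, and
    composing it with the inclusion gives the identity. *)
Lemma renv_ind (Q : R -> Prop) : subspace_pred Q -> Q 1 ->
  (forall a b, Q a -> Q b -> Q (a * b)) -> (forall x, Q (i x)) ->
  forall a, Q a.
Proof.
move=> Qs Q1 QM Qi.
have BP : is_aspace (vspace_of Qs).
  apply/andP; split; first by apply: has_algid1; apply/mem_vspace_of.
  apply/prodvP => a b /mem_vspace_of Qa /mem_vspace_of Qb.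
  by apply/mem_vspace_of; apply: QM.
pose B : {aspace R} := ASpace BP; pose BT : algType F := subvs_of B.
have iB x : i x \in B by apply/mem_vspace_of.
have B1 : algid B = 1 by apply/eqP; rewrite algid_eq1; apply/mem_vspace_of.
pose f x : BT := Subvs (iB x).
have fL : linear f by move=> a x y; apply: val_inj; rewrite /= linearP.
pose fl : {linear L -> BT} := HB.pack f (GRing.isLinear.Build F L BT _ f fL).
have [[hbr hp] univ] := renvP L.
have valX (u : BT) k : vsval (u ^+ k) = vsval u ^+ k.
  by elim: k => [|k IH]; rewrite ?expr0 // !exprS -IH.
have hf : restricted_map fl.
  split=> [x y|x]; apply: val_inj; first exact: hbr.
  by rewrite [RHS]valX; exact: hp.
have [g gi _] := univ BT fl hf.
pose h (a : R) : R := vsval (g a).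
have hL : linear h by move=> c a b; rewrite /h !linearP.
have hM : monoid_morphism h.
  by split=> [|a b]; rewrite /h ?rmorph1 ?rmorphM.
pose hl : {lrmorphism R -> R} := HB.pack h
  (GRing.isLinear.Build F R R _ h hL) (GRing.isMonoidMorphism.Build R R h hM).
have [e ei ue] := univ R i (conj hbr hp).
have idE : idfun =1 e by apply: (ue idfun).
have hE : h =1 e by apply: (ue hl) => x; rewrite /= /h gi.
move=> a; apply/(mem_vspace_of Qs); rewrite -[a]/(idfun a) idE -hE.
exact: subvsP.
Qed.

Section Modules.
Variables (M N : opmod F R) (hM : is_amodule M) (hN : is_amodule N).

Lemma am_opD a b (m : M) : op (a + b) m = op a m + op b m.
Proof.
case: hM => hl _ _; have := hl 1 a b; rewrite !scale1r => ->.
by rewrite add_lfunE.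
Qed.

Lemma am_opZ c a (m : M) : op (c *: a) m = c *: op a m.
Proof.
case: hM => hl _ _; have h0 : op (0 : R) = 0 :> 'End(M).
  by have := hl (-1) 0 0; rewrite scaler0 addr0 scaleN1r addNr.
by have := hl c a 0; rewrite h0 !addr0 => ->; rewrite lfunZE.
Qed.

Lemma am_opB a b (m : M) : op (a - b) m = op a m - op b m.
Proof. by rewrite am_opD -scaleN1r am_opZ scaleN1r. Qed.

Lemma am_opM a b (m : M) : op (a * b) m = op a (op b m).
Proof. by case: hM => _ _ ->; rewrite comp_lfunE. Qed.

Lemma am_op1 (m : M) : op (1 : R) m = m.
Proof. by case: hM => _ -> _; rewrite id_lfunE. Qed.

Lemma am_lbr (x y : L) (m : M) :
  op (i (lbr x y)) m = op (i x) (op (i y) m) - op (i y) (op (i x) m).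
Proof. by have [[-> _] _] := renvP L; rewrite am_opB !am_opM. Qed.

End Modules.

Lemma om_hom_renv (M N : opmod F R) (k : 'Hom(M, N)) :
  is_amodule M -> is_amodule N ->
  (forall (x : L) m, k (op (i x) m) = op (i x) (k m)) -> om_hom k.
Proof.
move=> hM hN hk a; elim/renv_ind: a => [|m|a b ha hb m|x m].
- split=> [m|c a b ha hb m].
    by rewrite -[0](scale0r 1) !am_opZ // !scale0r linear0.
  by rewrite !am_opD // !am_opZ // linearP /= ha hb.
- by rewrite !am_op1.
- by rewrite !am_opM // ha hb.
- exact: hk.
Qed.

End Generation.

Lemma iter_pred T (g : T -> T) k w : (0 < k)%N ->
  iter k g w = iter k.-1 g (g w).
Proof. by case: k => // k; rewrite iterSr. Qed.

Section Extension.
Variables (F : fieldType) (p : nat) (L : restrictedLie F p) (S : restModule L).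
Variable f : 'Hom(L, S).
Hypothesis Zf : lie_cocycle f.

Fact ext_op_linear (x : L) :
  linear (fun e : S * F^o => (op x e.1 + e.2 *: f x, 0 : F^o)).
Proof.
move=> a [s c] [t d]; apply: injective_projections => /=; last first.
  by rewrite scaler0 addr0.
by rewrite linearP /= scalerDl scalerDr -!scalerA addrACA.
Qed.

Definition ext_om : opmod F L :=
  @OpMod F L (S * F^o)%type (fun x => lin_of (ext_op_linear x)).

Lemma ext_omE x (e : ext_om) : op x e = (op x e.1 + e.2 *: f x, 0).
Proof. exact: lin_ofE. Qed.

Fact ext_linear : linear (@op F L ext_om).
Proof.
move=> a x y; apply/lfunP => e; rewrite lfunZDE !ext_omE lm_opZD linearP /=.
apply: injective_projections => /=; last by rewrite scaler0 addr0.
by rewrite !scalerDr !scalerA [e.2 * a]mulrC addrACA.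
Qed.

Fact ext_lbr (x y : L) (e : ext_om) :
  op (lbr x y) e = op x (op y e) - op y (op x e).
Proof.
rewrite !ext_omE /= !scale0r !addr0; apply: injective_projections => /=.
  have opE z a (v w : S) : op z (v + a *: w) = op z v + a *: op z w.
    by rewrite linearD linearZ.
  by rewrite lm_lbr Zf scalerBr !opE opprD addrACA.
by rewrite subr0.
Qed.

Definition ext_lm : lieModule L := LieModule ext_linear ext_lbr.

Lemma ext_iter (x : L) k (s : S) :
  iter k (op x) ((s, 0) : ext_lm) = (iter k (op x) s, 0).
Proof.
by elim: k => [|k IH] //; rewrite !iterS IH ext_omE /= scale0r addr0.
Qed.

Hypothesis hS : nontriv_irr S.

(** On the extension E defined by f, the defect x^p - x^[p] commutes with L and
    kills S; it therefore maps E / S into the invariants of S, which vanish. *)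
Lemma cocycle_pmap (x : L) : f (Defs.pmap x) = iter p.-1 (op x) (f x).
Proof.
apply/eqP; rewrite eq_sym -subr_eq0; apply/eqP/(invariants0 hS) => y.
pose u : ext_lm := (0, 1); have pP := prime_gt0 (rl_prime L).
pose D (e : ext_lm) : ext_lm := iter p (op x) e - op (Defs.pmap x) e.
have DS s : D (s, 0) = 0.
  rewrite /D ext_iter ext_omE /= scale0r addr0 rm_pmap.
  by apply: injective_projections => /=; rewrite subrr.
have itadj k : op (M := ext_lm) (iter k (lbr x) y) =
    iter k (fun g => (op x \o g)%VF - (g \o op x)%VF) (op (M := ext_lm) y).
  elim: k => [|k IH] //; rewrite !iterS -IH; apply/lfunP => e.
  by rewrite (lm_lbr (l := ext_lm)) add_lfunE opp_lfunE !comp_lfunE.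
have Dcomm e : D (op y e) = op y (D e).
  rewrite /D linearB /=.
  have h1 := iter_commutator (rl_char L) (op (M := ext_lm) x)
    (op (M := ext_lm) x) (op y) e.
  rewrite -itadj -pmap_ad (lm_lbr (l := ext_lm)) in h1.
  apply/eqP; rewrite -subr_eq0 opprB (AC (2*2) ((1*4)*(3*2))) /= -h1.
  by rewrite -[X in _ + X]opprB subrr.
have DE : D u = (iter p.-1 (op x) (f x) - f (Defs.pmap x), 0).
  rewrite /D iter_pred // !ext_omE /= !linear0 !add0r !scale1r.
  rewrite ext_iter; apply: injective_projections => //=.
  by rewrite subr0.
have := Dcomm u; rewrite DE [op y u]ext_omE DS ext_omE => /(congr1 fst) /=.
by rewrite scale0r addr0.
Qed.

Fact ext_pmap (x : L) (e : ext_lm) : op (Defs.pmap x) e = iter p (op x) e.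
Proof.
case: e => s c; rewrite ext_omE /= cocycle_pmap rm_pmap.
have pP := prime_gt0 (rl_prime L).
have itL k (u v : S) :
    iter k (op x) (u + c *: v) = iter k (op x) u + c *: iter k (op x) v.
  by elim: k => [|k IH] //; rewrite !iterS IH linearD linearZ.
by rewrite [RHS]iter_pred // ext_omE ext_iter /= itL -iter_pred.
Qed.

Definition rm_ext : restModule L := RestModule ext_pmap.

End Extension.

(** * First cohomology from projective presentations of the trivial module *)

Section Presentation.
Variables (F : fieldType) (p : nat) (L : restrictedLie F p) (S : restModule L).
Hypothesis hS : nontriv_irr S.
Variables (P : amodule (renv L)) (g : 'Hom(P, umod (triv_rm L))).
Hypotheses (projP : projective P) (hg : om_hom g) (sg : limg g = fullv).
Local Notation i := (renv_in L).
Local Notation X := (lker g).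

Let sX : stable X := stable_lker hg.
Let hP := am_P P.

Lemma umod_op (M : restModule L) (x : L) (m : M) :
  op (M := umod M) (i x) m = op x m.
Proof. by rewrite [op _]umod_act_in. Qed.

Lemma triv_aug (x : L) m : g (op (i x) m) = 0.
Proof. by rewrite hg umod_op [op x _]zero_lfunE. Qed.

Lemma generator_ex : exists v : P, g v = 1 :> F^o.
Proof.
have : (1 : F^o) \in limg g by rewrite sg memvf.
by case/memv_imgP => v _ ->; exists v.
Qed.

Let v : P := projT1 (cid generator_ex).
Let gv : g v = 1 :> F^o. Proof. by rewrite /v; case: cid. Qed.

Definition ker_am : amodule (renv L) := AModule (is_amodule_sub hP sX).

Let toX : 'Hom(P, ker_am) := linfun (vsproj X).
Let inX : 'Hom(ker_am, P) := linfun vsval.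

Let inXE w : inX w = vsval w. Proof. exact: lfunE. Qed.
Let toXK m : m \in X -> inX (toX m) = m.
Proof. by move=> mX; rewrite inXE lfunE /= vsprojK. Qed.
Let inX_inj w w' : inX w = inX w' -> w = w'.
Proof. by rewrite !inXE => h; apply: val_inj. Qed.
Let inX_op a w : inX (op a w) = op a (inX w).
Proof. by rewrite !inXE om_subE. Qed.
Let toX_op a m : m \in X -> toX (op a m) = op a (toX m).
Proof. by move=> mX; apply: inX_inj; rewrite inX_op !toXK // sX. Qed.
Let inXK w : toX (inX w) = w.
Proof. by apply: inX_inj; rewrite toXK // inXE; exact: subvsP. Qed.
Let g_inX w : g (inX w) = 0.
Proof. by apply/eqP; rewrite -memv_ker inXE; exact: subvsP. Qed.

Let xv x : op (i x) v \in X. Proof. by rewrite memv_ker triv_aug. Qed.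

Fact ker_elt_linear : linear (fun x : L => toX (op (i x) v)).
Proof.
by move=> a x y; rewrite linearP am_opD // am_opZ // linearP.
Qed.

Definition ker_cocycle (h : 'Hom(ker_am, S)) : 'Hom(L, S) :=
  (h \o lin_of ker_elt_linear)%VF.

Let Psi_linear : linear ker_cocycle.
Proof. by move=> a h k; rewrite /ker_cocycle comp_lfunDl comp_lfunZl. Qed.
Let Psi := lin_of Psi_linear.

Let PsiE h x : Psi h x = h (toX (op (i x) v)).
Proof. by rewrite lin_ofE comp_lfunE lin_ofE. Qed.

Let HX : {vspace 'Hom(ker_am, S)} := Homs ker_am (umod S).

Definition extends (h : 'Hom(ker_am, S)) :=
  exists2 k : 'Hom(P, umod S), om_hom k & h = (k \o inX)%VF.

Fact extends_subspace : subspace_pred extends.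
Proof.
split.
  exists 0; last by rewrite comp_lfun0l.
  by case: (Homs_subproof P (umod S)).
move=> a _ _ [h hh ->] [k hk ->]; exists (a *: h + k).
  by case: (Homs_subproof P (umod S)) => _; apply.
by rewrite comp_lfunDl comp_lfunZl.
Qed.

Definition extendable : {vspace 'Hom(ker_am, S)} := vspace_of extends_subspace.

Let hSm := am_P (umod S).

Let HXP (h : 'Hom(ker_am, umod S)) : h \in HX <-> om_hom h.
Proof. exact: mem_Homs. Qed.

Let homL (h : 'Hom(ker_am, S)) : h \in HX ->
  forall (x : L) w, h (op (i x) w) = op x (h w).
Proof. by move=> /HXP hh x w; rewrite [LHS]hh; exact: umod_op. Qed.

Let Psi_cocycle h : h \in HX -> lie_cocycle (Psi h).
Proof.
move=> hX x y; rewrite !PsiE am_lbr // !linearB.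
have e a b : h (toX (op (i a) (op (i b) v))) = op a (h (toX (op (i b) v))).
  by rewrite toX_op //; exact: (homL hX).
by congr (_ - _); exact: e.
Qed.

(** If h(x v) = x s for all x in L then h extends to P by sending v to s. *)
Let Psi_coboundary h : h \in HX ->
  (Psi h \in coboundaries S <-> h \in extendable).
Proof.
move=> hX; split=> [/mem_vspace_of[s hs]|/mem_vspace_of[k hk ->]]; last first.
  apply/mem_vspace_of; exists (k v) => x.
  by rewrite PsiE comp_lfunE toXK // hk; exact: umod_op.
apply/mem_vspace_of; pose gF m : F := g m.
have gFL : linear (fun m => gF m *: v).
  by move=> a m n; rewrite /gF linearP /= scalerDl scalerA.
have gSL : linear (fun m => gF m *: s).
  by move=> a m n; rewrite /gF linearP /= scalerDl scalerA.
pose k : 'Hom(P, umod S) := (h \o toX \o (\1 - lin_of gFL) + lin_of gSL)%VF.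
have kE m : k m = h (toX (m - gF m *: v)) + gF m *: s.
  rewrite /k add_lfunE 2!comp_lfunE add_lfunE opp_lfunE.
  congr (h (toX (_ - _)) + _); [exact: id_lfunE | exact: lin_ofE | exact: lin_ofE].
have mX m : m - gF m *: v \in X.
  rewrite memv_ker linearB linearZ /= gv subr_eq0 /gF; apply/eqP.
  by rewrite [RHS]mulr1.
exists k.
  apply: om_hom_renv => // x m; rewrite kE umod_op kE.
  have -> : gF (op (i x) m) = 0 by rewrite /gF triv_aug.
  have opE a (s1 s2 : S) : op x (s1 + a *: s2) = op x s1 + a *: op x s2.
    by rewrite linearD linearZ.
  have hE a w1 w2 : h (w1 + a *: w2) = h w1 + a *: h w2.
    by rewrite linearD linearZ.
  rewrite !scale0r subr0 addr0 opE -hs PsiE -(homL hX) -hE.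
  congr (h _); apply: inX_inj.
  have iE a w1 w2 : inX (w1 + a *: w2) = inX w1 + a *: inX w2.
    by rewrite linearD linearZ.
  rewrite iE inX_op !toXK // ?memv_ker ?triv_aug //.
  by rewrite linearB linearZ /= subrK.
apply/lfunP => w; rewrite comp_lfunE kE.
have -> : gF (inX w) = 0 by rewrite /gF g_inX.
by rewrite !scale0r subr0 addr0 inXK.
Qed.

(** Let E be the extension of F by S defined by f. The lift P -> E of g maps X
    into S, and this map h has the class of f. *)
Let Psi_surj f : lie_cocycle f -> exists2 h, h \in HX & f - Psi h \in coboundaries S.
Proof.
move=> Zf; pose E := rm_ext Zf hS.
have sndL : linear (fun e : E => e.2 : F^o) by move=> a [s c] [t d].
pose pr : 'Hom(umod E, umod (triv_rm L)) := lin_of sndL.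
have prE e : pr e = e.2 by exact: lin_ofE.
have hpr : om_hom pr.
  apply: om_hom_renv; try exact: am_P.
  move=> x e; rewrite !umod_op prE ext_omE /= [RHS]zero_lfunE //.
have spr : limg pr = fullv.
  apply/vspaceP => c; rewrite memvf; apply/memv_imgP.
  by exists ((0, c) : E); rewrite ?memvf // prE.
have [tau htau tauE] := projP hpr spr hg.
have tau2 m : (tau m : S * F^o).2 = g m by rewrite -tauE comp_lfunE prE.
have tauL (x : L) m : tau (op (i x) m) = op (M := E) x (tau m).
  by rewrite htau umod_op.
have fstL : linear (fun e : E => e.1 : S) by move=> a [s c] [t d].
pose h : 'Hom(ker_am, S) := (lin_of fstL \o tau \o inX)%VF.
have hE w : h w = (tau (inX w) : S * F^o).1 by rewrite /h 2!comp_lfunE lin_ofE.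
exists h.
  apply/HXP; apply: om_hom_renv; try exact: am_P.
  move=> x w; rewrite umod_op hE inX_op tauL ext_omE /= tau2 g_inX.
  by rewrite scale0r addr0 hE.
apply/mem_vspace_of; exists (- (tau v : S * F^o).1) => x.
rewrite add_lfunE opp_lfunE PsiE hE toXK // tauL ext_omE /= tau2 gv scale1r.
by rewrite linearN opprD addrCA subrr addr0.
Qed.

(** So h |-> (x |-> h(x v)) identifies the maps X -> S modulo those that extend
    to P with the cocycles modulo the coboundaries. *)
Theorem presentation_H1 :
  (\dim (Homs ker_am (umod S)) - \dim extendable)%N = dim_H1 S.
Proof.
set Z := vspace_of (lie_cocycle_subspace S).
set B := coboundaries S.
have eX : (extendable <= HX)%VS.
  apply/subvP => h /mem_vspace_of[k hk ->]; apply/HXP => a w.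
  by rewrite [LHS]comp_lfunE inX_op hk [in RHS]comp_lfunE.
have BZ : (B <= Z)%VS.
  apply/subvP => f /mem_vspace_of Bf; apply/mem_vspace_of.
  exact: lie_coboundary_cocycle.
have defZ : Z = (Psi @: HX + B)%VS.
  apply/eqP; rewrite eqEsubv subv_add BZ andbT; apply/andP; split.
    apply/subvP => f /mem_vspace_of/Psi_surj[h hX hB].
    by rewrite -[f](subrK (Psi h)) addrC memv_add // memv_img.
  apply/subvP => _ /memv_imgP[h hX ->]; apply/mem_vspace_of.
  exact: Psi_cocycle.
have defI : (Psi @: HX :&: B)%VS = (Psi @: extendable)%VS.
  apply/vspaceP => f; apply/idP/idP.
    rewrite memv_cap => /andP[/memv_imgP[h hX ->] /(Psi_coboundary hX)].
    exact: memv_img.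
  case/memv_imgP => h he ->; have hX := subvP eX _ he.
  by rewrite memv_cap memv_img //; apply/(Psi_coboundary hX).
have kerE : (HX :&: lker Psi = extendable :&: lker Psi)%VS.
  apply/eqP; rewrite eqEsubv; apply/andP; split; last exact: capvS.
  rewrite subv_cap capvSr andbT; apply/subvP => h.
  rewrite memv_cap memv_ker => /andP[hX /eqP h0].
  by apply/(Psi_coboundary hX); rewrite h0 mem0v.
have d1 := dimv_sum_cap (Psi @: HX) B; rewrite -defZ defI in d1.
have d2 := limg_ker_dim Psi HX; have d3 := limg_ker_dim Psi extendable.
rewrite -kerE in d3; rewrite /dim_H1 -/Z -/(coboundaries S) -/B -d2 -d3.
have eP : (\dim (Psi @: extendable) <= \dim (Psi @: HX))%N by rewrite dimvS ?limgS.
by rewrite subnDl; apply/eqP; rewrite -(eqn_add2r (\dim B)) subnK ?dimvS //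
  addnC addnBA // addnC -d1 addnK.
Qed.

End Presentation.

Section Resolution.
Variables (F : fieldType) (p : nat) (L : restrictedLie F p) (S : restModule L).
Hypothesis hS : nontriv_irr S.
Local Notation N0 := (umod (triv_rm L)).

(** In the free resolution, a cocycle of degree one is a map on the syzygy X of
    F, and it is a coboundary when it extends to the free module. *)
Theorem dim_Hres_H1 : dim_Hres 1 S = dim_H1 S.
Proof.
have hg := fcover_hom (N := N0); have sg := fcover_surj N0.
rewrite -(presentation_H1 hS (free_proj (n := _)) hg sg).
pose K := ker_am hg; pose q : 'Hom(res N0 1, K) := fcover (syz N0 1).
have hq : om_hom q := fcover_hom (N := syz N0 1).
have sq : limg q = fullv := fcover_surj (syz N0 1).
have qV w : q ((q^-1)%VF w) = w by rewrite limg_lfunVK // sq memvf.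
have PhiL : linear (fun h : 'Hom(K, umod S) => (h \o q)%VF).
  by move=> a h k; rewrite comp_lfunDl comp_lfunZl.
pose Phi := lin_of PhiL.
have PhiE h w : Phi h w = h (q w) by rewrite lin_ofE comp_lfunE.
have inj V : \dim (Phi @: V) = \dim V.
  apply: limg_dim_eq; apply/eqP; rewrite -subv0; apply/subvP => h.
  rewrite memv_cap memv_ker memv0 => /andP[_ /eqP h0]; apply/eqP/lfunP => w.
  by rewrite -(qV w) -PhiE h0 !zero_lfunE.
rewrite /dim_Hres /dim_Ext -(inj (Homs _ _)) -(inj (extendable S hg)).
congr (_ - _)%N; congr (\dim _); apply/vspaceP => f; apply/idP/idP.
- move=> /mem_vspace_of[hf df].
  have dft t : f (res_d N0 1 t) = 0 by rewrite -comp_lfunE df zero_lfunE.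
  have fq w w' : q w = q w' -> f w = f w'.
    move=> /eqP; rewrite -subr_eq0 -linearB -memv_ker -(limg_res_d N0 1).
    case/memv_imgP => t _ wt; apply/eqP; rewrite -subr_eq0 -linearB wt.
    by apply/eqP; exact: dft.
  pose h : 'Hom(K, umod S) := (f \o q^-1)%VF.
  have hE w : h (q w) = f w by rewrite comp_lfunE; apply: fq; rewrite qV.
  have -> : f = Phi h by apply/lfunP => w; rewrite PhiE hE.
  apply/memv_img/mem_Homs => a w; rewrite -(qV w) -hq !hE; exact: hf.
- case/memv_imgP => h /mem_Homs hh ->; apply/mem_vspace_of; split.
    by move=> a w; rewrite !PhiE hq hh.
  apply/lfunP => w; rewrite comp_lfunE PhiE zero_lfunE.
  have : res_d N0 1 w \in lker q.
    by rewrite -(limg_res_d N0 1) memv_img ?memvf.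
  by rewrite memv_ker => /eqP ->; rewrite linear0.
- move=> /mem_vspace_of[k hk ->].
  rewrite (_ : (k \o _)%VF = Phi (k \o fsyz_in N0)%VF); last first.
    by apply/lfunP => w; rewrite PhiE !comp_lfunE.
  apply/memv_img/mem_vspace_of; exists k => //.
- case/memv_imgP => h /mem_vspace_of[k hk ->] ->; apply/mem_vspace_of.
  by exists k => //; apply/lfunP => w; rewrite PhiE !comp_lfunE.
Qed.

(** A map from the projective cover of F to S that is nonzero on the kernel X
    is surjective there, and then its kernel is everything because X is
    superfluous; one that vanishes on X has values in the invariants of S. *)
Lemma proj_cover_H1 (P : amodule (renv L)) (g : 'Hom(P, N0))
    (hg : om_hom g) : is_proj_cover g ->
  \dim (Homs (ker_am hg) (umod S)) = dim_H1 S.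
Proof.
case=> projP _ sg small; rewrite -(presentation_H1 hS projP hg sg).
suff -> : extendable S hg = 0%VS by rewrite dimv0 subn0.
apply/eqP; rewrite -subv0; apply/subvP => _ /mem_vspace_of[k hk ->].
suff -> : k = 0 by rewrite comp_lfun0l mem0v.
have sX := stable_lker hg.
have sI : stable (M := S) (k @: lker g)%VS.
  move=> x _ /memv_imgP[w wX ->]; rewrite -umod_op.
  have := hk (renv_in L x) w => <-; exact/memv_img/(sX _ w wX).
have [[_ irS] _] := hS; case: (irS _ sI) => kX.
  apply/lfunP => m; rewrite zero_lfunE; apply: (invariants0 hS) => x.
  rewrite -umod_op -[LHS]hk; apply/eqP; rewrite -memv0 -kX memv_img //.
  by rewrite memv_ker triv_aug.
suff kf : lker k = fullv.
  by apply/lfunP => m; rewrite zero_lfunE; apply/eqP; rewrite -memv_ker kf memvf.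
apply: small; first exact: stable_lker.
apply/vspaceP => m; rewrite memvf.
have : k m \in (k @: lker g)%VS by rewrite kX memvf.
case/memv_imgP => w wX kmw; rewrite -(subrK w m) memv_add //.
by rewrite memv_ker linearB /= kmw subrr.
Qed.

End Resolution.

(** * Semisimplicity modulo the radical *)

Definition maximal_stable (F : fieldType) (X : Type) (M : opmod F X)
    (W : {vspace M}) :=
  [/\ stable W, W != fullv &
    forall V : {vspace M}, stable V -> (W <= V)%VS -> V = W \/ V = fullv].

Section Stable.
Variables (F : fieldType) (X : Type) (M : opmod F X).

Lemma stableD (U V : {vspace M}) : stable U -> stable V -> stable (U + V)%VS.
Proof.
move=> sU sV x _ /memv_addP[u uU [v vV ->]].
by rewrite linearD memv_add ?sU ?sV.
Qed.

Lemma stableI (U V : {vspace M}) : stable U -> stable V -> stable (U :&: V)%VS.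
Proof. by move=> sU sV x v; rewrite !memv_cap => /andP[*]; rewrite sU ?sV. Qed.

(** A submodule C of least dimension with C + U = M meets U in K: otherwise it
    could be cut down by a maximal submodule. *)
Lemma complement_ex (K : {vspace M}) :
  (forall m, m \notin K -> exists2 W, maximal_stable W & m \notin W) ->
  forall U : {vspace M}, stable U -> exists C : {vspace M},
    [/\ stable C, (C + U)%VS = fullv & (C :&: U <= K)%VS].
Proof.
move=> maxK U sU; have [|d [C [sC CU dC]] dmin] := @min_nat_ex
    (fun d => exists C : {vspace M}, [/\ stable C, (C + U)%VS = fullv & \dim C = d]).
  exists (\dim {:M}), fullv; split=> //; first exact: stablef.
  by apply/eqP; rewrite eqEsubv subvf addvSl.
exists C; split=> //; apply/subvP => m; rewrite memv_cap => /andP[mC mU].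
apply/contraT => /maxK[W [sW _ maxW] mW].
have WCU : (W + (C :&: U))%VS = fullv.
  have [||E|//] := maxW (W + (C :&: U))%VS; last 1 first.
  - case/negP: mW; rewrite -E; apply: (subvP (addvSr _ _)).
    by rewrite memv_cap mC.
  - by apply: stableD => //; apply: stableI.
  - exact: addvSl.
have C'U : ((C :&: W) + U)%VS = fullv.
  apply/eqP; rewrite eqEsubv subvf -CU subv_add addvSr andbT.
  apply/subvP => c cC; have : c \in (W + (C :&: U))%VS by rewrite WCU memvf.
  case/memv_addP => w wW [u]; rewrite memv_cap => /andP[uC uU] cE.
  rewrite cE memv_add // memv_cap wW andbT.
  by rewrite -(addrK u w) -cE memvB.
have : (d <= \dim (C :&: W))%N.
  by apply: dmin; exists (C :&: W)%VS; split=> //; exact: stableI.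
rewrite -dC => dCW; have /eqP CW : (C :&: W == C)%VS by rewrite eqEdim capvSl.
by case/negP: mW; move: mC; rewrite -CW memv_cap => /andP[].
Qed.

End Stable.

Section Jacobson.
Variables (F : fieldType) (A : falgType F).

Definition reg_om : opmod F A := @OpMod F A A (fun a => amull a).

Lemma reg_omE a (b : reg_om) : op a b = a * b.
Proof. by rewrite /= lfunE. Qed.

Lemma Jac_left : left_ideal (Jac A).
Proof.
move=> a x /mem_vspace_of xJ; apply/mem_vspace_of => I mI.
by case: (mI) => lI _ _; apply/lI/xJ.
Qed.

Lemma Jac_maximal a : a \notin Jac A ->
  exists2 W : {vspace reg_om}, maximal_stable W & a \notin W.
Proof.
move=> aJ; have : ~ (forall I : {vspace A}, max_left_ideal I -> a \in I).
  by move=> h; case/negP: aJ; apply/mem_vspace_of.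
move/existsNP => [I /not_implyP[[lI nI mI] /negP aI]]; exists I => //; split.
- by move=> b x xI; rewrite reg_omE; exact: lI.
- exact/eqP.
- move=> V sV IV; apply: mI => // b x xV; rewrite -reg_omE; exact: sV.
Qed.

Section Module.
Variables (M : opmod F A) (hM : is_amodule M).

Fact orbit_linear (m : M) : linear (fun a : A => op a m).
Proof. by move=> c a b; case: hM => -> _ _; rewrite lfunZDE. Qed.

Definition orbit_map (m : M) : 'Hom(A, M) := lin_of (orbit_linear m).

Lemma orbit_mapE m a : orbit_map m a = op a m. Proof. exact: lin_ofE. Qed.

Let opM a b (m : M) : op (a * b) m = op a (op b m).
Proof. by case: hM => _ _ ->; rewrite comp_lfunE. Qed.

Let op1 (m : M) : op (1 : A) m = m.
Proof. by case: hM => _ -> _; rewrite id_lfunE. Qed.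

Lemma orbit_stable (I : {vspace A}) m : left_ideal I ->
  stable (orbit_map m @: I)%VS.
Proof.
move=> lI a _ /memv_imgP[b bI ->]; rewrite orbit_mapE -opM -orbit_mapE.
by rewrite memv_img // lI.
Qed.

Lemma orbit_pre_left (W : {vspace M}) m : stable W ->
  left_ideal (orbit_map m @^-1: W)%VS.
Proof.
move=> sW a b; rewrite -!memv_preim !orbit_mapE opM; exact: sW.
Qed.

(** The annihilator of a nonzero vector of M is a maximal left ideal. *)
Lemma Jac_irr a (m : M) : irreducible M -> a \in Jac A -> op a m = 0.
Proof.
move=> [_ irM] aJ; have [->|m0] := eqVneq m 0; first exact: linear0.
have /mem_vspace_of/(_ (lker (orbit_map m))) : a \in Jac A by [].
rewrite memv_ker orbit_mapE => h; apply/eqP/h; split.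
- by move=> b x; rewrite !memv_ker !orbit_mapE opM => /eqP ->; rewrite linear0.
- move=> kf; have := memvf (1 : A); rewrite -kf memv_ker orbit_mapE op1.
  by rewrite (negPf m0).
move=> I lI kI; case: (irM _ (orbit_stable (m := m) lI)) => Im.
  left; apply/eqP; rewrite eqEsubv kI andbT; apply/subvP => b bI.
  by rewrite memv_ker -memv0 -Im memv_img.
right; have : m \in (orbit_map m @: I)%VS by rewrite Im memvf.
case/memv_imgP => b bI mb.
have I1 : (1 : A) \in I.
  rewrite -(subrK b 1) memvD //; apply: (subvP kI).
  by rewrite memv_ker linearB /= -mb orbit_mapE op1 subrr.
apply/vspaceP => x; rewrite memvf; have := lI x 1 I1; by rewrite mulr1.
Qed.

(** This expresses the semisimplicity of M / K. Let W be maximal among the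
    submodules containing K but not m. For q in M, the left ideal of all a with
    a q in W + A m has a complement C modulo Jac A. Then W + C q avoids m, so
    C q <= W, and q itself lies in W + A m. *)
Lemma Jac_separates (K : {vspace M}) : stable K ->
  (forall a m, a \in Jac A -> op a m \in K) ->
  forall m, m \notin K -> exists2 W : {vspace M}, maximal_stable W & m \notin W.
Proof.
move=> sK JK m mK; pose P d := exists W : {vspace M},
  [/\ stable W, (K <= W)%VS, m \notin W & \dim W = d].
have [||d [W [sW KW mW dW]] dmax] := @max_nat_ex P (\dim {:M}).
- by exists (\dim K), K.
- by move=> d [W [_ _ _ <-]]; rewrite dimvS ?subvf.
have maxW V : stable V -> (W <= V)%VS -> m \notin V -> V = W.
  move=> sV WV mV; apply/esym/eqP; rewrite eqEdim WV dW.
  by apply: dmax; exists V; split=> //; exact: subv_trans WV.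
pose T := (W + orbit_map m @: fullv)%VS.
have sT : stable T by apply: stableD => //; apply: orbit_stable => a x _; exact: memvf.
have mT : m \in T.
  apply: (subvP (addvSr _ _)); rewrite -[X in X \in _](op1 m) -orbit_mapE.
  exact/memv_img/memvf.
have Tf : T = fullv.
  apply/vspaceP => q; rewrite memvf; pose U := (orbit_map q @^-1: T)%VS.
  have [|C [sC CU CUJ]] := @complement_ex F A reg_om (Jac A) Jac_maximal U.
    by move=> a x xU; rewrite reg_omE; exact: orbit_pre_left.
  have lC : left_ideal C by move=> a x xC; rewrite -reg_omE; exact: sC.
  pose D := (W + orbit_map q @: C)%VS.
  have DW : D = W.
    apply: maxW; first by apply: stableD => //; exact: orbit_stable.
      exact: addvSl.
    apply: contra (mW) => /memv_addP[w wW [_ /memv_imgP[c cC ->] mE]].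
    rewrite mE memvD //; apply: (subvP KW); rewrite orbit_mapE; apply: JK.
    apply: (subvP CUJ); rewrite memv_cap cC -memv_preim.
    have -> : orbit_map q c = m - w by rewrite mE addrC addKr.
    by rewrite memvB // (subvP (addvSl _ _)).
  have CsU : (C <= U)%VS.
    apply/subvP => c cC; rewrite -memv_preim (subvP (addvSl _ _)) // -DW.
    by rewrite (subvP (addvSr _ _)) // memv_img.
  have : (1 : A) \in (C + U)%VS by rewrite CU memvf.
  have /subvP sub : (C + U <= U)%VS by rewrite subv_add CsU subvv.
  by move/sub; rewrite -memv_preim orbit_mapE op1.
exists W => //; split=> //.
  by apply: contraNneq mW => Wf; rewrite Wf memvf.
move=> V sV WV; case: (boolP (m \in V)) => mV; last by left; exact: maxW.
right; apply/eqP; rewrite eqEsubv subvf -Tf subv_add WV; apply/subvP => w.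
by case/memv_imgP => a _ ->; rewrite orbit_mapE sV.
Qed.

Lemma act_span_sub (I : {vspace A}) (U W : {vspace M}) :
  (forall a m, a \in I -> m \in U -> op a m \in W) -> (act_span I U <= W)%VS.
Proof.
move=> h; apply/span_subvP.
by move=> _ /allpairsP[[a m] [/= /vbasis_mem aI /vbasis_mem mU ->]]; exact: h.
Qed.

Lemma act_span_stable (I : {vspace A}) (U : {vspace M}) :
  left_ideal I -> stable (act_span I U).
Proof.
move=> lI a m mI; suff /subvP/(_ m mI) : (act_span I U <= op a @^-1: act_span I U)%VS.
  by rewrite -memv_preim.
apply: act_span_sub => b u bI uU; rewrite -memv_preim -opM.
by apply: mem_act_span => //; exact: lI.
Qed.

End Module.

End Jacobson.

(** * The second Loewy layer *)

Section Multiplicity.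
Variables (F : fieldType) (X : Type) (M S : opmod F X).
Hypothesis irS : irreducible S.

Fact vanishing_Homs_subspace (W : {vspace M}) :
  subspace_pred (fun f : 'Hom(M, S) => om_hom f /\ forall w, w \in W -> f w = 0).
Proof.
have [h0 h] := Homs_subproof M S; split.
  by split=> // w _; rewrite zero_lfunE.
move=> a f g [hf fW] [hg gW]; split; first exact: h.
by move=> w wW; rewrite lfunZDE fW // gW // scaler0 addr0.
Qed.

(** Filter Hom(M, S) by vanishing on the terms of a composition series. A factor
    isomorphic to S contributes a copy of End(S), because the complement allows
    a map on a term of the series to be extended to M. *)
Lemma dim_Homs_mult :
  (forall U : {vspace M}, stable U -> exists C : {vspace M},
     [/\ stable C, (C + U)%VS = fullv & (C :&: U)%VS = 0%VS]) ->
  \dim (Homs M S) = (comp_mult M S * \dim (Homs S S))%N.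
Proof.
move=> compl; rewrite /comp_mult; case: cid => -[n c] /= [c0 cn sc cc].
pose Z j := vspace_of (vanishing_Homs_subspace (c j)).
pose cnt j : nat := `[< om_iso (om_factor (c j) (c j.+1)) S >].
have -> : #|[set j : 'I_n | `[< om_iso (om_factor (c j) (c j.+1)) S >]]| =
    (\sum_(0 <= j < n) cnt j)%N.
  by rewrite cardsE -sum1_card big_mkord big_mkcond; apply: eq_bigr.
have -> : Homs M S = Z 0%N.
  apply/vspaceP => f; apply/idP/idP => [/mem_Homs hf|/mem_vspace_of[hf _]].
    apply/mem_vspace_of; split=> // w; rewrite c0 memv0 => /eqP ->.
    exact: linear0.
  exact/mem_Homs.
have Zn : Z n = 0%VS.
  apply/eqP; rewrite -subv0; apply/subvP => f /mem_vspace_of[_ fn].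
  by rewrite memv0; apply/eqP/lfunP => m; rewrite zero_lfunE fn // cn memvf.
suff filt j : (j <= n)%N ->
    \dim (Z 0%N) = (\dim (Z j) + (\sum_(0 <= i < j) cnt i) * \dim (Homs S S))%N.
  by rewrite (filt n) // Zn dimv0.
elim: j => [|j IH] jn; first by rewrite big_nil addn0.
rewrite (IH (ltnW jn)) big_nat_recr //= mulnDl [in RHS]addnCA addnC.
congr addn; have [cj irT] := cc _ jn.
have sW := sc _ (ltnW jn); have sU := sc _ jn.
have Zop f x u : f \in Z j -> u \in c j.+1 -> f (op x u) = op x (f u).
  by move=> /mem_vspace_of[hf _] _; exact: hf.
have ZW f w : f \in Z j -> w \in c j -> f w = 0.
  by move=> /mem_vspace_of[_ fW]; exact: fW.
have Zcomp phi f : om_hom phi -> f \in Z j -> (phi \o f)%VF \in Z j.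
  move=> hphi /mem_vspace_of[hf fW]; apply/mem_vspace_of; split=> [x m|w wW].
    by rewrite !comp_lfunE hf hphi.
  by rewrite comp_lfunE fW // linear0.
have Z'E f : f \in Z j.+1 <-> f \in Z j /\ forall u, u \in c j.+1 -> f u = 0.
  split=> [/mem_vspace_of[hf fU]|[/mem_vspace_of[hf _] fU]].
    split=> //; apply/mem_vspace_of; split=> // w wW.
    by apply: fU; exact: (subvP cj).
  by apply/mem_vspace_of; split.
have [[f [u [fZ uU fu]]]|no] := pselect (exists f u,
    [/\ f \in Z j, u \in c j.+1 & f u != 0]).
  have [iso ->] := restriction_dim sW sU irT irS Zop ZW Zcomp Z'E fZ uU fu.
  by rewrite /cnt (_ : `[< _ >]) ?mul1n //; apply/asboolP.
rewrite /cnt (_ : `[< _ >] = false).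
  rewrite addn0; congr (\dim _); apply: (restriction_dim0 Z'E).
  by move=> f u fZ uU; apply/eqP/contraT => fu; case: no; exists f, u.
apply/asboolP => -[phi [hphi kphi _]]; case: no.
have [C [sC CU CU0]] := compl _ sU; pose U := c j.+1.
have UC0 : (U :&: C = 0)%VS by rewrite capvC.
have UCf m : m \in (U + C)%VS by rewrite addvC CU memvf.
pose pr := daddv_pi U C.
have prU u : u \in U -> pr u = u by exact: daddv_pi_id.
have prC m : m - pr m \in C.
  by rewrite -{1}(daddv_pi_add UC0 (UCf m)) addrC addKr memv_pi.
have pr0 m : m \in C -> pr m = 0.
  move=> mC; have : pr m \in (U :&: C)%VS.
    by rewrite memv_cap memv_pi /= -[pr m](subKr m) memvB.
  by rewrite UC0 memv0 => /eqP.
have hpr x m : pr (op x m) = op x (pr m).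
  have -> : op x m = op x (m - pr m) + op x (pr m) by rewrite -linearD subrK.
  rewrite linearD /= pr0; last exact/(sC x)/prC.
  by rewrite add0r prU //; exact/(sU x)/memv_pi.
have [u uU uW] : exists2 u, u \in U & u \notin c j.
  case: irT => T0 _; apply: contraNP T0 => h; rewrite -subv0; apply/subvP => t _.
  have [u uU <-] := toq_surj t; rewrite memv0 toq_eq0 //.
  by apply/contraT => uW; case: h; exists u.
pose f := (phi \o toq (c j) U \o pr)%VF.
have fE m : f m = phi (toq (c j) U (pr m)) by rewrite /f !comp_lfunE.
exists f, u; split=> //.
  apply/mem_vspace_of; split=> [x m|w wW].
    by rewrite !fE hpr toq_op ?memv_pi // hphi.
  rewrite fE prU ?(subvP cj) //.
  have /eqP -> : toq (c j) U w == 0 by rewrite toq_eq0 // (subvP cj).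
  exact: linear0.
rewrite fE prU // -memv_ker kphi memv0 toq_eq0 //.
Qed.

End Multiplicity.

Section Layer.
Variables (F : fieldType) (A : falgType F).

Lemma is_amodule_quot (M : opmod F A) (W : {vspace M}) :
  is_amodule M -> stable W -> is_amodule (om_quot W).
Proof.
move=> [hl h1 hM] sW; split.
- move=> a x y; apply/lfunP => v; rewrite -(qreprK v) om_quotE // hl.
  by rewrite !lfunZDE linearP !(om_quotE _ _ sW).
- by apply/lfunP => v; rewrite -(qreprK v) om_quotE // h1 !id_lfunE.
- move=> a b; apply/lfunP => v; rewrite -(qreprK v) om_quotE // hM.
  by rewrite comp_lfunE [RHS]comp_lfunE !(om_quotE _ _ sW).
Qed.

Lemma sub_Jac2 : (Jac A ^+ 2 <= Jac A)%VS.
Proof. by rewrite expv2; apply/prodvP => a b _ bJ; exact: Jac_left. Qed.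

Lemma Jac2_left : left_ideal (Jac A ^+ 2)%VS.
Proof.
move=> a x xJ; rewrite expv2.
suff /subvP/(_ _ xJ) : (Jac A ^+ 2 <= amull a @^-1: (Jac A * Jac A))%VS.
  by rewrite -memv_preim lfunE.
rewrite expv2; apply/prodvP => b d bJ dJ.
by rewrite -memv_preim lfunE /= mulrA memv_mul // Jac_left.
Qed.

Variables (P N S : amodule A) (g : 'Hom(P, N)) (hg : om_hom g).
Hypotheses (cg : is_proj_cover g) (irN : irreducible N) (irS : irreducible S).

Let hP := am_P P.
Let JP := @act_span F A P (Jac A) fullv.
Let J2P := @act_span F A P (Jac A ^+ 2)%VS fullv.
Let sJP : stable JP. Proof. exact: (act_span_stable hP (@Jac_left F A)). Qed.
Let sJ2P : stable J2P. Proof. exact: (act_span_stable hP Jac2_left). Qed.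

(** The kernel of a projective cover of an irreducible module is the unique
    maximal submodule, hence the radical. *)
Lemma proj_cover_rad : JP = lker g.
Proof.
have [_ _ sg small] := cg; apply/eqP; rewrite eqEsubv; apply/andP; split.
  apply: act_span_sub => a m aJ _; rewrite memv_ker hg.
  by rewrite (Jac_irr (am_P N)).
apply/subvP => m mX; apply/contraT => mJ.
have [|W [sW nW maxW] mW] := Jac_separates hP sJP _ mJ.
  by move=> a q aJ; apply: mem_act_span => //; exact: memvf.
have [||E|E] := maxW (W + lker g)%VS.
- by apply: stableD => //; exact: stable_lker.
- exact: addvSl.
- by case/negP: mW; rewrite -E (subvP (addvSr _ _)).
- by case/eqP: nW; exact: small.
Qed.

Let J2JP : (J2P <= JP)%VS.
Proof.
apply: act_span_sub => a m aJ _; apply: mem_act_span; rewrite ?memvf //.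
exact: (subvP sub_Jac2).
Qed.

Let JJP a m : a \in Jac A -> m \in JP -> op a m \in J2P.
Proof.
move=> aJ mJ; suff /subvP/(_ m mJ) : (JP <= op a @^-1: J2P)%VS.
  by rewrite -memv_preim.
apply: act_span_sub => b q bJ _; rewrite -memv_preim -comp_lfunE.
have [_ _ <-] := hP; apply: mem_act_span; rewrite ?memvf //.
by rewrite expv2 memv_mul.
Qed.

(** The radical kills S, so every map Jac P -> S factors through
    Jac P / Jac^2 P, which is semisimple. *)
Theorem rad_layer_mult :
  \dim (Homs (AModule (is_amodule_sub hP (stable_lker hg))) S) =
  (comp_mult (rad_layer P) S * \dim (Homs S S))%N.
Proof.
set K := AModule _; have hS := am_P S.
have hR : is_amodule (rad_layer P).
  exact: (is_amodule_sub (is_amodule_quot hP sJ2P) (stable_qimg sJ2P sJP)).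
have JR a (t : rad_layer P) : a \in Jac A -> op a t = 0.
  move=> aJ; have [m mJ <-] := toq_surj t.
  by rewrite -[LHS]toq_op //; apply/eqP; rewrite [_ == _]toq_eq0 ?JJP ?sJP.
rewrite -(dim_Homs_mult irS); last first.
  move=> U sU; have [|C [sC CU CU0]] := @complement_ex _ _ (rad_layer P) 0%VS _ U sU.
    apply: (Jac_separates hR); first exact: stable0.
    by move=> a t aJ; rewrite JR // mem0v.
  by exists C; split=> //; apply/eqP; rewrite -subv0.
pose inK : 'Hom(K, P) := linfun vsval.
have inKE w : inK w = vsval w by rewrite lfunE.
have inK_op a w : inK (op a w) = op a (inK w).
  by rewrite !inKE [LHS]om_subE //; exact: stable_lker.
have inKJ w : inK w \in JP.
  by rewrite inKE proj_cover_rad; exact: subvsP.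
pose toK : 'Hom(P, K) := linfun (vsproj (lker g)).
have inK_inj w w' : inK w = inK w' -> w = w'.
  by rewrite !inKE => h; apply: val_inj.
have toKK m : m \in JP -> inK (toK m) = m.
  by rewrite proj_cover_rad => mX; rewrite inKE lfunE /= vsprojK.
pose q : 'Hom(K, rad_layer P) := (toq J2P JP \o inK)%VF.
have qE w : q w = toq J2P JP (inK w) by exact: comp_lfunE.
have q_op a w : q (op a w) = op a (q w).
  by rewrite !qE inK_op [LHS]toq_op.
have q_surj t : exists w, q w = t.
  by have [m mJ <-] := toq_surj t; exists (toK m); rewrite qE toKK.
have PhiL : linear (fun h : 'Hom(rad_layer P, S) => (h \o q)%VF).
  by move=> a h k; rewrite comp_lfunDl comp_lfunZl.
pose Phi := lin_of PhiL.
have PhiE h w : Phi h w = h (q w) by rewrite lin_ofE comp_lfunE.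
rewrite -(limg_dim_eq (f := Phi) (U := Homs (rad_layer P) S)); last first.
  apply/eqP; rewrite -subv0; apply/subvP => h.
  rewrite memv_cap memv_ker memv0 => /andP[_ /eqP h0]; apply/eqP/lfunP => t.
  by have [w <-] := q_surj t; rewrite -PhiE h0 !zero_lfunE.
congr (\dim _); apply/vspaceP => h; apply/idP/idP; last first.
  case/memv_imgP => k /mem_Homs hk ->; apply/mem_Homs => a w.
  by rewrite !PhiE q_op hk.
move/mem_Homs => hh.
have h0 m : m \in J2P -> h (toK m) = 0.
  suff /subvP sub : (J2P <= lker (h \o toK) :&: JP)%VS.
    by move/sub; rewrite memv_cap memv_ker comp_lfunE => /andP[/eqP].
  rewrite subv_cap J2JP andbT.
  have toK_op a x : x \in JP -> toK (op a x) = op a (toK x).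
    by move=> mJ; apply: inK_inj; rewrite inK_op !toKK ?sJP.
  have -> : J2P = act_span (Jac A) JP.
    apply/eqP; rewrite eqEsubv; apply/andP; split; last first.
      by apply: act_span_sub => a x aJ xJ; exact: JJP.
    apply: act_span_sub => a x; rewrite expv2 => aJ _.
    suff /subvP/(_ a aJ) :
        (Jac A * Jac A <= orbit_map hP x @^-1: act_span (Jac A) JP)%VS.
      by rewrite -memv_preim orbit_mapE.
    apply/prodvP => b d bJ dJ; rewrite -memv_preim orbit_mapE.
    have [_ _ ->] := hP; rewrite comp_lfunE; apply: mem_act_span => //.
    by apply: mem_act_span => //; exact: memvf.
  apply: act_span_sub => a x aJ xJ; rewrite memv_ker comp_lfunE toK_op //.
  by rewrite hh (Jac_irr hS).
pose lift : 'Hom(rad_layer P, P) :=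
  (qrepr J2P \o linfun (vsval : subvs_of (qproj J2P @: JP)%VS -> _))%VF.
have liftB m : m \in JP -> lift (toq J2P JP m) - m \in J2P.
  move=> mJ; have -> : lift (toq J2P JP m) = qrepr J2P (qproj J2P m).
    rewrite comp_lfunE; congr (fun_of_lfun (qrepr J2P) _); rewrite lfunE; exact: val_toq.
  exact: qrepr_projB.
pose k : 'Hom(rad_layer P, S) := (h \o toK \o lift)%VF.
have kE w : k (q w) = h w.
  rewrite /k 2!comp_lfunE qE; apply/eqP.
  have -> : h w = h (toK (inK w)) by congr (h _); apply: inK_inj; rewrite toKK.
  by rewrite -subr_eq0 -linearB -linearB; apply/eqP/h0/liftB.
have -> : h = Phi k by apply/lfunP => w; rewrite PhiE kE.
apply/memv_img/mem_Homs => a t; have [w <-] := q_surj t.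
by rewrite -q_op !kE hh.
Qed.

End Layer.

(** * The principal block *)

Section Blocks.
Variables (F : fieldType) (A : falgType F).
Implicit Types I J : {vspace A}.

Lemma two_sided_sum (T : finType) (P : pred T) (B : T -> {vspace A}) :
  (forall i, P i -> two_sided (B i)) -> two_sided (\sum_(i | P i) B i)%VS.
Proof.
move=> h a x /memv_sumP[y yB ->]; rewrite mulr_sumr mulr_suml.
by split; apply: memv_suml => i Pi; apply: subvP (sumv_sup i Pi (subvv _)) _ _;
  case: (h i Pi a (y i) (yB i Pi)).
Qed.

(** Split a two-sided ideal until all summands are indecomposable. *)
Lemma block_split I : two_sided I -> exists n (B : 'I_n -> {vspace A}),
  [/\ forall i, indecomposable_ideal (B i),
      \dim (\sum_i B i)%VS = (\sum_i \dim (B i))%N & (\sum_i B i)%VS = I].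
Proof.
have [k] := ubnP (\dim I); elim: k => // k IH in I *.
rewrite ltnS => dI tI; have [->|I0] := eqVneq I 0%VS.
  exists 0%N, (fun=> 0%VS); split; first by case.
    by rewrite !big_ord0 dimv0.
  by rewrite big_ord0.
have [indI|decI] := pselect (indecomposable_ideal I).
  by exists 1%N, (fun=> I); rewrite !big_ord1; split.
have [I1 [I2 [t1 t2 I12 I120 [n1 n2]]]] : exists I1 I2,
    [/\ two_sided I1, two_sided I2, (I1 + I2)%VS = I, (I1 :&: I2)%VS = 0%VS &
        I1 <> 0%VS /\ I2 <> 0%VS].
  apply: contrapT => h; apply: decI; split=> //; first exact/eqP.
  move=> I1 I2 t1 t2 I12 I120; apply: contrapT => /not_orP[n1 n2].
  by apply: h; exists I1, I2.
have dE : (\dim I1 + \dim I2 = \dim I)%N.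
  by rewrite -I12 dimv_disjoint_sum.
have pos J : J <> 0%VS -> (0 < \dim J)%N by move/eqP; rewrite lt0n dimv_eq0.
have lt1 : (\dim I1 < k)%N.
  by apply: leq_trans dI; rewrite -dE -[X in (X < _)%N]addn0 ltn_add2l pos.
have lt2 : (\dim I2 < k)%N.
  by apply: leq_trans dI; rewrite -dE -[X in (X < _)%N]add0n ltn_add2r pos.
have [m1 [B1 [ind1 d1 s1]]] := IH I1 lt1 t1.
have [m2 [B2 [ind2 d2 s2]]] := IH I2 lt2 t2.
exists (m1 + m2)%N, (fun i => match split i with inl j => B1 j | inr j => B2 j end).
have sumE (T : Type) (idx : T) (op : Monoid.law idx) (h : {vspace A} -> T) :
  \big[op/idx]_(i < m1 + m2) h (match split i with inl j => B1 j | inr j => B2 j end) =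
  op (\big[op/idx]_i h (B1 i)) (\big[op/idx]_i h (B2 i)).
  rewrite big_split_ord; congr (op _ _); apply: eq_bigr => i _.
    by rewrite (unsplitK (inl _ i)).
  by rewrite (unsplitK (inr _ i)).
split.
- by move=> i; case: (split i).
- by rewrite (sumE _ 0%VS _ id) sumE -d1 -d2 s1 s2 dimv_disjoint_sum.
- by rewrite (sumE _ 0%VS _ id) s1 s2.
Qed.

Lemma block_decomposition_ex : exists n (B : 'I_n -> {vspace A}),
  block_decomposition B.
Proof.
have [|n [B [indB dB sB]]] := @block_split fullv.
  by move=> a x _; rewrite !memvf.
by exists n, B; split=> //; rewrite directvE /= dB.
Qed.

Lemma act_span0 (M : opmod F A) I : is_amodule M -> act_span I {:M}%VS = 0%VS ->
  forall a (m : M), a \in I -> op a m = 0.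
Proof.
move=> hM I0 a m aI; apply/eqP; rewrite -memv0 -I0.
by apply: mem_act_span => //; exact: memvf.
Qed.

Lemma irr_act_span (M : amodule A) I : two_sided I -> irreducible M ->
  act_span I {:M}%VS = 0%VS \/ in_block I M.
Proof.
move=> tI [_ irM]; apply: irM; apply: act_span_stable; first exact: am_P.
by move=> a x xI; case: (tI a x xI).
Qed.

Lemma irr_block_ex (M : amodule A) : irreducible M ->
  exists B C : {vspace A}, [/\ is_block B, two_sided B /\ two_sided C,
    (B + C)%VS = fullv, (B :&: C)%VS = 0%VS & in_block B M].
Proof.
move=> irM; have [n [B [indB dB sB]]] := block_decomposition_ex.
have tB i : two_sided (B i) by case: (indB i).
have hM := am_P M.
have [i Bi] : exists i, in_block (B i) M.
  apply: contrapT => /forallNP h; case: (irM) => /negP[]; rewrite -subv0.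
  apply/subvP => m _; have : (1 : A) \in (\sum_i B i)%VS by rewrite sB memvf.
  case/memv_sumP => e eB e1; rewrite memv0.
  have <- : op (1 : A) m = m by case: hM => _ -> _; rewrite id_lfunE.
  rewrite -orbit_mapE // e1 linear_sum big1 // => j _; rewrite [LHS]orbit_mapE.
  case: (irr_act_span (tB j) irM) => [/(act_span0 hM)-> //|/h //].
  exact: eB.
pose C := (\sum_(j | j != i) B j)%VS.
exists (B i), C; split=> //.
- by exists n, B, i; split=> //; split.
- by split=> //; apply: two_sided_sum.
- by rewrite -sB (bigD1 i).
- by move/directv_sumP: dB => /(_ i isT).
Qed.

End Blocks.

Section Principal.
Variables (F : fieldType) (p : nat) (L : restrictedLie F p) (S : restModule L).
Hypothesis hS : nontriv_irr S.
Local Notation N0 := (umod (triv_rm L)).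

Lemma triv_irr : irreducible N0.
Proof.
split; first by rewrite -dimv_eq0 dimvf.
move=> W _; have [->|W0] := eqVneq W 0%VS; [by left | right].
apply/eqP; rewrite eqEdim subvf dimvf; rewrite -dimv_eq0 -lt0n in W0.
exact: W0.
Qed.

(** Let 1 = e + e' with e in the block B of F. If B killed S, then in the
    extension of F by S the vector e (0, 1) would be a lift of 1 that is
    annihilated by L. *)
Lemma principal_block_of_cocycle (f : 'Hom(L, S)) :
  lie_cocycle f -> ~ lie_coboundary f -> in_principal_block S.
Proof.
move=> Zf nBf; have irS : irreducible (umod S).
  case: hS => -[S0 irS] _; split=> // W sW; apply: irS => x w wW.
  by rewrite -umod_op; exact: sW.
have [B [C [blB [tB tC] BC BC0 BF]]] := irr_block_ex triv_irr.
exists B; split=> //; have [BS|//] := irr_act_span tB irS.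
case: nBf; have kS := act_span0 (am_P (umod S)) BS.
pose E := rm_ext Zf hS; have hE := am_P (umod E).
have CB a b : a \in C -> b \in B -> a * b = 0.
  move=> aC bB; apply/eqP; rewrite -memv0 -BC0 memv_cap.
  by case: (tB a b bB) => -> _; case: (tC b a aC).
have : (1 : renv L) \in (B + C)%VS by rewrite BC memvf.
case/memv_addP => e eB [e' e'C e1].
have eK b : b \in B -> e * b = b.
  by move=> bB; rewrite -{2}[b]mul1r e1 mulrDl (CB e') // addr0.
have e'F (c : N0) : op e' c = 0.
  have : c \in act_span B fullv by rewrite BF memvf.
  suff /subvP sub : (act_span B fullv <= lker (op (M := N0) e'))%VS.
    by move/sub; rewrite memv_ker => /eqP.
  apply: act_span_sub => b d bB _; rewrite memv_ker -comp_lfunE.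
  have [hl _ <-] := am_P N0; rewrite CB //.
  by rewrite (_ : op (0 : renv L) = 0) ?zero_lfunE //;
    have := hl (-1) 0 0; rewrite scaler0 addr0 scaleN1r addNr.
have sndL : linear (fun d : E => d.2 : F^o) by move=> a [s c] [t d].
pose pr : 'Hom(umod E, N0) := lin_of sndL.
have prE d : pr d = d.2 by exact: lin_ofE.
have hpr : om_hom pr.
  apply: om_hom_renv; try exact: am_P.
  by move=> x d; rewrite !umod_op prE ext_omE /= [RHS]zero_lfunE.
have inL : linear (fun s : S => (s, 0) : E).
  by move=> a s t; apply: injective_projections => //=; rewrite scaler0 addr0.
pose inS : 'Hom(umod S, umod E) := lin_of inL.
have inE s : inS s = (s, 0) by exact: lin_ofE.
have hin : om_hom inS.
  apply: om_hom_renv; try exact: am_P.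
  by move=> x s; rewrite !umod_op !inE ext_omE /= scale0r addr0.
pose u : E := (0, 1); pose w : umod E := op e (u : umod E).
have w2 : (w : E).2 = 1.
  pose one : N0 := (1 : F^o).
  have : op (1 : renv L) one = one by apply: am_op1; exact: am_P.
  rewrite e1 am_opD; last exact: am_P.
  by rewrite e'F addr0 -prE hpr prE.
have Lw x : op (renv_in L x) w = 0.
  have xe : renv_in L x * e \in B by case: (tB (renv_in L x) e eB).
  have -> : op (renv_in L x) w = op e (op (renv_in L x) w).
    by rewrite -!am_opM // eK.
  rewrite umod_op ext_omE -inE -hin kS // linear0 //.
exists (- (w : E).1) => x; have := Lw x; rewrite umod_op ext_omE w2 scale1r.
move/(congr1 fst) => /= /eqP; rewrite addrC addr_eq0 => /eqP ->.
by rewrite linearN.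
Qed.

End Principal.

(** * The characterization of solvability *)

Section Main.
Variables (F : fieldType) (p : nat) (L : restrictedLie F p).

Lemma ann_nontriv_irr (S : restModule L) :
  nontriv_irr S -> nontriv_irr (ann_rm S).
Proof.
move=> [[S0 irS] nt]; split.
  split=> // W sW; apply: irS => x w wW.
  by rewrite -ann_omE; exact: sW.
case=> f [hf kf im]; apply: nt; exists f; split=> // x v.
by rewrite [RHS]zero_lfunE -ann_omE hf [LHS]zero_lfunE.
Qed.

Lemma dim_End_gt0 (S : restModule L) : nontriv_irr S -> (0 < \dim (Homs S S))%N.
Proof.
move=> [[S0 _] _]; rewrite lt0n dimv_eq0; apply: contraNneq S0 => h.
have : (\1%VF : 'End(S)) \in Homs S S by apply/mem_Homs => x v; rewrite !id_lfunE.
rewrite h memv0 => /eqP one0; rewrite -subv0; apply/subvP => v _.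
by rewrite memv0 -[v]id_lfunE one0 zero_lfunE.
Qed.

Lemma rad_layer_H1 (S : restModule L) : nontriv_irr S ->
  (comp_mult (rad_layer (proj_cover_triv L)) (umod S) * \dim (Homs S S))%N =
  dim_H1 S.
Proof.
move=> hS; rewrite /proj_cover_triv /proj_cover; case: cid => -[P g] /= cg.
have [_ hg _ _] := cg; rewrite -(proj_cover_H1 hS hg cg).
have irS : irreducible (umod S).
  case: hS => -[S0 irS] _; split=> // W sW; apply: irS => x w wW.
  by rewrite -umod_op; exact: sW.
rewrite (rad_layer_mult hg cg (triv_irr L) irS); congr (_ * \dim _)%N.
apply/vspaceP => f; have e1 := @mem_Homs _ _ S S f.
have e2 := @mem_Homs _ _ (umod S) (umod S) f.
apply/idP/idP => [/e1 hf|/e2 hf]; [apply/e2 | apply/e1].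
  by apply: om_hom_renv; try exact: am_P; move=> x v; rewrite !umod_op hf.
by move=> x v; have := hf (renv_in L x) v; rewrite !umod_op.
Qed.

(** A nonabelian chief factor N / J is perfect. If every H^1(L / Ann S, S) with S
    in the principal block vanished, every cocycle of a module S killed by J but
    not by N that vanishes on J would be a coboundary, and N / J abelian. *)
Lemma solvable_of_vanishing n (c : nat -> ideal L) : chief_series n c ->
  (forall S : restModule L, nontriv_irr S -> in_principal_block S ->
     dim_H1 (ann_rm S) = 0%N) ->
  lie_solvable L.
Proof.
move=> hc vanish; apply: (solvable_of_abelian_factors hc) => j jn.
have [_ _ /(_ j jn)[JN mN]] := hc.
have sJ : stable (M := adj L) (c j) := @idlP _ _ (c j).
have sN : stable (M := adj L) (c j.+1) := @idlP _ _ (c j.+1).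
have [_ _ cov] := chief_covers JN mN.
have dN : (derived_term (c j.+1) <= c j.+1)%VS.
  apply/span_subvP => _ /allpairsP[[x y] [/= /vbasis_mem xN /vbasis_mem yN ->]].
  exact: idl_br.
have [||| E | perf] := cov (derived_term (c j.+1) + c j)%VS.
- by apply: stableD => //; exact: derived_stable.
- exact: addvSr.
- by rewrite subv_add dN.
- move=> x y xN yN; rewrite -E; apply: (subvP (addvSl _ _)).
  exact: mem_derived_term.
apply: (factor_abelian sN _ _ sJ); first by rewrite perf.
move=> S irS JS NS f Zf fJ; apply: contrapT => nBf.
have hS : nontriv_irr S.
  split=> // -[g [hg kg _]]; apply: NS => x m _; apply/eqP.
  by rewrite -memv0 -kg memv_ker hg [op x _]zero_lfunE.
have Ja : (c j <= ann_vs S)%VS by apply/subvP => x xJ; apply/annP => s; exact: JS.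
have nNa : ~~ (c j.+1 <= ann_vs S)%VS.
  by apply/negP => /subvP Na; apply: NS => x m /Na/annP.
have := vanish S hS (principal_block_of_cocycle hS Zf nBf).
rewrite dim_H1_ann -(Zon_ann JN mN hS Ja nNa) => /eqP; rewrite subn_eq0 => le.
have BZ : (coboundaries S <= Zon S (c j))%VS.
  by rewrite (Zon_ann JN mN hS Ja nNa) coboundaries_on_ann.
apply: nBf; apply/(mem_vspace_of (lie_coboundary_subspace S)).
rewrite -/(coboundaries S); have /eqP -> : coboundaries S == Zon S (c j).
  by rewrite eqEdim BZ.
by apply/mem_vspace_of.
Qed.

End Main.

Theorem theorem5p5 (F : fieldType) (p : nat) (L : restrictedLie F p)
  (n : nat) (c : nat -> ideal L) (hc : chief_series n c) :
  [<->
    lie_solvable L;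
    forall S : restModule L, nontriv_irr S -> dim_H1 (ann_rm S) = 0%N;
    forall S : restModule L, nontriv_irr S ->
      dim_H1 S = (\dim (Homs S S) * split_mult n c S)%N;
    forall S : restModule L, nontriv_irr S -> dim_Hres 1 (ann_rm S) = 0%N;
    forall S : restModule L, nontriv_irr S -> in_principal_block S ->
      dim_Hres 1 (ann_rm S) = 0%N;
    forall S : restModule L, nontriv_irr S ->
      dim_Hres 1 S = (\dim (Homs S S) * split_mult n c S)%N;
    forall S : restModule L, nontriv_irr S -> in_principal_block S ->
      dim_Hres 1 S = (\dim (Homs S S) * split_mult n c S)%N;
    forall S : restModule L, nontriv_irr S ->
      comp_mult (rad_layer (proj_cover_triv L)) (umod S) = split_mult n c S;
    forall S : restModule L, nontriv_irr S -> in_principal_block S ->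
      comp_mult (rad_layer (proj_cover_triv L)) (umod S) = split_mult n c S
  ].
Proof.
have resA (S : restModule L) : nontriv_irr S ->
    dim_Hres 1 (ann_rm S) = dim_H1 (ann_rm S).
  by move=> hS; exact/dim_Hres_H1/ann_nontriv_irr.
have resL (S : restModule L) : nontriv_irr S -> dim_Hres 1 S = dim_H1 S.
  exact: dim_Hres_H1.
have formula := fun S hS => @dim_H1_formula F p L S n c hc hS.
have formulaP (S : restModule L) : nontriv_irr S ->
    dim_H1 S = (\dim (Homs S S) * split_mult n c S)%N <-> dim_H1 (ann_rm S) = 0%N.
  move=> hS; rewrite formula //; split=> [/eqP|->]; last by rewrite addn0.
  by rewrite -[X in _ == X]addn0 eqn_add2l => /eqP.
have layerP (S : restModule L) : nontriv_irr S ->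
    comp_mult (rad_layer (proj_cover_triv L)) (umod S) = split_mult n c S <->
    dim_H1 S = (\dim (Homs S S) * split_mult n c S)%N.
  move=> hS; rewrite -rad_layer_H1 // mulnC; split=> [-> //|/eqP].
  by rewrite eqn_pmul2l ?dim_End_gt0 // => /eqP.
tfae.
- by move=> solv S hS; exact: solvable_H1_ann.
- by move=> h S hS; apply/formulaP => //; exact: h.
- by move=> h S hS; rewrite resA //; apply/formulaP => //; exact: h.
- by move=> h S hS _; exact: h.
- move=> h S hS; rewrite resL //; apply/formulaP => //.
  apply: solvable_H1_ann => //; apply: (solvable_of_vanishing hc) => T hT bT.
  by rewrite -resA // h.
- by move=> h S hS _; exact: h.
- move=> h S hS; apply/layerP/formulaP => //.
  apply: solvable_H1_ann => //; apply: (solvable_of_vanishing hc) => T hT bT.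
  by apply/formulaP; rewrite // -resL // h.
- by move=> h S hS _; exact: h.
- move=> h; apply: (solvable_of_vanishing hc) => T hT bT.
  by apply/formulaP/layerP => //; exact: h.
Qed.
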